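(* Let $(A,[\,,\,]_A,a)$ be a Lie algebroid over a smooth manifold $M$ with a regular Nambu structure $\Pi\in\Gamma(\Lambda^nA)$ of order $n\ge3$. Assume that $\Gamma A^\ast$ is locally spanned by elements of the form $d_Af$, $f\in C^\infty(M)$. Let $\mathcal D=\Pi_{n-1}(\Lambda^{n-1}A^\ast)\subseteq A$. Then the $C^\infty(M)$-linear homomorphisms $i^k\colon\Gamma(\Lambda^kA^\ast)\to\Gamma(\Lambda^k\mathcal D^\ast)$ given by $$i^k(\alpha)(X_1,\dots,X_k)=\alpha(X_1,\dots,X_k),\qquad \alpha\in\Gamma(\Lambda^kA^\ast),\ X_i\in\Gamma(\mathcal D),$$ induce an isomorphism of complexes $\pi^\bullet\colon(\Omega^\bullet_\Pi(A),\tilde d_A)\to(\Gamma(\Lambda^\bullet\mathcal D^\ast),d_{\mathcal D})$. Thus $\mathcal H^\bullet_N(A)\cong\mathcal H^\bullet_\Pi(A)$.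
   Context: $M$ is paracompact; $d_A$ is the Lie algebroid differential on $\Gamma(\Lambda^\bullet A^\ast)$ with trivial coefficients; $\mathcal L_X$ is the Lie derivative; $[\,,\,]_A$ also denotes the Schouten bracket, with $[X,Y_1\wedge\cdots\wedge Y_k]_A=\sum_iY_1\wedge\cdots\wedge[X,Y_i]_A\wedge\cdots\wedge Y_k$. Pairing: $\langle\phi_1\wedge\cdots\wedge\phi_k,X_1\wedge\cdots\wedge X_k\rangle=\det(\phi_i(X_j))$. Contraction: $\langle\psi,\iota_\phi\xi\rangle=\langle\phi\wedge\psi,\xi\rangle$ for $\phi,\psi\in\Gamma(\Lambda^\bullet A^\ast)$, $\xi\in\Gamma(\Lambda^\bullet A)$. Write $\Pi\alpha:=\iota_\alpha\Pi$, $\Pi_k\colon\Lambda^kA^\ast\to\Lambda^{n-k}A$, $\Pi_k(\alpha)=\iota_\alpha\Pi$. Nambu structure of order $n$: $\Pi\in\Gamma(\Lambda^nA)$ with $\iota_\beta[\Pi\alpha,\Pi]_A=-\Pi(\iota_{\Pi\beta}d_A\alpha)$ for all $\alpha,\beta\in\Gamma(\Lambda^{n-1}A^\ast)$; regular means $\Pi(x)\ne0$ for all $x\in M$. Under the hypotheses $\mathcal D$ is a vector subbundle of $A$ (of rank $n$) and a Lie subalgebroid; $d_{\mathcal D}$ is its Lie algebroid differential with trivial coefficients. $\mathcal H^\bullet_\Pi(A)$: let $\Omega^k(A,\Pi)=\{\alpha\in\Gamma(\Lambda^kA^\ast):\alpha(X_1,\dots,X_k)=0\ \text{for all }X_i\in\Pi_{n-1}(\Gamma(\Lambda^{n-1}A^\ast))\}$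 ($\Omega^0(A,\Pi)=0$) and $\Omega^k_\Pi(A)=\Gamma(\Lambda^kA^\ast)/\Omega^k(A,\Pi)$. Since $d_A\Omega^k(A,\Pi)\subseteq\Omega^{k+1}(A,\Pi)$, there is an induced $\tilde d_A[\alpha]=[d_A\alpha]$; $\mathcal H^\bullet_\Pi(A)$ is the cohomology of $(\Omega^\bullet_\Pi(A),\tilde d_A)$. Nambu cohomology $\mathcal H^\bullet_N(A)$: the Lie algebroid cohomology, with trivial coefficients, of the Lie algebroid $\Lambda^{n-1}A^\ast/\ker\Pi_{n-1}$ with bracket $\langle[\alpha],[\beta]\rangle=[\ll\alpha,\beta\gg_\ast]$, where $\ll\alpha,\beta\gg_\ast=\mathcal L_{\Pi\alpha}\beta-\iota_{\Pi\beta}d_A\alpha$, and anchor $[\alpha]\mapsto a(\Pi\alpha)$. *)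

(* Defs.v *)
From HB Require Import structures.
From mathcomp Require Import all_boot all_order all_algebra.
From mathcomp Require Import perm.
From mathcomp Require Import all_classical all_reals all_analysis.

Set Implicit Arguments.
Unset Strict Implicit.
Unset Printing Implicit Defensive.

Import Order.TTheory GRing.Theory Num.Theory numFieldNormedType.Exports.
Local Open Scope classical_set_scope.
Local Open Scope ring_scope.
Local Open Scope quotient_scope.

(* Definite description: an element of P if there is one, x0 otherwise. It is
   only applied to sets P that have at most one element in the intended use. *)
Definition the (T : Type) (x0 : T) (P : set T) : T :=
  if pselect (exists x, P x) is left h then sval (cid h) else x0.

Section LinearAlgebra.
Variable R : realType.

Section Span.
Variable V : lmodType R.

Definition lspan (S : set V) : {pred V} := fun v =>
  `[< forall P : set V, P 0 ->
        (forall a u w, P u -> P w -> P (a *: u + w)) -> S `<=` P -> P v >].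

Lemma lspan_submod_closed (S : set V) : submod_closed (lspan S).
Proof.
split=> [|a u w]; first by rewrite unfold_in; apply/asboolP.
rewrite !unfold_in => /asboolP uS /asboolP wS; apply/asboolP => P P0 PD SP.
by apply: (PD); [apply: uS|apply: wS].
Qed.

HB.instance Definition _ (S : set V) :=
  GRing.isSubmodClosed.Build R V (lspan S)
    (GRing.submod_closed_semi (lspan_submod_closed S)).

End Span.

(* Subspaces and quotients are formed from the linear span of a set S, so that
   no proof that S is a subspace is needed to name them; when S is a subspace,
   they are S and V / S. *)
Section SubQuotient.
Variables (V : lmodType R) (S : set V).

Definition subspace : Type := {v : V | v \in lspan S}.
HB.instance Definition _ := SubChoice.on subspace.
HB.instance Definition _ := [SubChoice_isSubLmodule of subspace by <:].

Definition quotient : Type := Quotient.quot (lspan S).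
HB.instance Definition _ := GRing.Zmodule.on quotient.

Definition class_of (v : V) : quotient := \pi_(Quotient.quot (lspan S)) v.
Definition rep (q : quotient) : V := repr (q : Quotient.quot (lspan S)).

Lemma rep_class (q : quotient) : class_of (rep q) = q.
Proof. exact: (@reprK _ (Quotient.quot (lspan S))). Qed.

Lemma class_ofE (u v : V) : class_of u = class_of v <-> u - v \in lspan S.
Proof.
rewrite Quotient.idealrBE; split=> [e|/eqP//]; exact/eqP.
Qed.

Lemma class_ofD (u v : V) : class_of (u + v) = class_of u + class_of v.
Proof. exact: Quotient.pi_add. Qed.

Definition quotient_scale (a : R) (q : quotient) := class_of (a *: rep q).

Lemma class_ofZ (a : R) (v : V) : class_of (a *: v) = quotient_scale a (class_of v).
Proof.
apply/class_ofE; rewrite -scalerBr; apply: rpredZ; apply/class_ofE.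
by rewrite rep_class.
Qed.

Lemma quotient_scaleA a b q :
  quotient_scale a (quotient_scale b q) = quotient_scale (a * b) q.
Proof. by rewrite {2}/quotient_scale -class_ofZ scalerA. Qed.

Lemma quotient_scale1 : left_id 1 quotient_scale.
Proof. by move=> q; rewrite /quotient_scale scale1r rep_class. Qed.

Lemma quotient_scaleDr : right_distributive quotient_scale +%R.
Proof.
move=> a p q; rewrite -(rep_class p) -(rep_class q) -class_ofD -!class_ofZ.
by rewrite scalerDr class_ofD.
Qed.

Lemma quotient_scaleDl q : {morph quotient_scale^~ q : a b / a + b}.
Proof. by move=> a b; rewrite /quotient_scale scalerDl class_ofD. Qed.

HB.instance Definition _ := GRing.Zmodule_isLmodule.Build R quotient
  quotient_scaleA quotient_scale1 quotient_scaleDr quotient_scaleDl.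
End SubQuotient.

Section AlternatingForms.
Variables (k : nat) (V : lmodType R).

Definition upd (X : 'I_k -> V) (i : 'I_k) (v : V) : 'I_k -> V :=
  fun j => if j == i then v else X j.

Definition alternating_form (f : ('I_k -> V) -> R) : Prop :=
  (forall X i a u v,
     f (upd X i (a *: u + v)) = a * f (upd X i u) + f (upd X i v)) /\
  (forall X i j, i != j -> X i = X j -> f X = 0).

Definition alternating_pred : {pred ('I_k -> V) -> R^o} :=
  fun f => `[< alternating_form f >].

Lemma alternating_submod_closed : submod_closed alternating_pred.
Proof.
split=> [|a f g]; rewrite !unfold_in.
  by apply/asboolP; split=> // *; rewrite mulr0 addr0.
move=> /asboolP[f1 f2] /asboolP[g1 g2]; apply/asboolP.
have E Y : (a *: f + g) Y = a * f Y + g Y :> R by [].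
split=> [X i b u v|X i j ij Xij].
  rewrite 3!E f1 g1 !mulrDr -!addrA (mulrCA a b); congr (_ + _).
  by rewrite addrCA.
by rewrite E (f2 _ _ _ ij Xij) (g2 _ _ _ ij Xij) mulr0 addr0.
Qed.

HB.instance Definition _ :=
  GRing.isSubmodClosed.Build R (('I_k -> V) -> R^o) alternating_pred
    (GRing.submod_closed_semi alternating_submod_closed).

Record altform := AltForm {
  altval : ('I_k -> V) -> R^o;
  altval_subproof : altval \in alternating_pred }.

Definition altfun (f : altform) (X : 'I_k -> V) : R := altval f X.
Coercion altfun : altform >-> Funclass.

HB.instance Definition _ := [isSub for altval].
HB.instance Definition _ := [Choice of altform by <:].
HB.instance Definition _ := [SubChoice_isSubLmodule of altform by <:].

Lemma altformP (f : altform) : alternating_form f.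
Proof. by have := altval_subproof f; rewrite unfold_in => /asboolP. Qed.

Definition mk_altform f (fP : alternating_form f) : altform :=
  AltForm (asboolT fP : f \in alternating_pred).
End AlternatingForms.

Section Wedge.
Variables (V : lmodType R) (k m N : nat) (e : (k + m)%N = N).

(* Normalised so that the wedge product of 1-forms is
   (f_1 /\ ... /\ f_k)(X_1, ..., X_k) = det (f_i (X_j)). *)
Definition wedge_fun (f : altform k V) (g : altform m V) (X : 'I_N -> V) : R :=
  ((k`! * m`!)%:R)^-1 * \sum_(s : 'S_N) (-1) ^+ s *
    (f (fun a => X (s (cast_ord e (lshift m a)))) *
     g (fun b => X (s (cast_ord e (rshift k b))))).

Lemma upd_comp (h n : nat) (X : 'I_n -> V) (p : 'I_h -> 'I_n) i0 v :
  injective p -> (fun a => upd X (p i0) v (p a)) = upd (X \o p) i0 v.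
Proof. by move=> pI; apply/funext => a; rewrite /upd (inj_eq pI). Qed.

Lemma upd_comp_out (h n : nat) (X : 'I_n -> V) (p : 'I_h -> 'I_n) i v :
  (forall a, p a != i) -> (fun a => upd X i v (p a)) = X \o p.
Proof. by move=> pi; apply/funext => a; rewrite /upd (negPf (pi a)). Qed.

Lemma sum_lin (I : finType) (c a : R) (sg F G H : I -> R) :
  (forall s, F s = a * G s + H s) ->
  c * \sum_s sg s * F s = a * (c * \sum_s sg s * G s) + c * \sum_s sg s * H s.
Proof.
move=> FE; under eq_bigr do rewrite FE mulrDr mulrCA.
by rewrite big_split /= -mulr_sumr mulrDr mulrCA.
Qed.

Lemma wedge_fun_alternating f g : alternating_form (wedge_fun f g).
Proof.
have [[f1 f2] [g1 g2]] := (altformP f, altformP g).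
split=> [X i a u v|X i j ij Xij].
  apply: sum_lin => s.
  pose pl a := s (cast_ord e (lshift m a)); pose pr b := s (cast_ord e (rshift k b)).
  have plI : injective pl.
    by move=> x y /perm_inj /cast_ord_inj; exact: lshift_inj.
  have prI : injective pr.
    by move=> x y /perm_inj /cast_ord_inj; exact: rshift_inj.
  have plr x y : pl x != pr y.
    by rewrite (inj_eq perm_inj) (inj_eq (@cast_ord_inj _ _ e)) eq_lrshift.
  have [[x ix]|[y iy]] : (exists x, i = pl x) \/ (exists y, i = pr y).
    pose z := cast_ord (esym e) ((s^-1)%g i).
    have iz : i = s (cast_ord e z) by rewrite cast_ordKV permKV.
    case: (split_ordP z) => w zw; [left|right]; exists w.
      by rewrite iz zw.
    by rewrite iz zw.
  - have L w : (fun c => upd X i w (s (cast_ord e (lshift m c)))) =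
        upd (X \o pl) x w by rewrite ix; exact: upd_comp.
    have P w : (fun c => upd X i w (s (cast_ord e (rshift k c)))) = X \o pr.
      by apply: (@upd_comp_out _ _ _ pr) => c; rewrite ix eq_sym plr.
    by rewrite !L f1 !P mulrDl mulrA.
  have L w : (fun c => upd X i w (s (cast_ord e (lshift m c)))) = X \o pl.
    by apply: (@upd_comp_out _ _ _ pl) => c; rewrite iy plr.
  have P w : (fun c => upd X i w (s (cast_ord e (rshift k c)))) =
      upd (X \o pr) y w by rewrite iy; exact: upd_comp.
  by rewrite !P g1 !L mulrDr mulrCA.
rewrite /wedge_fun; set S := \sum_s _.
suff SN : S = - S.
  have /eqP : S + S = 0 by rewrite {1}SN addNr.
  by rewrite -mulr2n mulrn_eq0 /= => /eqP ->; rewrite mulr0.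
rewrite {1}/S (reindex_inj (mulIg (tperm i j))) /= -sumrN; apply: eq_bigr => s _.
have Xt y : X (tperm i j y) = X y.
  by case: tpermP => [->|->|//]; rewrite Xij.
rewrite odd_permM odd_tperm ij addbT -mulNr; congr (_ * (f _ * g _)).
- by case: (odd_perm s); rewrite /= ?expr1 ?expr0 ?opprK.
- by apply/funext => b; rewrite permM Xt.
- by apply/funext => b; rewrite permM Xt.
Qed.

Definition wedge f g : altform N V := mk_altform (wedge_fun_alternating f g).

Lemma wedge_linear f : linear (wedge f).
Proof.
move=> a g h; apply: val_inj; apply/funext => X /=.
change (wedge_fun f (a *: g + h) X = a * wedge_fun f g X + wedge_fun f h X).
by apply: sum_lin => s; rewrite [a * (_ * _)]mulrCA -mulrDr.
Qed.

HB.instance Definition _ f :=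
  GRing.isLinear.Build R (altform m V) (altform N V) *:%R (wedge f)
    (wedge_linear f).

End Wedge.

(* For V of finite dimension, the pairing of the k-th exterior powers of V and
   of its dual identifies the former with the dual of the space of alternating
   k-linear forms on V: a multivector is xi |-> <phi, xi>, and
   X_1 /\ ... /\ X_k is phi |-> phi (X_1, ..., X_k). *)
Definition mvector k (V : lmodType R) := {scalar (altform k V)}.

(* iota_phi xi : <psi, iota_phi xi> = <phi /\ psi, xi>. *)
Definition contract (V : lmodType R) k m N (e : (k + m)%N = N)
  (phi : altform k V) (xi : mvector N V) : mvector m V := xi \o wedge e phi.

(* The identification of multivectors of degree 1 with vectors. *)
Definition vector_of (V : lmodType R) (xi : mvector 1 V) : V :=
  the 0 [set v | forall phi : altform 1 V, xi phi = phi (fun=> v)].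

(* iota_v omega = omega (v, _, ..., _). *)
Section Interior.
Variables (V : lmodType R) (k : nat).

Definition vcons (v : V) (X : 'I_k -> V) : 'I_k.+1 -> V :=
  fun i => if unlift ord0 i is Some j then X j else v.

Lemma interior_alternating (v : V) (f : altform k.+1 V) :
  alternating_form (fun X => f (vcons v X)).
Proof.
have [f1 f2] := altformP f.
have E X i u : vcons v (upd X i u) = upd (vcons v X) (lift ord0 i) u.
  apply/funext => j; rewrite /vcons /upd; case: unliftP => [j' ->|->].
    by rewrite (inj_eq lift_inj).
  by rewrite (negPf (neq_lift _ _)).
split=> [X i a u w|X i j ij Xij]; first by rewrite !E f1.
apply: (f2 _ (lift ord0 i) (lift ord0 j)); first by rewrite (inj_eq lift_inj).
by rewrite /vcons !liftK.
Qed.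

Definition interior v f : altform k V := mk_altform (interior_alternating v f).
End Interior.

Lemma subform_alternating k (V : lmodType R) (B : set V) (f : altform k V) :
  alternating_form (fun X : 'I_k -> subspace B => f (fun i => val (X i))).
Proof.
have [f1 f2] := altformP f.
have E (X : 'I_k -> subspace B) i v :
    (fun j => val (upd X i v j)) = upd (fun j => val (X j)) i (val v).
  by apply/funext => j; rewrite /upd; case: ifP.
split=> [X i a u v|X i j ij Xij].
  by rewrite !E [val (_ + _)]linearP f1.
by apply: (f2 _ i j) => //; rewrite Xij.
Qed.

Definition subform k (V : lmodType R) (B : set V) (f : altform k V) :
  altform k (subspace B) := mk_altform (subform_alternating B f).

End LinearAlgebra.

Section Smooth.
Variables (R : realType) (d : nat).
Implicit Types (U : set 'rV[R]_d) (f g : 'rV[R]_d -> R).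

(* f is of class C^p on U, which is open wherever this is used. *)
Fixpoint class_C (p : nat) U f : Prop :=
  (forall u, U u -> {for u, continuous f}) /\
  if p is q.+1 then
    forall i : 'I_d, (forall u, U u -> derivable f u (delta_mx 0 i)) /\
                     class_C q U ('D_(delta_mx 0 i) f)
  else True.

Definition smooth_on U f := forall p, class_C p U f.

Lemma class_CW p U f : class_C p.+1 U f -> class_C p U f.
Proof.
elim: p f => [|p IH] f /=; first by case.
by case=> cf df; split=> // i; have [? ?] := df i; split=> //; exact: IH.
Qed.

Lemma class_C_ext p U f g : open U -> (forall u, U u -> f u = g u) ->
  class_C p U f -> class_C p U g.
Proof.
move=> oU; have near_eq f1 g1 u : (forall u, U u -> f1 u = g1 u) -> U u ->
    \near u, f1 u = g1 u.
  by move=> fg Uu; apply: filterS (open_nbhs_nbhs (conj oU Uu)) => ?; exact: fg.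
have cont_ext f1 g1 : (forall u, U u -> f1 u = g1 u) ->
    (forall u, U u -> {for u, continuous f1}) -> forall u, U u -> {for u, continuous g1}.
  move=> fg cf u Uu; rewrite /prop_for /continuous_at -(fg u Uu).
  have h := @near_eq_cvg _ _ (nbhs u) (nbhs_filter u) _ _ (near_eq _ _ _ fg Uu).
  exact: cvg_trans h (cf u Uu).
elim: p f g => [|p IH] f g fg /= [cf df]; split.
- exact: cont_ext cf.
- by [].
- exact: cont_ext cf.
move=> i; have [di Di] := df i; split.
  move=> u Uu; apply: (near_eq_derivable (near_eq _ _ _ fg Uu) (di _ Uu)).
apply: IH Di => u Uu; exact: near_eq_derive (near_eq _ _ _ fg Uu).
Qed.

Lemma class_C_cst p U (c : R) : open U -> class_C p U (fun=> c).
Proof.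
move=> oU; elim: p c => [|p IH] c /=; split=> //.
1,2: by move=> u _; exact: cst_continuous.
move=> i; split=> [u _|]; first exact: derivable_cst.
by apply: (class_C_ext oU _ (IH 0)) => u _; rewrite derive_cst.
Qed.

Lemma class_CD p U f g : open U -> class_C p U f -> class_C p U g ->
  class_C p U (fun u => f u + g u).
Proof.
move=> oU; elim: p f g => [|p IH] f g /= [cf df] [cg dg]; split.
1,3: by move=> u Uu; apply: continuousD; [exact: cf|exact: cg].
  by [].
move=> i; have [di Di] := df i; have [ei Ei] := dg i; split.
  by move=> u Uu; apply: derivableD; [exact: di|exact: ei].
apply: class_C_ext (IH _ _ Di Ei) => // u Uu.
by rewrite -deriveD; [|exact: di|exact: ei].
Qed.

Lemma class_CM p U f g : open U -> class_C p U f -> class_C p U g ->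
  class_C p U (fun u => f u * g u).
Proof.
move=> oU; elim: p f g => [|p IH] f g.
  by move=> /= [cf _] [cg _]; split=> // u Uu; apply: continuousM; [exact: cf|exact: cg].
move=> fC gC; have f' := class_CW fC; have g' := class_CW gC.
case: fC => cf df; case: gC => cg dg; split.
  by move=> u Uu; apply: continuousM; [exact: cf|exact: cg].
move=> i; have [di Di] := df i; have [ei Ei] := dg i; split.
  by move=> u Uu; apply: derivableM; [exact: di|exact: ei].
apply: class_C_ext (class_CD oU (IH _ _ f' Ei) (IH _ _ g' Di)) => // u Uu.
by rewrite -deriveM; [|exact: di|exact: ei].
Qed.

Lemma smooth_on_lin U (a : R) f g : open U -> smooth_on U f -> smooth_on U g ->
  smooth_on U (fun u => a * f u + g u).
Proof.
by move=> oU fS gS p; apply: class_CD => //; apply: class_CM => //; exact: class_C_cst.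
Qed.

Lemma smooth_onM U f g : open U -> smooth_on U f -> smooth_on U g ->
  smooth_on U (fun u => f u * g u).
Proof. by move=> oU fS gS p; apply: class_CM. Qed.

End Smooth.

Section Manifolds.
Variables (R : realType) (d : nat) (M : topologicalType).

Record manifold := Manifold {
  manifold_hausdorff : hausdorff_space M;
  chart_index : Type;
  chart_dom : chart_index -> set M;
  chart : chart_index -> M -> 'rV[R]_d;
  chart_inv : chart_index -> 'rV[R]_d -> M;
  chart_dom_open : forall i, open (chart_dom i);
  chart_cover : forall x, exists i, chart_dom i x;
  chart_image_open : forall i, open (chart i @` chart_dom i);
  chartK : forall i x, chart_dom i x -> chart_inv i (chart i x) = x;
  chart_continuous : forall i x, chart_dom i x -> {for x, continuous (chart i)};
  chart_inv_continuous : forall i u, (chart i @` chart_dom i) u ->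
    {for u, continuous (chart_inv i)};
  chart_transition : forall i j (c : 'I_d),
    smooth_on (chart i @` (chart_dom i `&` chart_dom j))
      (fun u => chart j (chart_inv i u) 0 c) }.

Definition paracompact := forall C : set (set M),
  (forall U, C U -> open U) -> (forall x, exists2 U, C U & U x) ->
  exists D : set (set M), [/\ (forall V, D V -> open V),
    (forall x, exists2 V, D V & V x),
    (forall V, D V -> exists2 U, C U & V `<=` U) &
    (forall x : M, exists2 W : set M, nbhs x W &
       finite_set [set V | D V /\ V `&` W !=set0])].

Variable S : manifold.

Definition smooth (W : set M) (f : M -> R) : Prop := forall i : chart_index S,
  smooth_on (chart i @` (chart_dom i `&` W)) (f \o chart_inv i).

Lemma chart_image_openT (i : chart_index S) : open (chart i @` (chart_dom i `&` [set: M])).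
Proof. by rewrite setIT; exact: chart_image_open. Qed.

Lemma smooth_lin (a : R) f g : smooth setT f -> smooth setT g ->
  smooth setT (fun x => a * f x + g x).
Proof. by move=> fS gS i; exact: (smooth_on_lin a (@chart_image_openT i) (fS i) (gS i)). Qed.

Lemma smoothM f g : smooth setT f -> smooth setT g ->
  smooth setT (fun x => f x * g x).
Proof. by move=> fS gS i; exact: (smooth_onM (@chart_image_openT i) (fS i) (gS i)). Qed.

Lemma smooth0 : smooth setT (fun=> 0).
Proof. by move=> i p; apply: class_C_cst; exact: chart_image_openT. Qed.

Record smooth_fun := SmoothFun {
  smooth_val :> M -> R;
  smooth_funP : smooth setT smooth_val }.

Record vbundle (r : nat) := VBundle {
  vfib :> M -> vectType R;
  frame_index : Type;
  frame_dom : frame_index -> set M;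
  frame : frame_index -> forall x, r.-tuple (vfib x);
  frame_dom_open : forall i, open (frame_dom i);
  frame_cover : forall x, exists i, frame_dom i x;
  frame_basis : forall i x, frame_dom i x -> basis_of fullv (frame i x);
  frame_transition : forall i j (k l : 'I_r),
    smooth (frame_dom i `&` frame_dom j)
      (fun x => coord (frame i x) k (tnth (frame j x) l)) }.

Definition smooth_section r (E : vbundle r) (s : forall x, E x) : Prop :=
  forall (i : frame_index E) (k : 'I_r),
    smooth (frame_dom i) (fun x => coord (frame i x) k (s x)).

(* The data of a Lie algebroid, without the laws: fibres, smooth sections,
   bracket of sections and anchor. A tangent vector at x is a derivation of
   the smooth functions at x; the values of the bracket and of the anchor
   outside smooth sections and smooth functions play no role. *)
Record algebroid_data := AlgebroidData {
  fib : M -> lmodType R;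
  sec : set (forall x, fib x);
  br : (forall x, fib x) -> (forall x, fib x) -> forall x, fib x;
  anchor : forall x, fib x -> (M -> R) -> R }.

Arguments sec : clear implicits.

Record algebroid_laws (E : algebroid_data) : Prop := AlgebroidLaws {
  anchor_linear : forall (f : smooth_fun) x a (u v : fib E x),
    anchor (a *: u + v) f = a * anchor u f + anchor v f;
  anchor_lin : forall (f g : smooth_fun) x (v : fib E x) a,
    anchor v (fun y => a * f y + g y) = a * anchor v f + anchor v g;
  anchor_derivation : forall (f g : smooth_fun) x (v : fib E x),
    anchor v (fun y => f y * g y) = anchor v f * g x + f x * anchor v g;
  anchor_smooth : forall (f : smooth_fun) X, sec E X ->
    smooth setT (fun x => anchor (X x) f);
  br_sec : forall X Y, sec E X -> sec E Y -> sec E (br X Y);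
  br_linear : forall X Y Z a, sec E X -> sec E Y -> sec E Z ->
    forall x, br (fun y => a *: X y + Y y) Z x = a *: br X Z x + br Y Z x;
  br_skew : forall X Y, sec E X -> sec E Y ->
    forall x, br X Y x = - br Y X x;
  br_jacobi : forall X Y Z, sec E X -> sec E Y -> sec E Z ->
    forall x, br X (br Y Z) x + br Y (br Z X) x + br Z (br X Y) x = 0;
  br_leibniz : forall (f : smooth_fun) X Y, sec E X -> sec E Y ->
    forall x, br X (fun y => f y *: Y y) x =
              f x *: br X Y x + anchor (X x) f *: Y x;
  anchor_br : forall (f : smooth_fun) X Y, sec E X -> sec E Y ->
    forall x, anchor (br X Y x) f =
              anchor (X x) (fun y => anchor (Y y) f) -
              anchor (Y x) (fun y => anchor (X y) f) }.

Record lie_algebroid (r : nat) := LieAlgebroid {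
  lie_bundle :> vbundle r;
  lie_br : (forall x, lie_bundle x) -> (forall x, lie_bundle x) ->
           forall x, lie_bundle x;
  lie_anchor : forall x, lie_bundle x -> (M -> R) -> R;
  lie_laws : algebroid_laws
    (@AlgebroidData (fun x => lie_bundle x : lmodType R)
       (@smooth_section r lie_bundle) lie_br lie_anchor) }.

Definition lie_data r (A : lie_algebroid r) : algebroid_data :=
  @AlgebroidData (fun x => A x : lmodType R)
    (@smooth_section r A) (@lie_br r A) (@lie_anchor r A).
Coercion lie_data : lie_algebroid >-> algebroid_data.

Section ProductModule.
Variable F : M -> lmodType R.

Definition fib_prod : Type := forall x, F x.
HB.instance Definition _ := gen_eqMixin fib_prod.
HB.instance Definition _ := gen_choiceMixin fib_prod.

Definition fib_add (s t : fib_prod) : fib_prod := fun x => s x + t x.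
Definition fib_opp (s : fib_prod) : fib_prod := fun x => - s x.
Definition fib_zero : fib_prod := fun x => 0.
Definition fib_scale (a : R) (s : fib_prod) : fib_prod := fun x => a *: s x.

Lemma fib_addA : associative fib_add.
Proof. by move=> s t u; apply: functional_extensionality_dep => x; exact: addrA. Qed.
Lemma fib_addC : commutative fib_add.
Proof. by move=> s t; apply: functional_extensionality_dep => x; exact: addrC. Qed.
Lemma fib_add0 : left_id fib_zero fib_add.
Proof. by move=> s; apply: functional_extensionality_dep => x; exact: add0r. Qed.
Lemma fib_addN : left_inverse fib_zero fib_opp fib_add.
Proof. by move=> s; apply: functional_extensionality_dep => x; exact: addNr. Qed.
HB.instance Definition _ :=
  GRing.isZmodule.Build fib_prod fib_addA fib_addC fib_add0 fib_addN.

Lemma fib_scaleA a b s : fib_scale a (fib_scale b s) = fib_scale (a * b) s.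
Proof. by apply: functional_extensionality_dep => x; exact: scalerA. Qed.
Lemma fib_scale1 : left_id 1 fib_scale.
Proof. by move=> s; apply: functional_extensionality_dep => x; exact: scale1r. Qed.
Lemma fib_scaleDr : right_distributive fib_scale +%R.
Proof. by move=> a s t; apply: functional_extensionality_dep => x; exact: scalerDr. Qed.
Lemma fib_scaleDl s : {morph fib_scale^~ s : a b / a + b}.
Proof. by move=> a b; apply: functional_extensionality_dep => x; exact: scalerDl. Qed.
HB.instance Definition _ := GRing.Zmodule_isLmodule.Build R fib_prod
  fib_scaleA fib_scale1 fib_scaleDr fib_scaleDl.
End ProductModule.

(* Sections of the k-th exterior power of the dual of E. Such a section is
   smooth when its values on smooth sections of E are smooth functions. *)
Section Forms.
Variables (E : algebroid_data) (k : nat).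

Definition smooth_form (w : fib_prod (fun x => altform k (fib E x))) : Prop :=
  forall X : 'I_k -> forall x, fib E x, (forall i, sec E (X i)) ->
    smooth setT (fun x => w x (fun i => X i x)).

Definition smooth_form_pred : {pred fib_prod (fun x => altform k (fib E x))} :=
  fun w => `[< smooth_form w >].

Lemma smooth_form_submod_closed : submod_closed smooth_form_pred.
Proof.
split=> [|a v w]; rewrite !unfold_in.
  by apply/asboolP => X _; exact: smooth0.
move=> /asboolP vS /asboolP wS; apply/asboolP => X XS.
exact: (smooth_lin a (vS X XS) (wS X XS)).
Qed.

HB.instance Definition _ := GRing.isSubmodClosed.Build R _ smooth_form_pred
  (GRing.submod_closed_semi smooth_form_submod_closed).

Record sform := SForm {
  sform_val : fib_prod (fun x => altform k (fib E x));
  sform_subproof : sform_val \in smooth_form_pred }.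

HB.instance Definition _ := [isSub for sform_val].
HB.instance Definition _ := [Choice of sform by <:].
HB.instance Definition _ := [SubChoice_isSubLmodule of sform by <:].

Definition sform_at (w : sform) (x : M) : altform k (fib E x) := sform_val w x.
Coercion sform_at : sform >-> Funclass.

Lemma sformP (w : sform) : smooth_form (sform_val w).
Proof. by have := sform_subproof w; rewrite unfold_in => /asboolP. Qed.

Definition mk_sform w (wP : smooth_form w) : sform :=
  SForm (asboolT wP : w \in smooth_form_pred).

Lemma fscale_smooth (f : smooth_fun) (w : sform) :
  smooth_form (fun x => f x *: w x).
Proof.
by move=> X XS; exact: (smoothM (smooth_funP f) (sformP w XS)).
Qed.

Definition fscale f w : sform := mk_sform (fscale_smooth f w).

(* The form w with w (X_1, ..., X_k) = F (X_1, ..., X_k) for all smooth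
   sections X_1, ..., X_k of E. *)
Definition form_of (F : ('I_k -> forall x, fib E x) -> M -> R) : sform :=
  the 0 [set w : sform | forall X : 'I_k -> forall x, fib E x,
    (forall i, sec E (X i)) -> forall x, w x (fun i => X i x) = F X x].
End Forms.

Section Differential.
Variable E : algebroid_data.

Definition koszul k (w : sform E k) (X : 'I_k.+1 -> forall x, fib E x)
    (x : M) : R :=
  \sum_(i < k.+1) (-1) ^+ i *
     anchor (X i x) (fun y => w y (fun l => X (lift i l) y)) +
  \sum_(i < k.+1) \sum_(j < k.+1 | (i < j)%N) (-1) ^+ (i + j) *
     w x (fun l : 'I_k => nth 0
       (br (X i) (X j) x ::
          [seq X h x | h <- enum 'I_k.+1 & h \notin [:: i; j]]) l).

Definition dform k (w : sform E k) : sform E k.+1 := form_of (koszul w).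

Definition lie_der k (X : forall x, fib E x) (w : sform E k) : sform E k :=
  form_of (fun Y x =>
    anchor (X x) (fun y => w y (fun l => Y l y)) -
    \sum_(i < k) w x (upd (fun l => Y l x) i (br X (Y i) x))).

Definition mvector_field n := forall x, mvector n (fib E x).

Definition smooth_mvector n (xi : mvector_field n) : Prop :=
  forall w : sform E n, smooth setT (fun x => xi x (w x)).

(* The Schouten bracket [X, xi], for a section X. Multivectors are locally sums
   of decomposable ones, on which it is given by
   [X, Y_1 /\ ... /\ Y_n] = \sum_i Y_1 /\ ... /\ [X, Y_i] /\ ... /\ Y_n. *)
Definition schouten n (X : forall x, fib E x) (xi : mvector_field n) :
    mvector_field n :=
  the xi [set zeta : mvector_field n |
    forall (U : set M) (p : nat) (Y : 'I_p -> 'I_n -> forall x, fib E x),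
      open U -> (forall j i, sec E (Y j i)) ->
      (forall x, U x -> forall phi : altform n (fib E x),
         xi x phi = \sum_(j < p) phi (fun i => Y j i x)) ->
      forall x, U x -> forall phi : altform n (fib E x),
        zeta x phi = \sum_(j < p) \sum_(i < n)
          phi (upd (fun l => Y j l x) i (br X (Y j i) x))].

(* iota_alpha xi for alpha of degree m and xi of degree m + 1; with xi = Pi
   this is Pi_m alpha. *)
Definition sharp m (xi : mvector_field m.+1) x (alpha : altform m (fib E x)) :
    fib E x :=
  vector_of (contract (addn1 m) alpha (xi x)).

End Differential.

(* The law d o d = 0 and the linearity of d are not part of the data: they hold
   for the complexes at hand but are not needed to name the cohomology. *)
Record cochains := Cochains {
  cobj : nat -> lmodType R;
  cdiff : forall k, cobj k -> cobj k.+1 }.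

Definition cocycle (C : cochains) k : set (cobj C k) :=
  [set z | cdiff z = 0].

Definition coboundary (C : cochains) k : set (cobj C k) :=
  match k with
  | 0 => [set 0]
  | j.+1 => range (@cdiff C j)
  end.

Definition cohomology (C : cochains) k : lmodType R :=
  @quotient R (subspace (@cocycle C k)) [set z | coboundary (val z)].

Definition forms (E : algebroid_data) : cochains :=
  @Cochains (fun k => sform E k) (@dform E).

Section Nambu.
Variables (r : nat) (A : lie_algebroid r) (m : nat).
Variable Pi : mvector_field A m.+1.

(* Pi is a regular Nambu structure of order m + 1. *)
Record regular_nambu : Prop := RegularNambu {
  nambu_smooth : smooth_mvector Pi;
  nambu_identity : forall (alpha beta : sform A m) x,
    sharp (schouten (fun y => sharp Pi (alpha y)) Pi) (beta x) =
    - sharp Pi (interior (sharp Pi (beta x)) (dform alpha x));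
  nambu_regular : forall x, exists phi : altform m.+1 (fib A x), Pi x phi != 0 }.

(* The subbundle D = Pi_m (Lambda^m A^* ) of A, whose smooth sections are those
   of A with values in D. Its bracket is that of A; the default value of insubd
   is not reached on smooth sections when D is involutive. *)
Definition image_data : algebroid_data :=
  @AlgebroidData
    (fun x => subspace (range (@sharp A m Pi x)))
    [set X | sec A (fun x => val (X x))]
    (fun X Y x => insubd 0 (@br A (fun y => val (X y)) (fun y => val (Y y)) x))
    (fun x v => @anchor A x (val v)).

Lemma restrict_smooth k (w : sform A k) :
  @smooth_form image_data k (fun x => subform _ (w x)).
Proof. by move=> X XS; exact: (sformP w XS). Qed.

Definition restrict_form k (w : sform A k) : sform image_data k :=
  mk_sform (restrict_smooth w).

Definition vanishing k : set (sform A k) :=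
  [set w : sform A k | forall eta : 'I_k -> sform A m,
     forall x, w x (fun i => sharp Pi (eta i x)) = 0].

Definition vclass k (w : sform A k) : quotient (@vanishing k) :=
  class_of (@vanishing k) w.

(* The differential is [w] |-> [d_A w]. *)
Definition vanishing_quotient : cochains :=
  @Cochains (fun k => quotient (@vanishing k))
    (fun k q => the 0 [set q' | forall w : sform A k,
       vclass w = q -> q' = vclass (dform w)]).

(* << alpha, beta >>_* = L_{Pi alpha} beta - iota_{Pi beta} d_A alpha. *)
Definition form_bracket (alpha beta : sform A m) x : altform m (fib A x) :=
  lie_der (fun y => sharp Pi (alpha y)) beta x -
  interior (sharp Pi (beta x)) (dform alpha x).

(* The bundle Lambda^m A^* / ker Pi_m. Its smooth sections are the classes of
   smooth sections of Lambda^m A^*, since M is paracompact. *)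
Definition coimage_fib (x : M) : lmodType R :=
  quotient [set alpha : altform m (fib A x) | sharp Pi alpha = 0].

Definition coimage_class (alpha : forall x, altform m (fib A x)) x :
  coimage_fib x := class_of _ (alpha x).

Definition coimage_data : algebroid_data :=
  @AlgebroidData coimage_fib
    [set s | exists alpha : sform A m, s = coimage_class alpha]
    (fun s t => the (fun=> 0) [set u | forall alpha beta : sform A m,
       s = coimage_class alpha -> t = coimage_class beta ->
       u = coimage_class (form_bracket alpha beta)])
    (fun x q => @anchor A x (sharp Pi (rep q))).

End Nambu.

(* The sections of the dual of A are locally spanned by the differentials
   d_A f = (v |-> a(v) f) of smooth functions f. *)
Definition locally_spanned_by_exact r (A : lie_algebroid r) : Prop :=
  forall x : M, exists U : set M, [/\ open U, U x &
    forall alpha : sform A 1,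
      exists (p : nat) (f : 'I_p -> smooth_fun) (g : 'I_p -> M -> R),
        (forall j, smooth U (g j)) /\
        forall y, U y -> forall v : A y,
          alpha y (fun=> v) = \sum_(j < p) g j y * lie_anchor v (f j)].

End Manifolds.

Definition lmod_isomorphic (R : realType) (U V : lmodType R) : Prop :=
  exists f : {linear U -> V}, bijective f.

(* Main.v *)
(** Replacing alpha by f alpha in the Nambu identity and subtracting f times the
    identity for alpha leaves an identity that is algebraic in d f.  As exact
    1-forms span A^*, this holds with any covector in place of d f, and for order
    n = m + 1 >= 3 it forces Pi to be decomposable at every point, say
    Pi = X_0 /\ ... /\ X_m, so that the image D of sharp is spanned by the X_i.

    A locally finite family of bump functions yields a global n-form Phi with
    <Phi, Pi> = 1, and v |-> (-1)^m Pi(iota_v Phi) is a smooth projection of A onto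
    D.  Composition with it extends forms on D to A; hence restriction to D is
    onto, and its kernel consists of the forms vanishing on D.

    The Nambu identity also gives [Pi alpha, Pi beta] = Pi <<alpha, beta>>, so that
    sharp identifies the coimage, as a Lie algebroid, with D.  All exterior
    derivatives satisfy the Koszul formula on sections, which the restriction and
    the pullback by sharp preserve.

    The existence of the exterior derivative is obtained from Cartan's formula by
    recursion on the degree: d w (X_0, X') = (L_{X_0} w - d (iota_{X_0} w)) (X'). *)

Require Import Defs.
From HB Require Import structures.
From mathcomp Require Import all_boot all_order all_algebra.
From mathcomp Require Import all_classical all_reals all_analysis.
From mathcomp Require Import perm zify ring lra.

Set Implicit Arguments.
Unset Strict Implicit.
Unset Printing Implicit Defensive.

Import Order.TTheory GRing.Theory Num.Theory numFieldNormedType.Exports.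
Local Open Scope classical_set_scope.
Local Open Scope ring_scope.
(** * Bump functions and paracompactness *)

(** Order at least 3 matters because for m = 1 the algebraic identity is empty: it reduces to
    skewness, and every bivector satisfies it. For m >= 2 it is a quadratic exchange relation for
    Pi, read as an alternating form on covectors; it shows that a covector vanishing on the m + 1
    vectors obtained from one nonzero value of Pi annihilates Pi. The differential, the Lie
    derivative, the Schouten bracket and the bracket of the coimage are definite descriptions, so
    each formula rests on a proof that a described object exists. Forms are tested on global
    sections; this is why local frames are multiplied by bump functions and extended to all of M.
    The recursion constructing d is carried out on A alone: d on D and on the coimage is transported
    from there. The form Phi takes the place of local frames of D: one formula gives smooth
    preimages under sharp for sections of D, extensions of forms on D, and the inverse of sharp on
    the coimage. That it is a projection rests on decomposability. *)

Section Flat.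
Variable R : realType.
Implicit Types t : R.

Definition flat (j : nat) t : R := if 0 < t then t^-1 ^+ j * expR (- t^-1) else 0.

Lemma flat_ge0 j t : 0 <= flat j t.
Proof.
rewrite /flat; case: ifP => // t0.
by rewrite mulr_ge0 ?exprn_ge0 ?invr_ge0 ?expR_ge0 ?ltW.
Qed.

Lemma flat_gt0 j t : 0 < t -> 0 < flat j t.
Proof.
by move=> t0; rewrite /flat t0 mulr_gt0 ?exprn_gt0 ?invr_gt0 ?expR_gt0.
Qed.

Lemma flat_le0 j t : t <= 0 -> flat j t = 0.
Proof. by move=> t0; rewrite /flat ltNge t0. Qed.

(** With s = t^-1 and N = j + 1: s / N <= exp (s / N), and the N-th power of this inequality is s^N
    <= N^N exp s. *)
Lemma flat_bounded j t : flat j.+1 t <= j.+1%:R ^+ j.+1.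
Proof.
rewrite /flat; case: ifP => [t0|_]; last by rewrite exprn_ge0.
have E : expR (t^-1) = expR (t^-1 / j.+1%:R) ^+ j.+1.
  by rewrite -expRM_natl mulrC divfK.
rewrite expRN ler_pdivrMr ?expR_gt0// E -exprMn.
rewrite lerXn2r ?nnegrE ?invr_ge0 ?mulr_ge0 ?expR_ge0 ?(ltW t0)//.
rewrite -ler_pdivrMl ?ltr0n// mulrC.
by rewrite (le_trans _ (expR_ge1Dx _))// lerDr.
Qed.

Lemma flatE j t : flat j t = t ^+ 2 * flat j.+2 t.
Proof.
rewrite /flat; case: ifP => [t0|_]; last by rewrite mulr0.
by rewrite mulrA -(addn2 j) exprD mulrCA -exprMn divff ?gt_eqF// expr1n mulr1.
Qed.

(** The powers of t^-1 close the family under differentiation, so smoothness of [flat 0] becomes one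
    induction over all [flat j]. At 0, by [flatE], the difference quotient is h times the value at h
    of the bounded function [flat j.+2]. *)
Lemma is_derive_flat j t :
  is_derive t 1 (flat j) (flat j.+2 t - j%:R * flat j.+1 t).
Proof.
have [t0|t0|<-] := ltgtP 0 t.
- have near_t : \forall u \near t, u^-1 ^+ j * expR (- u^-1) = flat j u.
    near=> u; rewrite /flat ifT//; near: u; exact: lt_nbhsr.
  apply: near_eq_is_derive near_t _.
  have dV : is_derive t 1 (fun u : R => u^-1) (- t ^- 2).
    apply: DeriveDef; first by apply: derivableV; rewrite ?gt_eqF.
    by rewrite deriveV ?gt_eqF// derive_id scaler1.
  have dN : is_derive t 1 (fun u : R => - u^-1) (t ^- 2).
    by have [d1 d2] := is_deriveN dV; split => //; rewrite d2 opprK.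
  have dE : is_derive t 1 (fun u : R => expR (- u^-1)) (expR (- t^-1) * t ^- 2).
    exact: (@is_derive1_comp _ expR).
  have dX : is_derive t 1 (fun u : R => u^-1 ^+ j)
      (j%:R * t^-1 ^+ j.-1 * - t ^- 2).
    by have := is_deriveX j dV; rewrite exprfctE.
  have [dM dME] := is_deriveM dX dE; split => //; rewrite dME.
  rewrite /flat t0 /GRing.scale /= -!exprVn.
  move: (t^-1) (expR _) => u e; case: j {dX dM dME} => [|j] /=.
    by ring.
  by rewrite !exprS; ring.
- have near_t : \forall u \near t, 0 = flat j u.
    near=> u; rewrite flat_le0// ltW//; near: u; exact: lt_nbhsl.
  rewrite !flat_le0 ?(ltW t0)// mulr0 subr0.
  exact: near_eq_is_derive near_t (is_derive_cst _ _ _).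
rewrite !flat_le0// mulr0 subr0.
have cv : (fun h : R => h^-1 *: ((flat j \o shift 0) (h *: (1:R)) - flat j 0)) @ 0^' --> (0:R).
  apply/cvgrPdist_le => e e0; near=> h.
  rewrite sub0r normrN /= addr0 [h *: 1]mulr1 (flat_le0 _ (lexx 0)) subr0.
  rewrite flatE /GRing.scale /= expr2 !mulrA mulVf ?mul1r; last first.
    by near: h; exact: nbhs_dnbhs_neq.
  rewrite normrM (ger0_norm (flat_ge0 _ _)).
  apply: (@le_trans _ _ (`|h| * j.+2%:R ^+ j.+2)).
    by rewrite ler_wpM2l// flat_bounded.
  rewrite -ler_pdivlMr ?exprn_gt0//.
  near: h; apply: dnbhs0_le.
  by rewrite divr_gt0 ?exprn_gt0.
by apply: DeriveDef; [apply/cvg_ex; exists 0 | exact: cvg_lim cv].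
Unshelve. all: by end_near. Qed.

Lemma continuous_flat j : continuous (flat j).
Proof.
by move=> t; apply/differentiable_continuous/derivable1_diffP;
  apply: (@ex_derive _ _ _ _ _ _ _ (is_derive_flat j t)).
Qed.
End Flat.

(** * Functions of class C^p: locality, algebra, cutoffs *)

Section ClassC.
Variables (R : realType) (d : nat).
Implicit Types (U V : set 'rV[R]_d) (f g : 'rV[R]_d -> R).

Lemma class_C_sub p U V f : V `<=` U -> class_C p U f -> class_C p V f.
Proof.
move=> VU; elim: p f => [|p IH] f /= [cf df]; split=> //.
- by move=> u /VU; exact: cf.
- by move=> u /VU; exact: cf.
by move=> i; have [di Di] := df i; split=> [u /VU|]; [exact: di|exact: IH].
Qed.

(** V may be any set: each clause of [class_C] concerns f, as a function on the whole space, at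
    single points of the set. *)
Lemma class_C_local p U f :
  (forall u, U u -> exists2 V, V u & class_C p V f) -> class_C p U f.
Proof.
elim: p f => [|p IH] f loc.
  by split=> // u /loc[V Vu [cf _]]; exact: cf.
split=> [u /loc[V Vu [cf _]]|i]; first exact: cf.
split=> [u /loc[V Vu [_ /(_ i)[di _]]]|]; first exact: di.
by apply: IH => u /loc[V Vu [_ /(_ i)[_ Di]]]; exists V.
Qed.

Lemma class_C_sum p U (I : Type) (s : seq I) (P : pred I) (F : I -> 'rV[R]_d -> R) :
  open U -> (forall i, P i -> class_C p U (F i)) ->
  class_C p U (fun u => \sum_(i <- s | P i) F i u).
Proof.
move=> oU FC; elim: s => [|i s IH].
  by rewrite (_ : (fun u => _) = fun=> 0);
    [exact: class_C_cst|apply/funext => u; rewrite big_nil].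
case Pi : (P i).
  rewrite (_ : (fun u => _) = fun u => F i u + \sum_(i <- s | P i) F i u).
    by apply: class_CD => //; exact: FC.
  by apply/funext => u; rewrite big_cons Pi.
by rewrite (_ : (fun u => _) = fun u => \sum_(i <- s | P i) F i u)//;
  apply/funext => u; rewrite big_cons Pi.
Qed.

Lemma class_CV p U f : open U -> (forall u, U u -> f u != 0) ->
  class_C p U f -> class_C p U (fun u => (f u)^-1).
Proof.
move=> oU f0; elim: p => [|p IH] fC.
  by split=> // u Uu; apply: continuousV; [exact: f0|exact: fC.1].
have f' := IH (class_CW fC); case: fC => cf df; split.
  by move=> u Uu; apply: continuousV; [exact: f0|exact: cf].
move=> i; have [di Di] := df i; split.
  by move=> u Uu; apply: derivableV; [exact: f0|exact: di].
have M1C := class_C_cst (d := d) p (-1 : R) oU.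
apply: class_C_ext (class_CM oU M1C (class_CM oU (class_CM oU f' f') Di)) => //.
move=> u Uu; rewrite deriveV; [|exact: f0|exact: di].
by rewrite /GRing.scale /= mulN1r mulNr -exprVn expr2.
Qed.

(* Only the chain rule in one variable is needed, since the outer function is
   a function on the line. *)
Lemma is_derive_comp_line (h : R -> R) g u v dh dg :
  is_derive u v g dg -> is_derive (g u) 1 h dh ->
  is_derive u v (h \o g) (dh * dg).
Proof.
move=> [gd gE] hd.
have E (k : 'rV[R]_d -> R) : 'D_v k u = 'D_1 (fun t : R => k (t *: v + u)) 0.
  rewrite /derive; set g1 := fun h => h^-1 *: _; set g2 := fun h => h^-1 *: _.
  suff -> : g1 = g2 by [].
  by rewrite funeqE /g1 /g2 => t /=; rewrite addr0 scale0r add0r [_%:A]mulr1.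
have gl : is_derive (0:R) 1 (fun t : R => g (t *: v + u)) dg.
  by split; [exact: (derivable1P g u v).1|rewrite -E].
have hl : is_derive ((fun t : R => g (t *: v + u)) 0) 1 h dh.
  by rewrite /= scale0r add0r.
have [cd cE] := @is_derive1_comp _ h (fun t : R => g (t *: v + u)) 0 _ _ hl gl.
by split; [exact: (derivable1P (h \o g) u v).2|rewrite E].
Qed.

Lemma class_C_flat p U j g : open U -> class_C p U g ->
  class_C p U (fun u => flat j (g u)).
Proof.
move=> oU; elim: p j g => [|p IH] j g.
  move=> [cg _]; split=> // u Uu.
  by apply: continuous_comp; [exact: cg|exact: continuous_flat].
move=> gC; have g' := class_CW gC; case: gC => cg dg; split.
  by move=> u Uu; apply: continuous_comp; [exact: cg|exact: continuous_flat].
move=> i; have [di Di] := dg i.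
have D u : U u -> is_derive u (delta_mx 0 i) (fun u => flat j (g u))
    ((flat j.+2 (g u) - j%:R * flat j.+1 (g u)) * 'D_(delta_mx 0 i) g u).
  move=> Uu; apply: is_derive_comp_line; first by apply: derivableP; exact: di.
  exact: is_derive_flat.
split=> [u Uu|]; first exact: (@ex_derive _ _ _ _ _ _ _ (D _ Uu)).
have jC := class_C_cst (d := d) p (- j%:R : R) oU.
apply: class_C_ext (class_CM oU
  (class_CD oU (IH j.+2 _ g') (class_CM oU jC (IH j.+1 _ g'))) Di) => //.
by move=> u Uu; rewrite (@derive_val _ _ _ _ _ _ _ (D _ Uu)) mulNr.
Qed.

(** The usual smooth cutoff, equal to 1 up to 1 and to 0 from 2 on. The two terms of the denominator
    do not vanish together, as t < 2 or t > 1. *)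
Definition plateau (t : R) : R := flat 0 (2 - t) / (flat 0 (2 - t) + flat 0 (t - 1)).

Lemma plateau_den t : flat 0 (2 - t) + flat 0 (t - 1) > 0 :> R.
Proof.
have [t1|t1] := ltP 1 t.
  by rewrite ltr_wpDl ?flat_ge0 ?flat_gt0 ?subr_gt0.
by rewrite ltr_pwDl ?flat_ge0 ?flat_gt0 ?subr_gt0// (le_lt_trans t1) ?ltr1n.
Qed.

Lemma plateau_ge0 t : 0 <= plateau t.
Proof. by rewrite divr_ge0 ?flat_ge0 ?ltW ?plateau_den. Qed.

Lemma plateau1 t : t <= 1 -> plateau t = 1.
Proof.
move=> t1; rewrite /plateau (flat_le0 _ (_ : t - 1 <= 0)) ?subr_le0// addr0 divff//.
by rewrite gt_eqF// flat_gt0// subr_gt0 (le_lt_trans t1) ?ltr1n.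
Qed.

Lemma plateau0 t : 2 <= t -> plateau t = 0.
Proof. by move=> t2; rewrite /plateau flat_le0 ?subr_le0// mul0r. Qed.

Lemma class_C_plateau p U g : open U -> class_C p U g ->
  class_C p U (fun u => plateau (g u)).
Proof.
move=> oU gC.
have c := class_C_cst (d := d) p _ oU.
have gN : class_C p U (fun u => 2 - g u).
  have := class_CD oU (c 2) (class_CM oU (c (-1)) gC).
  by apply: class_C_ext => // u _; rewrite mulN1r.
have gP : class_C p U (fun u => g u - 1) by exact: class_CD (c (-1)).
have f2 := class_C_flat 0 oU gN; have f1 := class_C_flat 0 oU gP.
apply: class_CM => //; apply: class_CV; [by []| |exact: class_CD].
by move=> u _; rewrite gt_eqF ?plateau_den.
Qed.
End ClassC.

(** * Smooth functions and bump functions on a manifold *)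

Section SmoothOnManifold.
Variables (R : realType) (d : nat) (M : topologicalType) (S : manifold R d M).
Implicit Types (U V W : set M) (f g : M -> R).

Lemma chart_image_open_sub (i : chart_index S) W : open W ->
  open (chart i @` (chart_dom i `&` W)).
Proof.
move=> oW; rewrite openE => _ [x [ix Wx] <-]; rewrite /interior.
have iu : (chart i @` chart_dom i) (chart i x) by exists x.
have ci := chart_inv_continuous iu.
have nW : nbhs (chart_inv i (chart i x)) W.
  by rewrite chartK//; exact: open_nbhs_nbhs.
have n1 : nbhs (chart i x) (chart i @` chart_dom i).
  by apply: open_nbhs_nbhs; split=> //; exact: chart_image_open.
have n2 : nbhs (chart i x) (chart_inv i @^-1` W) by exact: ci nW.
apply: filterS (filterI n1 n2) => _ [[y iy <-]]; rewrite /preimage/= chartK// => Wy.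
by exists y.
Qed.

Lemma smooth_sub W V f : V `<=` W -> smooth S W f -> smooth S V f.
Proof.
move=> VW fS i p; apply: class_C_sub (fS i p).
by move=> _ [x [ix Vx] <-]; exists x => //; split=> //; exact: VW.
Qed.

Lemma smooth_local W f :
  (forall x, W x -> exists2 V, V x & smooth S V f) -> smooth S W f.
Proof.
move=> loc i p; apply: class_C_local => _ [x [ix Wx] <-].
by have [V Vx fV] := loc _ Wx; exists (chart i @` (chart_dom i `&` V)); [by exists x|exact: fV].
Qed.

Lemma smooth_ext W f g : open W -> (forall x, W x -> f x = g x) ->
  smooth S W f -> smooth S W g.
Proof.
move=> oW fg fS i p; apply: class_C_ext (fS i p); first exact: chart_image_open_sub.
by move=> _ [x [ix Wx] <-] /=; rewrite chartK// fg.
Qed.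

Lemma smooth_cst W (c : R) : open W -> smooth S W (fun=> c).
Proof. by move=> oW i p; apply: class_C_cst; exact: chart_image_open_sub. Qed.

Lemma smooth_add W f g : open W -> smooth S W f -> smooth S W g ->
  smooth S W (fun x => f x + g x).
Proof.
move=> oW fS gS i p.
by apply: class_CD; [exact: chart_image_open_sub|exact: fS|exact: gS].
Qed.

Lemma smooth_mul W f g : open W -> smooth S W f -> smooth S W g ->
  smooth S W (fun x => f x * g x).
Proof.
move=> oW fS gS i p.
by apply: class_CM; [exact: chart_image_open_sub|exact: fS|exact: gS].
Qed.

Lemma smooth_inv W f : open W -> (forall x, W x -> f x != 0) ->
  smooth S W f -> smooth S W (fun x => (f x)^-1).
Proof.
move=> oW f0 fS i p; apply: class_CV; [exact: chart_image_open_sub| |exact: fS].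
by move=> _ [x [ix Wx] <-] /=; rewrite chartK// f0.
Qed.

Lemma smooth_sum W (I : Type) (s : seq I) (P : pred I) (F : I -> M -> R) :
  open W -> (forall i, P i -> smooth S W (F i)) ->
  smooth S W (fun x => \sum_(i <- s | P i) F i x).
Proof.
move=> oW FS i p; apply: (@class_C_sum _ _ _ _ _ _ _ (fun j u => F j (chart_inv i u))).
  exact: chart_image_open_sub.
by move=> j Pj; exact: FS.
Qed.

Lemma smooth_prod W (I : Type) (s : seq I) (P : pred I) (F : I -> M -> R) :
  open W -> (forall i, P i -> smooth S W (F i)) ->
  smooth S W (fun x => \prod_(i <- s | P i) F i x).
Proof.
move=> oW FS; elim: s => [|i s IH].
  rewrite (_ : (fun x => _) = fun=> 1); first exact: smooth_cst.
  by apply/funext => x; rewrite big_nil.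
case Pi : (P i).
  rewrite (_ : (fun x => _) = fun x => F i x * \prod_(i <- s | P i) F i x).
    by apply: smooth_mul => //; exact: FS.
  by apply/funext => x; rewrite big_cons Pi.
by rewrite (_ : (fun x => _) = fun x => \prod_(i <- s | P i) F i x)//;
  apply/funext => x; rewrite big_cons Pi.
Qed.

Lemma smooth_plateau W f : open W -> smooth S W f ->
  smooth S W (fun x => plateau (f x)).
Proof.
by move=> oW fS i p; apply: class_C_plateau; [exact: chart_image_open_sub|exact: fS].
Qed.

Definition smooth_fun_cst (c : R) : smooth_fun S := SmoothFun (smooth_cst c openT).
Definition smooth_fun_mul (f g : smooth_fun S) : smooth_fun S :=
  SmoothFun (smooth_mul openT (smooth_funP f) (smooth_funP g)).

Lemma smooth_chart_coord (i : chart_index S) (k : 'I_d) :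
  smooth S (chart_dom i) (fun x => chart i x 0 k).
Proof. by move=> j; rewrite setIC; move: (chart_transition j i k); rewrite setIC. Qed.

(** Extension by zero: U and the complement of K cover M, and the product is zero on the latter.
    Outside U, g is arbitrary. *)
Lemma smooth_supported (b : M -> R) (K U : set M) g : closed K -> K `<=` U ->
  open U -> smooth S U b -> (forall y, ~ K y -> b y = 0) -> smooth S U g ->
  smooth S setT (fun y => b y * g y).
Proof.
move=> cK KU oU bS b0 gS; apply: smooth_local => x _.
have [Kx|Kx] := pselect (K x).
  by exists U; [exact: KU|exact: smooth_mul].
exists (~` K) => //; apply: (@smooth_ext _ (fun=> 0)).
- exact: closed_openC.
- by move=> y Ky; rewrite b0// mul0r.
- exact: smooth_cst (closed_openC cK).
Qed.

Lemma bump_exists U x : open U -> U x -> exists (b : smooth_fun S) (K : set M),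
  [/\ compact K, K `<=` U, forall y, 0 <= b y, forall y, ~ K y -> b y = 0 &
      \forall y \near x, b y = 1].
Proof.
move=> oU Ux; have [i ix] := chart_cover S x.
pose W := chart i @` (chart_dom i `&` U); pose c := chart i x.
have oW : open W := chart_image_open_sub oU.
have /nbhs_ballP[e /= e0 eW] : nbhs c W.
  by apply: open_nbhs_nbhs; split=> //; exists x.
(* A sum of squares replaces the maximum norm, which is not smooth. The cube [K0] below lies in the
   ball of radius e since 3/4 < 1, and outside it q is at least (3/4)^2 / (1/2)^2 = 9/4 > 2, where
   [plateau] vanishes. *)
pose rho := e / 2; pose q (u : 'rV[R]_d) := \sum_k ((u 0 k - c 0 k) / rho) ^+ 2.
have rho0 : 0 < rho by rewrite divr_gt0.
pose K0 := [set u : 'rV[R]_d |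
  forall k, [set` `[c 0 k - 3 / 4 * e, c 0 k + 3 / 4 * e]] (u 0 k)].
have cK0 : compact K0.
  apply: (@rV_compact _ _
    (fun k => `[c 0 k - 3 / 4 * e, c 0 k + 3 / 4 * e]%classic)) => k.
  exact: segment_compact.
have K0W : K0 `<=` W.
  move=> u uK; apply: eW; rewrite mx_norm_ball /ball_ /= [ltLHS]/Num.norm /= mx_normrE.
  apply/bigmax_ltP; split=> // -[a k] _ /=; rewrite !mxE (ord1 a).
  have := uK k; rewrite /= in_itv /= => /andP[u1 u2].
  by rewrite ltr_norml; apply/andP; split; lra.
have q2 u : ~ K0 u -> 2 <= q u.
  move=> /existsNP[k uk]; rewrite /q (bigD1 k)//=.
  rewrite -[2]addr0 lerD ?sumr_ge0//; last by move=> *; rewrite sqr_ge0.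
  rewrite expr_div_n ler_pdivlMr ?exprn_gt0//.
  have big : 3 / 4 * e <= `|u 0 k - c 0 k|.
    rewrite leNgt; apply/negP; rewrite ltr_norml => /andP[u1 u2]; apply: uk.
    by rewrite /= in_itv /=; apply/andP; split; lra.
  rewrite -[X in _ <= X]real_normK ?num_real//.
  apply: (@le_trans _ _ ((3 / 4 * e) ^+ 2)); last first.
    by rewrite lerXn2r ?nnegrE ?normr_ge0//; lra.
  by rewrite /rho; nra.
pose K := chart_inv i @` K0.
have KU : K `<=` chart_dom i `&` U.
  by move=> _ [u /K0W[y [iy Uy] <-] <-]; rewrite chartK.
have cK : compact K.
  apply: continuous_compact cK0; apply: continuous_in_subspaceT => u.
  rewrite inE => /K0W[y [iy Uy] <-].
  by apply: chart_inv_continuous; exists y.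
(* The Hausdorff property makes the compact K closed, so b vanishes on an open set which, with the
   chart domain, covers M. *)
have clK : closed K := compact_closed (manifold_hausdorff S) cK.
pose b y := if pselect (chart_dom i y) then plateau (q (chart i y)) else 0.
have bE y : chart_dom i y -> b y = plateau (q (chart i y)).
  by rewrite /b; case: pselect.
have b0 y : ~ K y -> b y = 0.
  rewrite /b; case: pselect => // iy Ky; apply: plateau0; apply: q2 => Ky0.
  by apply: Ky; exists (chart i y) => //; rewrite chartK.
have bS : smooth S setT b.
  apply: smooth_local => y _; have [iy|iy] := pselect (chart_dom i y).
    exists (chart_dom i) => //; have oi := chart_dom_open i.
    apply: (@smooth_ext _ (fun z => plateau (q (chart i z)))) => //.
      by move=> z iz; rewrite bE.
    apply: smooth_plateau => //; apply: smooth_sum => // k _.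
    apply: (@smooth_ext _ (fun z => ((chart i z 0 k - c 0 k) / rho) *
        ((chart i z 0 k - c 0 k) / rho))) => //.
    have h : smooth S (chart_dom i) (fun z => (chart i z 0 k - c 0 k) / rho).
      apply: smooth_mul => //; last exact: smooth_cst.
      by apply: smooth_add => //; [exact: smooth_chart_coord|exact: smooth_cst].
    exact: smooth_mul.
  exists (~` K); first by move=> /KU[].
  apply: (@smooth_ext _ (fun=> 0)); first exact: closed_openC.
    by move=> z Kz; rewrite b0.
  exact: smooth_cst (closed_openC clK).
exists (SmoothFun bS), K; split=> //=.
- by move=> y /KU[].
- by move=> y; rewrite /b; case: pselect => // ?; exact: plateau_ge0.
have [cq0 _] : class_C 0 setT q.
  apply: class_C_sum => [|k _]; first exact: openT.
  split=> [u _|//]; have h : {for u, continuous (fun v : 'rV[R]_d => (v 0 k - c 0 k) / rho)}.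
    apply: continuousM; last exact: cst_continuous.
    by apply: continuousB; [exact: coord_continuous|exact: cst_continuous].
  exact: (continuousM h h).
have cq : {for x, continuous (q \o chart i)}.
  by apply: continuous_comp; [exact: chart_continuous|exact: cq0].
have qx : q (chart i x) = 0.
  by rewrite /q big1// => k _; rewrite subrr mul0r expr0n.
have n1 : \forall y \near x, q (chart i y) < 1.
  have h : nbhs (q (chart i x)) [set t : R | t < 1].
    by rewrite qx; apply: lt_nbhsl.
  exact: cq h.
have n2 : \forall y \near x, chart_dom i y.
  by apply: open_nbhs_nbhs; split=> //; exact: chart_dom_open.
apply: filterS (filterI n1 n2) => y [qy iy].
by rewrite -[LHS]/(b y) bE// plateau1// ltW.
Qed.

End SmoothOnManifold.

(** * Locally finite families of bump functions *)

Section LocallyFinite.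
Variables (R : realType) (d : nat) (M : topologicalType) (S : manifold R d M).

Lemma locally_finite_compact (D : set (set M)) (K : set M) : compact K ->
  (forall x : M, exists2 W : set M, nbhs x W & finite_set [set V | D V /\ V `&` W !=set0]) ->
  finite_set [set V | D V /\ V `&` K !=set0].
Proof.
have [->|/set0P[x0 _]] := eqVneq K set0.
  move=> _ _; rewrite (_ : [set _ | _] = set0)//.
  by apply/seteqP; split=> // V [_ [y [_ []]]].
move=> cK lf.
(* The characterisation of compactness by open covers is stated for pointed spaces; a point of K
   serves as base point. *)
pose pointM := isPointed.Build M x0; pose M' : ptopologicalType := HB.pack M pointM.
have lf' (x : M) : exists W, nbhs x W /\ finite_set [set V | D V /\ V `&` W !=set0].
  by have [W ? ?] := lf x; exists W.
have [W Wn] := choice lf'.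
have [s sP] : exists s : seq M, forall y, K y -> exists2 x, x \in s & W x y.
  have : @cover_compact M' K by rewrite -(compact_cover M').
  move=> /(_ M' setT (fun x => (W x)°)) [].
  - by move=> x _; exact: open_interior.
  - by move=> x _; exists x => //; have [] := Wn x.
  move=> X _ KX; exists (finmap.enum_fset X) => y /KX[x Xx /interior_subset Wy].
  by exists x.
have sub : [set V | D V /\ V `&` K !=set0] `<=`
    \bigcup_(x in [set` s]) [set V | D V /\ V `&` W x !=set0].
  move=> V [DV [y [Vy /sP[x xs Wy]]]].
  by exists x => //; split=> //; exists y.
apply: sub_finite_set sub _.
by apply: bigcup_finite => [|x _]; [exact: finite_seq|have [] := Wn x].
Qed.

(* A weak partition of unity: only positivity of the sum of the b_i is needed.
   A first locally finite refinement D1 controls the supports, a second one,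
   finer than the sets where the bumps are 1, the indices. *)
Lemma locally_finite_bumps (O : M -> set M) : paracompact M ->
  (forall x, open (O x)) -> (forall x, O x x) ->
  exists b : M -> smooth_fun S,
  [/\ forall x y, 0 <= b x y,
      forall x y, b x y != 0 -> O x y,
      forall y, exists x, 0 < b x y &
      forall y : M, exists2 W : set M, nbhs y W &
        finite_set [set x | exists2 z, W z & b x z != 0]].
Proof.
move=> pM oO Ox.
have [[x0 _]|M0] := pselect (exists y : M, True); last first.
  by exists (fun=> smooth_fun_cst S 0); split=> y; case: M0; exists y.
have bumpP U x : open U -> U x -> exists b : smooth_fun S, exists K V : set M,
   [/\ compact K, open V, V x, forall y, 0 <= b y &
     [/\ K `<=` U, V `<=` K, forall y, V y -> b y = 1 & forall y, b y != 0 -> K y]].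
  move=> oU Ux; have [b [K [cK KU b0 bK b1]]] := bump_exists S oU Ux.
  have bK' y : b y != 0 -> K y.
    by move=> by0; apply: contrapT => /bK b_; rewrite b_ eqxx in by0.
  exists b, K, ([set y | b y = 1]°); split=> //; first exact: open_interior.
  split=> // y /interior_subset //= y1; apply: bK'; rewrite y1; exact: oner_neq0.
have [f0 f0P] := choice (fun x => bumpP _ _ (oO x) (Ox x)).
have [K0 K0P] := choice f0P; have [V0 {f0P K0P}V0P] := choice K0P.
have [D1 [oD1 cD1 rD1 lD1]] : exists D : set (set M), [/\ (forall V, D V -> open V),
    (forall x, exists2 V, D V & V x),
    (forall V, D V -> exists2 U, range V0 U & V `<=` U) &
    (forall x : M, exists2 W : set M, nbhs x W &
       finite_set [set V | D V /\ V `&` W !=set0])].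
  by apply: pM => [_ [x _ <-]|x]; [have [] := V0P x|
     exists (V0 x); [exists x|have [] := V0P x]].
have cD1' (x : M) : exists V, D1 V /\ V x by have [V ? ?] := cD1 x; exists V.
have [V1 V1P] := choice cD1'.
have bumpQ x : exists b : smooth_fun S, exists K V : set M,
   [/\ compact K, open V, V x, forall y, 0 <= b y &
     [/\ K `<=` O x `&` V1 x, V `<=` K, forall y, V y -> b y = 1 & forall y, b y != 0 -> K y]].
  have [DV Vx] := V1P x; apply: bumpP; last by split.
  by apply: openI => //; exact: oD1.
have [b1 b1P] := choice bumpQ; have [K1 K1P] := choice b1P.
have [V2 {b1P K1P}V2P] := choice K1P.
have [D2 [oD2 cD2 rD2 lD2]] : exists D : set (set M), [/\ (forall V, D V -> open V),
    (forall x, exists2 V, D V & V x),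
    (forall V, D V -> exists2 U, range V2 U & V `<=` U) &
    (forall x : M, exists2 W : set M, nbhs x W &
       finite_set [set V | D V /\ V `&` W !=set0])].
  by apply: pM => [_ [x _ <-]|x]; [have [] := V2P x|
     exists (V2 x); [exists x|have [] := V2P x]].
have cP i : exists x : M, D2 i -> i `<=` V2 x.
  have [Di|Di] := pselect (D2 i); last by exists x0.
  by have [_ [x _ <-] iV] := rD2 _ Di; exists x.
have [c {}cP] := choice cP.
(* One set of D1 may be [V1 x] for infinitely many x, so only the centres of nonempty members of D2
   keep their bump. *)
pose I x := exists i, [/\ D2 i, i !=set0 & c i = x].
pose b x : smooth_fun S := if pselect (I x) then b1 x else smooth_fun_cst S 0.
have bE x y : b x y != 0 -> I x /\ b1 x y != 0.
  by rewrite /b; case: (pselect (I x)) => [Ix bx|_ /=]; [split|rewrite eqxx].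
exists b; split.
- move=> x y; rewrite /b; case: (pselect (I x)) => [?|//] /=.
  by have [_ _ _ b_ge0 _] := V2P x; exact: b_ge0.
- move=> x y /bE[_]; have [_ _ _ _ [KO _ _ bK]] := V2P x.
  by move/bK/KO => [].
- move=> y; have [i Di iy] := cD2 y; exists (c i).
  have Ii : I (c i) by exists i; split=> //; exists y.
  have [_ _ _ _ [_ _ b11 _]] := V2P (c i).
  rewrite /b; case: (pselect (I (c i))) => [?|/(_ Ii)//] /=.
  by rewrite b11 ?ltr01//; exact: cP iy.
move=> y; have [W Wy fW] := lD1 y; exists W => //.
(* If the bump at x is nonzero somewhere on W, then [V1 x] meets W and is one of finitely many sets
   V of D1. Such a V lies in a compact set, which meets only finitely many members of D2, and x is
   the centre of one of them that is contained in V. *)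
pose F V := c @` [set i | D2 i /\ i `&` V !=set0].
apply: (@sub_finite_set _ _ (\bigcup_(V in [set V | D1 V /\ V `&` W !=set0]) F V)).
  move=> x [z Wz /bE[[i [Di [t it] ix]] bz]]; exists (V1 x).
    split; first by have [] := V1P x.
    have [_ _ _ _ [KO _ _ bK]] := V2P x.
    by exists z; split=> //; have [] := KO _ (bK _ bz).
  exists i => //; split=> //; exists t; split=> //.
  have [_ _ _ _ [KO VK _ _]] := V2P x.
  by have := cP _ Di _ it; rewrite ix => /VK/KO[].
apply: bigcup_finite => // V [DV _]; apply: finite_image.
have [_ [x _ <-] VV0] := rD1 _ DV; have [cK _ _ _ [_ VK _ _]] := V0P x.
apply: sub_finite_set (locally_finite_compact cK lD2) => i [Di [t [it Vt]]].
by split=> //; exists t; split=> //; apply: VK; exact: VV0.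
Qed.

Lemma smooth_fsum (I : choiceType) (F : I -> M -> R) :
  (forall i, smooth S setT (F i)) ->
  (forall y : M, exists2 W : set M, nbhs y W & finite_set [set i | exists2 z, W z & F i z != 0]) ->
  smooth S setT (fun y => \sum_(i \in setT) F i y).
Proof.
move=> FS lf; apply: smooth_local => y _; have [W Wy fW] := lf y.
exists W°; first exact: Wy.
have /finite_seqP[s sE] := fW.
apply: (@smooth_ext _ _ _ _ _ (fun z => \sum_(i <- undup s) F i z)).
- exact: open_interior.
- move=> z /interior_subset Wz.
  rewrite (@fsbigE _ _ _ _ _ (undup s)) ?undup_uniq//; last first.
    move=> i _; rewrite mem_undup => /negP si; apply: contrapT => /eqP Fz.
    by apply: si; have : [set` s] i by rewrite -sE; exists z.
  by rewrite [RHS]big_mkcond /=; apply: eq_bigr => i _; rewrite in_setT.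
apply: smooth_sum; first exact: open_interior.
by move=> i _; apply: smooth_sub (FS i).
Qed.
End LocallyFinite.

Lemma the_spec (T : Type) (x0 : T) (P : set T) : (exists x, P x) -> P (the x0 P).
Proof. by move=> Px; rewrite /the; case: pselect => // h; case: (cid h). Qed.

Local Notation iprod := Defs.interior.
Arguments altfun : simpl never.

(** * Alternating forms *)

Section Altforms.
Variable R : realType.
Implicit Types (V : lmodType R) (k r : nat).

Lemma altform_ext k V (f g : altform k V) : (forall X, f X = g X) -> f = g.
Proof. by move=> fg; apply: val_inj; apply/funext => X; exact: fg. Qed.

Lemma altformD k V (f g : altform k V) X : (f + g) X = f X + g X.
Proof. by []. Qed.

Lemma altformZ k V a (f : altform k V) X : (a *: f) X = a * f X.
Proof. by []. Qed.

Lemma altform0 k V X : (0 : altform k V) X = 0.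
Proof. by []. Qed.

Lemma altformN k V (f : altform k V) X : (- f) X = - f X.
Proof. by []. Qed.

Lemma altform_sum k V (I : Type) (s : seq I) (P : pred I) (f : I -> altform k V) X :
  (\sum_(i <- s | P i) f i) X = \sum_(i <- s | P i) f i X.
Proof. by apply: (big_morph (fun g : altform k V => g X)). Qed.

Lemma upd_same k V (X : 'I_k -> V) i v : upd X i v i = v.
Proof. by rewrite /upd eqxx. Qed.

Lemma upd_neq k V (X : 'I_k -> V) i v j : j != i -> upd X i v j = X j.
Proof. by rewrite /upd => /negPf ->. Qed.

Lemma upd_id k V (X : 'I_k -> V) i : upd X i (X i) = X.
Proof. by apply/funext => j; rewrite /upd; case: eqP => // ->. Qed.

Lemma upd_upd k V (X : 'I_k -> V) i u v : upd (upd X i u) i v = upd X i v.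
Proof. by apply/funext => j; rewrite /upd; case: eqP. Qed.

Lemma updC k V (X : 'I_k -> V) i j u v : i != j ->
  upd (upd X i u) j v = upd (upd X j v) i u.
Proof.
move=> ij; apply/funext => l; rewrite /upd.
by case: eqP => // ->; rewrite eq_sym (negPf ij).
Qed.

Lemma vcons0 k V v (X : 'I_k -> V) : vcons v X ord0 = v.
Proof. by rewrite /vcons unlift_none. Qed.

Lemma vconsS k V v (X : 'I_k -> V) j : vcons v X (lift ord0 j) = X j.
Proof. by rewrite /vcons liftK. Qed.

Lemma vcons_eta k V (X : 'I_k.+1 -> V) : vcons (X ord0) (X \o lift ord0) = X.
Proof. by apply/funext => i; rewrite /vcons; case: unliftP => [j ->|->]. Qed.

Lemma vcons_upd0 k V v w (X : 'I_k -> V) : upd (vcons v X) ord0 w = vcons w X.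
Proof.
apply/funext => i; rewrite /upd /vcons; case: unliftP => [j ->|->].
  by rewrite eq_sym (negPf (neq_lift _ _)).
by rewrite eqxx.
Qed.

Lemma vcons_updS k V v w (X : 'I_k -> V) i :
  upd (vcons v X) (lift ord0 i) w = vcons v (upd X i w).
Proof.
apply/funext => j; rewrite /upd /vcons; case: unliftP => [j' ->|->].
  by rewrite (inj_eq lift_inj).
by rewrite (negPf (neq_lift _ _)).
Qed.

Section Slots.
Variables (k : nat) (V : lmodType R) (f : altform k V).

Lemma altform_lin X i a u v :
  f (upd X i (a *: u + v)) = a * f (upd X i u) + f (upd X i v).
Proof. by have [-> _] := altformP f. Qed.

Lemma altform_alt X i j : i != j -> X i = X j -> f X = 0.
Proof. by have [_ h] := altformP f; exact: h. Qed.

Lemma altform_updD X i u v : f (upd X i (u + v)) = f (upd X i u) + f (upd X i v).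
Proof. by rewrite -[u]scale1r altform_lin mul1r scale1r. Qed.

Lemma altform_upd0 X i : f (upd X i 0) = 0.
Proof.
by have := altform_updD X i 0 0; rewrite addr0 => /eqP; rewrite -subr_eq0 opprD addNKr oppr_eq0 => /eqP.
Qed.

Lemma altform_updZ X i a u : f (upd X i (a *: u)) = a * f (upd X i u).
Proof. by rewrite -[a *: u]addr0 altform_lin altform_upd0 addr0. Qed.

Lemma altform_updN X i u : f (upd X i (- u)) = - f (upd X i u).
Proof. by rewrite -scaleN1r altform_updZ mulN1r. Qed.

Lemma altform_upd_sum X i (I : Type) (s : seq I) (P : pred I) (F : I -> V) :
  f (upd X i (\sum_(l <- s | P l) F l)) = \sum_(l <- s | P l) f (upd X i (F l)).
Proof.
exact: (big_morph (fun v => f (upd X i v)) (altform_updD X i) (altform_upd0 X i)).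
Qed.

Lemma altform_swap_upd X i j u v : i != j ->
  f (upd (upd X i u) j v) = - f (upd (upd X i v) j u).
Proof.
move=> ij; have F0 w : f (upd (upd X i w) j w) = 0.
  by apply: (altform_alt ij); rewrite upd_same upd_neq// upd_same.
apply/eqP; rewrite -addr_eq0.
have := F0 (u + v); rewrite altform_updD 2!(updC _ _ _ ij) !altform_updD.
by rewrite -!(updC _ _ _ ij) !F0 add0r addr0 addrC => ->.
Qed.

Lemma altform_tperm X i j : i != j -> f (X \o tperm i j) = - f X.
Proof.
move=> ij; have -> : X \o tperm i j = upd (upd X i (X j)) j (X i).
  apply/funext => l; rewrite /upd /=; case: tpermP => [->|->|/eqP li /eqP lj].
  - by rewrite (negPf ij) eqxx.
  - by rewrite eqxx.
  - by rewrite (negPf li) (negPf lj).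
by rewrite altform_swap_upd// !upd_id.
Qed.

Lemma altform_perm (s : 'S_k) X : f (X \o s) = (-1) ^+ s * f X.
Proof.
have [ts -> dts] := prod_tpermP s.
elim: ts dts X => [|[i j] ts IH] /= => [_|/andP[ij dts]] X.
  by rewrite big_nil odd_perm1 mul1r; congr (f _); apply/funext => l; rewrite /= perm1.
rewrite big_cons /=.
rewrite (_ : X \o _ = (X \o (\prod_(t <- ts) tperm t.1 t.2)%g) \o tperm i j); last first.
  by apply/funext => l; rewrite /= permM.
rewrite altform_tperm// IH// odd_permM odd_tperm ij /=.
by case: (odd_perm _); rewrite /= ?expr0 ?expr1 ?mul1r ?mulN1r ?opprK.
Qed.

End Slots.

Lemma altform_vcons_lin k V (f : altform k.+1 V) a u v X :
  f (vcons (a *: u + v) X) = a * f (vcons u X) + f (vcons v X).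
Proof. by have := altform_lin f (vcons 0 X) ord0 a u v; rewrite !vcons_upd0. Qed.

Lemma altform_vcons_scale k V (f : altform k.+1 V) a u X :
  f (vcons (a *: u) X) = a * f (vcons u X).
Proof. by have := altform_updZ f (vcons 0 X) ord0 a u; rewrite !vcons_upd0. Qed.

Lemma altform_vcons_swap k V (f : altform k.+1 V) u v X i :
  f (vcons u (upd X i v)) = - f (vcons v (upd X i u)).
Proof.
have E x y : vcons x (upd X i y) = upd (upd (vcons 0 X) ord0 x) (lift ord0 i) y.
  by rewrite vcons_upd0 vcons_updS.
by rewrite !E altform_swap_upd// neq_lift.
Qed.

(** [lift_perm ord0 i 1] is the cycle that brings slot i to the front; its sign is (-1)^i. *)
Lemma altform_upd_vcons k V (f : altform k.+1 V) X i v :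
  f (upd X i v) = (-1) ^+ i * f (vcons v (X \o lift i)).
Proof.
have -> : vcons v (X \o lift i) = upd X i v \o lift_perm ord0 i 1.
  apply/funext => j; rewrite /vcons /=; case: unliftP => [l ->|->].
    by rewrite lift_perm_lift perm1 upd_neq// eq_sym neq_lift.
  by rewrite lift_perm_id upd_same.
rewrite altform_perm odd_lift_perm odd_perm1 addbF /=.
by rewrite mulrA -[(-1) ^+ i]signr_odd -signr_addb addbb mul1r.
Qed.

(** The vectors [e] may differ from slot to slot: besides expansions in a basis, this covers
    splitting each argument in its own way, as in [ann_all]. *)
Lemma altform_expand k V (f : altform k V) r (c : 'I_k -> 'I_r -> R)
    (e : 'I_k -> 'I_r -> V) :
  f (fun i => \sum_l c i l *: e i l) =
  \sum_(g : {ffun 'I_k -> 'I_r}) (\prod_i c i (g i)) * f (fun i => e i (g i)).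
Proof.
elim: k f c e => [|k IH] f c e.
  pose g0 : {ffun 'I_0 -> 'I_r} := [ffun i : 'I_0 => False_rect _ (notF (ltn_ord i))].
  rewrite (big_pred1 g0) => [|g]; last by apply/esym/eqP/ffunP => -[].
  by rewrite big_ord0 mul1r; congr (f _); apply/funext => -[].
pose h (p : 'I_r * {ffun 'I_k -> 'I_r}) : {ffun 'I_k.+1 -> 'I_r} :=
  [ffun i => if unlift ord0 i is Some j then p.2 j else p.1].
pose h' (g : {ffun 'I_k.+1 -> 'I_r}) := (g ord0, [ffun j => g (lift ord0 j)]).
have hK : cancel h h'.
  move=> [l g]; rewrite /h' /h ffunE unlift_none; congr (_, _).
  by apply/ffunP => j; rewrite !ffunE liftK.
have h'K : cancel h' h.
  move=> g; apply/ffunP => i; rewrite /h' /h ffunE; case: unliftP => [j ->|->] //=.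
  by rewrite ffunE.
rewrite (reindex h) /=; last by exists h' => ? _; [exact: hK|exact: h'K].
rewrite -(pair_bigA _ (fun l g => (\prod_i c i (h (l, g) i)) *
  f (fun i => e i (h (l, g) i)))) /=.
set X := fun i => _.
rewrite -(vcons_eta X) /X /= -[vcons _ _](vcons_upd0 0) altform_upd_sum.
apply: eq_bigr => l _; rewrite altform_updZ vcons_upd0.
have -> : f (vcons (e ord0 l) ((fun i => \sum_l c i l *: e i l) \o lift ord0)) =
    \sum_(g : {ffun 'I_k -> 'I_r}) (\prod_i c (lift ord0 i) (g i)) *
      f (vcons (e ord0 l) (fun i => e (lift ord0 i) (g i))).
  exact: (IH (iprod (e ord0 l) f) (fun i => c (lift ord0 i)) (fun i => e (lift ord0 i))).
rewrite mulr_sumr.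
apply: eq_bigr => g _; rewrite big_ord_recl /h ffunE unlift_none /= mulrA.
congr (_ * _ * f _).
  by apply: eq_bigr => i _; rewrite ffunE liftK.
apply/funext => i; rewrite /vcons; case: unliftP => [j ->|->].
  by rewrite ffunE liftK.
by rewrite ffunE unlift_none.
Qed.

End Altforms.

Lemma lift_perm_exists n (s : 'S_n.+1) i j : s i = j -> exists t, lift_perm i j t = s.
Proof.
move=> sij; pose u k := odflt k (unlift j (s (lift i k))).
have uK k : lift j (u k) = s (lift i k).
  rewrite /u; case: unliftP => [l ->//|]; rewrite -sij => /perm_inj /eqP.
  by rewrite eq_sym (negPf (neq_lift _ _)).
have uI : injective u.
  by move=> k l kl; apply: (@lift_inj _ i); apply: (@perm_inj _ s); rewrite -!uK kl.
exists (perm uI); apply/permP => x; case: (unliftP i x) => [k ->|->].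
  by rewrite lift_perm_lift permE uK.
by rewrite lift_perm_id.
Qed.

(** * Products of covectors, and endomorphisms of rank one acting on forms *)

Section Forms.
Variables (R : realType) (V : lmodType R).

(** The m! permutations sending the last position to i contribute equal terms, which the
    normalisation 1 / m! absorbs. The sign (-1)^(m + i) is that of moving slot i to the end. *)
Lemma wedge1E m (f : altform m V) (g : altform 1 V) X :
  wedge (addn1 m) f g X =
  \sum_(i < m.+1) (-1) ^+ (m + i) * (f (X \o lift i) * g (fun=> X i)).
Proof.
rewrite -[LHS]/(wedge_fun (addn1 m) f g X) /wedge_fun.
have El a : cast_ord (addn1 m) (lshift 1 a) = lift ord_max a.
  by apply: val_inj; rewrite /= /bump leqNgt ltn_ord.
have Er b : cast_ord (addn1 m) (rshift m b) = ord_max.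
  by apply: val_inj; rewrite /= (ord1 b) addn0.
pose T (s : 'S_m.+1) : R := (-1) ^+ s *
  (f (X \o s \o lift ord_max) * g (fun=> X (s ord_max))).
rewrite (eq_bigr T) => [|s _]; last first.
  rewrite /T; congr (_ * (f _ * g _)); apply/funext => a; first by rewrite El.
  by rewrite Er.
rewrite (partition_big (fun s : 'S_m.+1 => s ord_max) xpredT)//= mulr_sumr.
apply: eq_bigr => i _.
rewrite (reindex (lift_perm ord_max i)) /=; last first.
  pose inv (s : 'S_m.+1) := odflt 1%g [pick t | lift_perm ord_max i t == s].
  have invK (s : 'S_m.+1) : s ord_max = i -> lift_perm ord_max i (inv s) = s.
    move=> /lift_perm_exists[t ts]; rewrite /inv; case: pickP => [u /eqP//|].
    by move/(_ t); rewrite ts eqxx.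
  exists inv => [t _|s /eqP]; last exact: invK.
  apply/permP => k; apply: (@lift_inj _ i).
  by rewrite -!(lift_perm_lift ord_max) invK// lift_perm_id.
under eq_bigl do rewrite lift_perm_id eqxx.
under eq_bigr => t _.
  rewrite /T lift_perm_id.
  rewrite (_ : X \o _ \o _ = (X \o lift i) \o t); last first.
    by apply/funext => a; rewrite /= lift_perm_lift.
  rewrite altform_perm odd_lift_perm mulrA mulrA -signr_addb addbK -mulrA.
  over.
have fact1 : (1`!)%N = 1%N by rewrite factS fact0.
have factN0 : (m`!)%:R != 0 :> R by rewrite pnatr_eq0 -lt0n fact_gt0.
rewrite sumr_const card_Sn fact1 muln1 -[X in _^-1 * X = _]mulr_natl mulKf//.
by rewrite exprD -[(-1) ^+ m]signr_odd -[(-1) ^+ i]signr_odd -signr_addb mulrA.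
Qed.

(** The product y_1 /\ ... /\ y_k. The arguments index the rows, so that linearity in X is linearity
    of the determinant in its rows; [detform_trE] serves for linearity in y. *)
Definition detform_fun k (y : 'I_k -> altform 1 V) (X : 'I_k -> V) : R :=
  \det (\matrix_(j, i) y i (fun=> X j)).

Lemma cst_upd (z : V) : (fun=> z) = upd (fun=> 0) (@ord0 0) z :> ('I_1 -> V).
Proof. by apply/funext => i; rewrite /upd (ord1 i). Qed.

Lemma covec_lin (u : altform 1 V) a v w :
  u (fun=> a *: v + w) = a * u (fun=> v) + u (fun=> w).
Proof. by have := altform_lin u (fun=> 0) ord0 a v w; rewrite -!cst_upd. Qed.

Lemma covecZ (u : altform 1 V) a v : u (fun=> a *: v) = a * u (fun=> v).
Proof. by have := altform_updZ u (fun=> 0) ord0 a v; rewrite -!cst_upd. Qed.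

Lemma covecN (u : altform 1 V) v : u (fun=> - v) = - u (fun=> v).
Proof. by have := altform_updN u (fun=> 0) ord0 v; rewrite -!cst_upd. Qed.

Lemma covec_sum (u : altform 1 V) (I : Type) (s : seq I) (P : pred I) (F : I -> V) :
  u (fun=> \sum_(i <- s | P i) F i) = \sum_(i <- s | P i) u (fun=> F i).
Proof.
by have := altform_upd_sum u (fun=> 0) ord0 s P F; rewrite -cst_upd => ->;
  apply: eq_bigr => i _; rewrite -cst_upd.
Qed.

Lemma detform_alternating k (y : 'I_k -> altform 1 V) : alternating_form (detform_fun y).
Proof.
split=> [X i a u v|X i j ij Xij]; last first.
  by apply: (determinant_alternate ij) => l; rewrite !mxE Xij.
rewrite /detform_fun.
have R0 w : row' i (\matrix_(j, l) y l (fun=> upd X i w j)) =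
    row' i (\matrix_(j, l) y l (fun=> X j)).
  by apply/matrixP => j l; rewrite !mxE upd_neq// eq_sym neq_lift.
rewrite (determinant_multilinear (i0 := i) (b := a) (c := 1)
  (B := \matrix_(j, l) y l (fun=> upd X i u j))
  (C := \matrix_(j, l) y l (fun=> upd X i v j))) ?mul1r ?R0//.
by apply/matrixP => j l; rewrite !mxE !upd_same mul1r covec_lin.
Qed.

Definition detform k (y : 'I_k -> altform 1 V) : altform k V :=
  mk_altform (detform_alternating y).

Lemma detformE k (y : 'I_k -> altform 1 V) X :
  detform y X = \det (\matrix_(j, i) y i (fun=> X j)).
Proof. by []. Qed.

Lemma detform_trE k (y : 'I_k -> altform 1 V) X :
  detform y X = \det (\matrix_(i, j) y i (fun=> X j)).
Proof. by rewrite detformE -det_tr; congr (\det _); apply/matrixP => i j; rewrite !mxE. Qed.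

Lemma detform_lin k (y : 'I_k -> altform 1 V) i a u v :
  detform (upd y i (a *: u + v)) = a *: detform (upd y i u) + detform (upd y i v).
Proof.
apply: altform_ext => X; rewrite altformD altformZ !detform_trE.
have R0 w : row' i (\matrix_(l, j) upd y i w l (fun=> X j)) =
    row' i (\matrix_(l, j) y l (fun=> X j)).
  by apply/matrixP => j l; rewrite !mxE upd_neq// eq_sym neq_lift.
rewrite (determinant_multilinear (i0 := i) (b := a) (c := 1)
  (B := \matrix_(l, j) upd y i u l (fun=> X j))
  (C := \matrix_(l, j) upd y i v l (fun=> X j))) ?mul1r ?R0//.
by apply/matrixP => j l; rewrite !mxE !upd_same mul1r altformD altformZ.
Qed.

Lemma detform_alt k (y : 'I_k -> altform 1 V) i j : i != j -> y i = y j -> detform y = 0.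
Proof.
move=> ij yij; apply: altform_ext => X; rewrite detform_trE altform0.
by apply: (determinant_alternate ij) => l; rewrite !mxE yij.
Qed.

(** The mirror image of [vcons]: c is put last, as in a product with a 1-form on the right. *)
Definition rcv (T : Type) m (a : 'I_m -> T) (c : T) : 'I_m.+1 -> T :=
  fun i => if unlift ord_max i is Some j then a j else c.

Lemma rcv_max T m (a : 'I_m -> T) c : rcv a c ord_max = c.
Proof. by rewrite /rcv unlift_none. Qed.

Lemma rcv_lift T m (a : 'I_m -> T) c j : rcv a c (lift ord_max j) = a j.
Proof. by rewrite /rcv liftK. Qed.

Lemma wedge_detform m (a : 'I_m -> altform 1 V) c :
  wedge (addn1 m) (detform a) c = detform (rcv a c).
Proof.
apply: altform_ext => X; rewrite wedge1E detformE (expand_det_col _ ord_max).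
apply: eq_bigr => i _; rewrite mxE rcv_max /cofactor [RHS]mulrCA [in RHS](mulrC (c _)).
rewrite addnC; congr (_ * (_ * _)); rewrite detformE; congr (\det _).
by apply/matrixP => j l; rewrite !mxE rcv_lift.
Qed.

(* The contraction of the endomorphism c (x) X of V with w: it is
   c /\ iota_X w. *)
Definition nder_fun k (c : altform 1 V) (X : V) (w : altform k V) (Z : 'I_k -> V) : R :=
  \sum_i c (fun=> Z i) * w (upd Z i X).

Lemma nder_alternating k c X (w : altform k V) : alternating_form (nder_fun c X w).
Proof.
split=> [Z i a u v|Z i j ij Zij].
  have E z : nder_fun c X w (upd Z i z) = c (fun=> z) * w (upd Z i X) +
      \sum_(l | l != i) c (fun=> Z l) * w (upd (upd Z l X) i z).
    rewrite /nder_fun (bigD1 i)//= upd_upd upd_same; congr (_ + _).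
    by apply: eq_bigr => l li; rewrite upd_neq// updC 1?eq_sym.
  rewrite !E covec_lin mulrDl mulrDr -mulrA -!addrA; congr (_ + _).
  rewrite addrCA; congr (_ + _); rewrite mulr_sumr -big_split /=.
  by apply: eq_bigr => l _; rewrite altform_lin mulrDr mulrCA.
rewrite /nder_fun (bigD1 i)//= (bigD1 j) 1?eq_sym//= big1 => [|l /andP[li lj]].
  rewrite addr0 Zij -mulrDr.
  have -> : upd Z i X = upd (upd Z j (Z j)) i X by rewrite upd_id.
  have -> : upd Z j X = upd (upd Z j X) i (Z j).
    by rewrite -Zij updC 1?eq_sym// upd_id.
  by rewrite altform_swap_upd 1?eq_sym// addNr mulr0.
by rewrite (altform_alt w ij) ?mulr0// !upd_neq// eq_sym.
Qed.

Definition nder k c X (w : altform k V) : altform k V :=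
  mk_altform (nder_alternating c X w).

Lemma nderE k c X (w : altform k V) Z :
  nder c X w Z = \sum_i c (fun=> Z i) * w (upd Z i X).
Proof. by []. Qed.

(** A derivation acts factor by factor, replacing y_l by y_l (X) c. Both sides are the sum over i
    and l of c (Z_i) y_l (X) times one cofactor, from expansions along row i on the left and along
    column l on the right. *)
Lemma nder_detform k c X (y : 'I_k -> altform 1 V) :
  nder c X (detform y) = \sum_l y l (fun=> X) *: detform (upd y l c).
Proof.
apply: altform_ext => Z; rewrite nderE altform_sum.
pose A := \matrix_(j, i) y i (fun=> Z j).
under eq_bigr => i _.
  rewrite detformE (expand_det_row _ i) mulr_sumr.
  under eq_bigr => l _.
    rewrite mxE upd_same.
    have -> : cofactor (\matrix_(j, l) y l (fun=> upd Z i X j)) i l = cofactor A i l.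
      rewrite /cofactor; congr (_ * \det _); apply/matrixP => j l'.
      by rewrite !mxE upd_neq// eq_sym neq_lift.
    rewrite mulrCA; over.
  over.
rewrite exchange_big /=; apply: eq_bigr => l _; rewrite -mulr_sumr altformZ.
congr (_ * _); rewrite detformE (expand_det_col _ l); apply: eq_bigr => i _.
rewrite mxE upd_same; congr (_ * _); rewrite /cofactor; congr (_ * \det _).
by apply/matrixP => j l'; rewrite !mxE upd_neq// eq_sym neq_lift.
Qed.

End Forms.

(** * Decomposability *)

Section FiniteDimensional.
Variables (R : realType) (V : lmodType R) (r : nat).
Variables (e : 'I_r -> V) (ec : 'I_r -> altform 1 V).
Hypothesis eP : forall v, v = \sum_l ec l (fun=> v) *: e l.

Lemma covec_inj (u v : V) :
  (forall c : altform 1 V, c (fun=> u) = c (fun=> v)) -> u = v.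
Proof. by move=> uv; rewrite (eP u) (eP v); apply: eq_bigr => l _; rewrite uv. Qed.

Lemma covec_decomp (c : altform 1 V) : c = \sum_l c (fun=> e l) *: ec l.
Proof.
apply: altform_ext => X; rewrite altform_sum.
have -> : X = fun=> X ord0 by apply/funext => i; rewrite (ord1 i).
by rewrite {1}(eP (X ord0)) covec_sum; apply: eq_bigr => l _; rewrite covecZ mulrC.
Qed.

(** Reflexivity of V; it makes the vector described by [vector_of] exist for every functional on
    covectors. *)
Lemma covec_repr (L : altform 1 V -> R) : scalar L ->
  exists v : V, forall c : altform 1 V, c (fun=> v) = L c.
Proof.
move=> Llin; pose LL : {scalar altform 1 V} :=
  HB.pack L (GRing.isLinear.Build R (altform 1 V) R _ L Llin).
exists (\sum_l LL (ec l) *: e l) => c.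
rewrite -[RHS]/(LL c) {2}(covec_decomp c) linear_sum covec_sum; apply: eq_bigr => l _.
by rewrite covecZ linearZ /= mulrC.
Qed.

Lemma vector_ofE (xi : mvector 1 V) (c : altform 1 V) : c (fun=> vector_of xi) = xi c.
Proof.
have [v vP] : exists v, forall c : altform 1 V, c (fun=> v) = xi c.
  by apply: covec_repr => a u w; rewrite linearP.
have := @the_spec V 0 [set v | forall phi : altform 1 V, xi phi = phi (fun=> v)].
by rewrite /= => ->//; exists v => phi; rewrite vP.
Qed.

Definition sharpv m (P : mvector m.+1 V) (a : altform m V) : V :=
  vector_of (Defs.contract (addn1 m) a P).

Lemma sharpvE m (P : mvector m.+1 V) a (c : altform 1 V) :
  c (fun=> sharpv P a) = P (wedge (addn1 m) a c).
Proof. by rewrite /sharpv vector_ofE. Qed.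

Lemma sharpv_linear m (P : mvector m.+1 V) : linear (sharpv P).
Proof.
move=> a f g; apply: covec_inj => c; rewrite covec_lin !sharpvE.
rewrite -[_ * P _]linearZ -linearD /=; congr (P _); apply: altform_ext => X.
rewrite altformD altformZ !wedge1E mulr_sumr -big_split; apply: eq_bigr => i _ /=.
by rewrite altformD altformZ mulrDl mulrDr; congr (_ + _); rewrite -mulrA mulrCA.
Qed.

Lemma altform_coord k (f : altform k V) X :
  f X = \sum_(g : {ffun 'I_k -> 'I_r}) (\prod_i ec (g i) (fun=> X i)) * f (e \o g).
Proof.
rewrite -(altform_expand f (fun i l => ec l (fun=> X i)) (fun _ l => e l)).
by congr (f _); apply/funext => i; exact: eP.
Qed.

(** Since the sum runs over all index functions, each product occurs with its k! reorderings, whence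
    the factor. The vectors e_l are only assumed to reproduce V, so increasing multi-indices would
    not do. *)
Lemma altform_detforms k (f : altform k V) :
  f = (k`!)%:R^-1 *: \sum_(g : {ffun 'I_k -> 'I_r}) f (e \o g) *: detform (ec \o g).
Proof.
have k0 : (k`!)%:R != 0 :> R by rewrite pnatr_eq0 -lt0n fact_gt0.
apply: altform_ext => X; rewrite altformZ; apply: (canRL (mulKf k0)).
rewrite altform_sum; under eq_bigr do rewrite altformZ detformE /determinant mulr_sumr.
rewrite exchange_big /= mulr_natl -card_Sn -sumr_const; apply: eq_bigr => s _.
rewrite altform_coord (reindex_onto (fun g : {ffun 'I_k -> 'I_r} => [ffun i => g (s i)])
  (fun g => [ffun i => g ((s^-1)%g i)])) /=; last first.
  by move=> g _; apply/ffunP => i; rewrite !ffunE permK.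
apply: eq_big => [g|g _].
  by apply/eqP/ffunP => i; rewrite !ffunE permKV.
rewrite (_ : e \o _ = (e \o g) \o s); last by apply/funext => i; rewrite /= ffunE.
rewrite altform_perm mulrCA [X in _ * X = _]mulrC [RHS]mulrCA; congr (_ * (_ * _)).
by apply: eq_bigr => i _; rewrite mxE /= ffunE.
Qed.

(** * The exchange relation and its consequences *)

Section Nambu.
Variables (m : nat) (P : mvector m.+1 V).

Lemma nambu_covec_alternating :
  alternating_form (fun y : 'I_m.+1 -> altform 1 V => P (detform y)).
Proof.
split=> [y i a u v|y i j ij yij]; first by rewrite detform_lin linearP.
by rewrite (detform_alt ij yij) linear0.
Qed.

(** P as an alternating form on covectors, so that the slot calculus applies to it; at differentials
    of functions it gives their Nambu bracket. *)
Definition cobracket : altform m.+1 (altform 1 V) := mk_altform nambu_covec_alternating.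

Lemma cobracketE y : cobracket y = P (detform y).
Proof. by []. Qed.

Lemma cobracket_rcv a c : cobracket (rcv a c) = (-1) ^+ m * cobracket (vcons c a).
Proof.
rewrite -{1}[rcv a c](upd_id _ ord_max) altform_upd_vcons rcv_max; congr (_ * cobracket (vcons _ _)).
by apply/funext => j; rewrite /= rcv_lift.
Qed.

Lemma sharp_detform a (c : altform 1 V) :
  c (fun=> sharpv P (detform a)) = (-1) ^+ m * cobracket (vcons c a).
Proof. by rewrite sharpvE wedge_detform -cobracket_rcv. Qed.

(* The algebraic part of the Nambu identity, obtained by replacing alpha with
   f alpha in it and collecting the terms in df = phi. *)
Hypothesis nambu_symbol : forall (phi c : altform 1 V) (f g : altform m V),
  P (nder phi (sharpv P f) (wedge (addn1 m) g c)) =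
  phi (fun=> sharpv P g) * P (wedge (addn1 m) f c) -
  P (wedge (addn1 m) (nder phi (sharpv P g) f) c).

(** The symbol identity for f = a_1 /\ ... /\ a_m and g = b_1 /\ ... /\ b_m, with [nder] acting
    factor by factor. The term in which c is replaced cancels against phi (sharp g) P (f /\ c), and
    the signs (-1)^m occur in pairs. For m = 1 the two sums cancel by skewness alone. *)
Lemma cobracket_exchange (a b : 'I_m -> altform 1 V) (phi c : altform 1 V) :
  \sum_l cobracket (vcons (b l) a) * cobracket (vcons c (upd b l phi)) +
  \sum_l cobracket (vcons (a l) b) * cobracket (vcons c (upd a l phi)) = 0.
Proof.
have S2 : (-1) ^+ m * (-1) ^+ m = 1 :> R by rewrite -signr_odd -signr_addb addbb.
have := nambu_symbol phi c (detform a) (detform b).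
rewrite wedge_detform !nder_detform linear_sum (bigD1_ord ord_max)//= rcv_max.
rewrite linearZ /= -cobracketE sharp_detform.
have -> : upd (rcv b c) ord_max phi = rcv b phi.
  apply/funext => i; rewrite /upd; case: (unliftP ord_max i) => [j ->|->].
    by rewrite eq_sym (negPf (neq_lift _ _)) !rcv_lift.
  by rewrite eqxx rcv_max.
rewrite cobracket_rcv sharp_detform wedge_detform -cobracketE cobracket_rcv.
have -> : wedge (addn1 m) (\sum_(l < m) a l (fun=> sharpv P (detform b)) *:
    detform (upd a l phi)) c =
    \sum_(l < m) a l (fun=> sharpv P (detform b)) *: detform (rcv (upd a l phi) c).
  apply: altform_ext => X; rewrite wedge1E altform_sum.
  under [RHS]eq_bigr do rewrite altformZ -wedge_detform wedge1E mulr_sumr.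
  rewrite exchange_big /=; apply: eq_bigr => i _; rewrite altform_sum mulr_suml mulr_sumr.
  by apply: eq_bigr => l _; rewrite altformZ -mulrA mulrCA.
set s := (-1) ^+ m in S2 *; rewrite linear_sum /=.
have updr l : upd (rcv b c) (lift ord_max l) phi = rcv (upd b l phi) c.
  apply/funext => i; rewrite /upd /rcv; case: unliftP => [j ->|->].
    by rewrite (inj_eq lift_inj).
  by rewrite (negPf (neq_lift _ _)).
under eq_bigr => l _.
  rewrite linearZ /= updr -cobracketE cobracket_rcv rcv_lift sharp_detform -/s mulrACA S2 mul1r.
  over.
under [X in _ = _ - X -> _]eq_bigr => l _.
  rewrite linearZ /= -cobracketE cobracket_rcv sharp_detform -/s mulrACA S2 mul1r.
  over.
set A := \sum_l _; set B := \sum_l _; set p := cobracket (vcons c a).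
by set q := cobracket (vcons phi b) => E; lra.
Qed.

Hypothesis m_ge2 : (1 < m)%N.

Section Ann.
Variables (a : 'I_m -> altform 1 V) (eta : altform 1 V).
Hypothesis a_eta : cobracket (vcons eta a) = 1.

Lemma cobracket_vcons_rep (b : 'I_m -> altform 1 V) i c :
  b i = c -> cobracket (vcons c b) = 0.
Proof.
move=> bc; apply: (@altform_alt _ _ _ _ _ ord0 (lift ord0 i)) => //.
by rewrite vcons0 vconsS.
Qed.

Section U.
Variable u : altform 1 V.
Hypothesis ua : cobracket (vcons u a) = 0.
Hypothesis uae : forall l, cobracket (vcons u (upd a l eta)) = 0.

(** The exchange relation for a and for b with b_i replaced by eta, with phi = b_i and c = u: by
    [a_eta] the term l = i of the first sum is the claim, and all others vanish by assumption. The
    section hypotheses [ua] and [uae] say that u vanishes on the m + 1 vectors determined by eta and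
    a. *)
Lemma ann_step (b : 'I_m -> altform 1 V) i :
  (forall l, l != i -> cobracket (vcons (b l) a) = 0) ->
  (forall l, cobracket (vcons u (upd a l (b i))) = 0) ->
  cobracket (vcons u b) = 0.
Proof.
move=> bX bu; have := cobracket_exchange a (upd b i eta) (b i) u.
rewrite [X in _ + X]big1 => [|l _]; last by rewrite bu mulr0.
rewrite (bigD1 i)//= upd_same a_eta mul1r upd_upd upd_id big1 ?addr0// => l li.
by rewrite upd_neq// bX// mul0r.
Qed.

(** After a multiple of eta is subtracted from phi, [ann_step] applies at a slot i other than l,
    which still carries a_i. Such a slot exists because m >= 2. *)
Lemma ann_upd l phi : cobracket (vcons u (upd a l phi)) = 0.
Proof.
pose t := cobracket (vcons phi a); pose phi' := phi - t *: eta.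
have E (b : 'I_m -> altform 1 V) x : cobracket (vcons u (upd b l x)) =
    cobracket (upd (vcons u b) (lift ord0 l) x) by rewrite vcons_updS.
suff h : cobracket (vcons u (upd a l phi')) = 0.
  rewrite (_ : phi = t *: eta + phi'); last by rewrite addrC subrK.
  by rewrite E altform_lin -!E uae h mulr0 addr0.
have phiX : cobracket (vcons phi' a) = 0.
  by rewrite /phi' addrC -scaleNr altform_vcons_lin a_eta mulr1 addNr.
have [i il] : exists i : 'I_m, i != l.
  have [->|?] := eqVneq l (Ordinal (ltnW m_ge2)); first by exists (Ordinal m_ge2).
  by exists (Ordinal (ltnW m_ge2)); rewrite eq_sym.
apply: (@ann_step _ i) => [l' l'i|l'].
  have [->|l'l] := eqVneq l' l; first by rewrite upd_same.
  by rewrite upd_neq// (cobracket_vcons_rep (i := l')).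
rewrite upd_neq//; have [->|l'i] := eqVneq l' i; first by rewrite upd_id.
apply: (@altform_alt _ _ _ _ _ (lift ord0 i) (lift ord0 l')).
  by rewrite (inj_eq lift_inj) eq_sym.
by rewrite !vconsS upd_same upd_neq// eq_sym.
Qed.

(** Each b_i is split into a multiple of eta and a covector whose [cobracket] with a is 0. In the
    expansion, a term with eta in two slots vanishes by alternation; otherwise [ann_step] applies at
    the slot carrying eta, or at any slot if there is none. *)
Lemma ann_all b : cobracket (vcons u b) = 0.
Proof.
pose X (c : altform 1 V) := cobracket (vcons c a).
pose c (i : 'I_m) (l : 'I_2) : R := if l == ord0 then X (b i) else 1.
pose ee i (l : 'I_2) := if l == ord0 then eta else b i - X (b i) *: eta.
have := altform_expand (Defs.interior u cobracket) c ee.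
rewrite (_ : (fun i => _) = b); last first.
  apply/funext => i; rewrite big_ord_recl big_ord1 /c /ee /=.
  by rewrite scale1r addrC subrK.
rewrite -[LHS]/(cobracket (vcons u b)) => ->; apply: big1 => g _.
rewrite -[X in _ * X]/(cobracket (vcons u (fun i => ee i (g i)))).
set y := fun i => ee i (g i).
have Xee i : g i != ord0 -> X (y i) = 0.
  rewrite /X /y /ee => /negPf ->.
  by rewrite addrC -scaleNr altform_vcons_lin a_eta mulr1 addNr.
have ex (i : 'I_m) : (forall l, l != i -> g l != ord0) ->
    (\prod_i c i (g i)) * cobracket (vcons u y) = 0.
  move=> gi; rewrite (@ann_step _ i) ?mulr0// => [l li|l]; last exact: ann_upd.
  exact/Xee/gi.
have [i /eqP gi|g0] := pickP (fun i => g i == ord0); last first.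
  by apply: (ex (Ordinal (ltnW m_ge2))) => l _; rewrite g0.
have [j /andP[ji /eqP gj]|gj] := pickP (fun j => (j != i) && (g j == ord0)); last first.
  by apply: (ex i) => l li; have := gj l; rewrite li /= => ->.
rewrite (@altform_alt _ _ _ _ _ (lift ord0 i) (lift ord0 j)) ?mulr0//.
  by rewrite (inj_eq lift_inj) eq_sym.
by rewrite !vconsS /y /ee gi gj.
Qed.
End U.

(** By [ann_all], P sees covectors only through their values at the vectors x_j dual to y = (eta,
    a). Hence P and x_0 /\ ... /\ x_m are both determined by their value at y, which is 1 for
    both. *)
Lemma nambu_decomposable_at : exists x : 'I_m.+1 -> V, forall w, P w = w x.
Proof.
pose y := vcons eta a.
have xex (j : 'I_m.+1) : exists v : V, forall c : altform 1 V,
    c (fun=> v) = cobracket (upd y j c).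
  by apply: covec_repr => t u v; rewrite altform_lin.
have [x xP] := choice xex.
have yx j k : y k (fun=> x j) = (j == k)%:R.
  rewrite xP; have [->|jk] := eqVneq j k; first by rewrite upd_id a_eta.
  by apply: (altform_alt _ jk); rewrite upd_same upd_neq// eq_sym.
have ann (u : altform 1 V) : (forall j, u (fun=> x j) = 0) -> forall z i, cobracket (upd z i u) = 0.
  move=> ux z i; rewrite altform_upd_vcons ann_all ?mulr0//.
    by rewrite -(vcons_upd0 eta) -xP.
  by move=> l; rewrite altform_vcons_swap -vcons_updS -xP ux oppr0.
(* Evaluation at x_j is a covector on the space of covectors, so [detform xx] below is x_0 /\ ... /\
   x_m as a form on covectors. *)
have xxex (j : 'I_m.+1) : exists E : altform 1 (altform 1 V),
    forall c, E (fun=> c) = c (fun=> x j).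
  have h : alternating_form (fun C : 'I_1 -> altform 1 V => C ord0 (fun=> x j)).
    split=> [C i t u v|C i i']; last by rewrite !ord1 eqxx.
    by rewrite (ord1 i) !upd_same.
  by exists (mk_altform h).
have [xx xxP] := choice xxex.
pose h : altform m.+1 (altform 1 V) := cobracket - detform xx.
have hann (u : altform 1 V) : (forall j, u (fun=> x j) = 0) -> forall z i, h (upd z i u) = 0.
  move=> ux z i; rewrite /h altformD altformN ann// sub0r detformE.
  rewrite (expand_det_row _ i) big1 ?oppr0// => l _.
  by rewrite mxE upd_same xxP ux mul0r.
have hy : h y = 0.
  rewrite /h altformD altformN a_eta detformE (_ : (\matrix_(_, _) _) = 1%:M).
    by rewrite det1 subrr.
  by apply/matrixP => j i; rewrite !mxE xxP yx eq_sym.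
(* Q projects covectors onto the span of the y_j along those that vanish on all x_j, which h does
   not see. *)
pose Q (c : altform 1 V) := \sum_j c (fun=> x j) *: y j.
have hQ1 z i : h (upd z i (Q (z i))) = h z.
  have E : h z = h (upd z i (z i)) by rewrite upd_id.
  apply/eqP; rewrite -subr_eq0 E; apply/eqP; rewrite -altform_updN -altform_updD hann// => j.
  rewrite altformD altformN altform_sum (bigD1 j)//= altformZ yx eqxx mulr1.
  by rewrite big1 ?addr0 ?subrr// => k kj; rewrite altformZ yx eq_sym (negPf kj) mulr0.
have hQ z : h z = h (Q \o z).
  pose zn n := fun i : 'I_m.+1 => if (i < n)%N then Q (z i) else z i.
  have zS n : (n <= m.+1)%N -> h (zn n) = h z.
    elim: n => [|n IH] nm; first by congr (h _); apply/funext => i; rewrite /zn ltn0.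
    rewrite -IH ?(ltnW nm)// -[RHS](hQ1 _ (Ordinal nm)); congr (h _); apply/funext => i.
    rewrite /zn /upd ltnS -val_eqE /= ltnn leq_eqVlt.
    by case: eqP => //= inn; congr (Q (z _)); apply: val_inj.
  by rewrite -(zS m.+1)//; congr (h _); apply/funext => i; rewrite /zn ltn_ord.
have h0 z : h z = 0.
  rewrite hQ (altform_expand h (fun i j => z i (fun=> x j)) (fun _ j => y j)).
  apply: big1 => g _; have [/injectiveP gI|/injectivePn[i [j ij gij]]] := boolP (injectiveb g).
    rewrite (_ : (fun i => y (g i)) = y \o perm gI); last first.
      by apply/funext => i; rewrite /= permE.
    by rewrite altform_perm hy !mulr0.
  by rewrite (altform_alt h ij) ?mulr0// gij.
have Pdet z : P (detform z) = detform z x.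
  have /eqP := h0 z; rewrite /h altformD altformN subr_eq0 cobracketE => /eqP ->.
  rewrite !detformE -det_tr; congr (\det _); apply/matrixP => i j.
  by rewrite !mxE xxP.
exists x => w; rewrite {1}(altform_detforms w) linearZ linear_sum /=.
rewrite {2}(altform_detforms w) altformZ altform_sum; congr (_ * _).
by apply: eq_bigr => g _; rewrite linearZ /= Pdet.
Qed.
End Ann.

Lemma nambu_decomposable (w0 : altform m.+1 V) : P w0 != 0 ->
  exists x : 'I_m.+1 -> V, forall w, P w = w x.
Proof.
move=> Pw0.
have [g gP] : exists g : 'I_m.+1 -> altform 1 V, cobracket g != 0.
  apply: contrapT => /forallNP Pg; case/negP: Pw0; apply/eqP.
  rewrite (altform_detforms w0) linearZ linear_sum /= big1 ?mulr0// => g _.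
  rewrite linearZ /= -cobracketE; have /negP := Pg (ec \o g).
  by rewrite negbK => /eqP ->; rewrite mulr0.
pose t := cobracket g.
apply: (@nambu_decomposable_at (g \o lift ord0) (t^-1 *: g ord0)).
by rewrite -(vcons_upd0 0) altform_updZ vcons_upd0 vcons_eta mulVf.
Qed.

End Nambu.

(** For v = \sum_i t_i x_i, the coefficient t_i is Phi with v put in slot i of x, as Phi (x) = 1 and
    repeated vectors give 0. The sign (-1)^m arises because [interior] fills the first slot whereas
    [contract] leaves the last one open. *)
Lemma sharp_projection m (P : mvector m.+1 V) (x : 'I_m.+1 -> V)
  (Phi : altform m.+1 V) (f : altform m V) :
  (forall w, P w = w x) -> P Phi = 1 ->
  sharpv P (Defs.interior (sharpv P f) Phi) = (-1) ^+ m *: sharpv P f.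
Proof.
move=> Px Phi1; apply: covec_inj => c; rewrite covecZ.
pose t (i : 'I_m.+1) : R := (-1) ^+ (m + i) * f (x \o lift i).
have vE : sharpv P f = \sum_i t i *: x i.
  apply: covec_inj => b; rewrite sharpvE Px wedge1E covec_sum.
  by apply: eq_bigr => i _; rewrite covecZ mulrA.
set v := sharpv P f in vE *; rewrite sharpvE Px wedge1E [in RHS]vE covec_sum mulr_sumr.
apply: eq_bigr => i _; rewrite covecZ.
have -> : Defs.interior v Phi (x \o lift i) = (-1) ^+ i * t i.
  have : Phi (upd x i v) = t i.
    rewrite vE altform_upd_sum (bigD1 i)//= altform_updZ upd_id -Px Phi1 mulr1.
    rewrite big1 ?addr0// => j ji; rewrite altform_updZ (altform_alt _ ji) ?mulr0//.
    by rewrite upd_same upd_neq.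
  rewrite altform_upd_vcons => <-.
  by rewrite mulrA -[(-1) ^+ i]signr_odd -signr_addb addbb mul1r.
rewrite exprD -!mulrA; congr (_ * _); rewrite !mulrA.
by rewrite -[(-1) ^+ i]signr_odd -signr_addb addbb mul1r.
Qed.

End FiniteDimensional.

(** The arguments are replaced one slot at a time; P carries a property such as smoothness through
    the partly replaced families. *)
Lemma slotwise (k : nat) (T U : Type) (P : T -> Prop) (Q : T -> T)
    (h : ('I_k -> T) -> U) :
  (forall z, P z -> P (Q z)) ->
  (forall z i, (forall j, P (z j)) ->
     h (fun j => if j == i then Q (z i) else z j) = h z) ->
  forall z, (forall j, P (z j)) -> h (Q \o z) = h z.
Proof.
move=> PQ hQ z Pz; pose zn n := fun i : 'I_k => if (i < n)%N then Q (z i) else z i.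
have zS n : (n <= k)%N -> h (zn n) = h z.
  elim: n => [|n IH] nk; first by congr (h _); apply/funext => i; rewrite /zn ltn0.
  rewrite -IH ?(ltnW nk)// -[RHS](hQ _ (Ordinal nk)); last first.
    by move=> j; rewrite /zn; case: ifP => _ //; exact: PQ.
  congr (h _); apply/funext => i; rewrite /zn ltnS -val_eqE /= ltnn leq_eqVlt.
  by case: eqP => //= ink; congr (Q (z _)); apply: val_inj.
by rewrite -(zS k)//; congr (h _); apply/funext => i; rewrite /zn ltn_ord.
Qed.

Lemma linfun_precomp_alternating (R : realType) (k : nat) (V W : lmodType R)
    (T : V -> W) (f : altform k W) : linear T ->
  alternating_form (fun X : 'I_k -> V => f (T \o X)).
Proof.
move=> Tl; have E X i v : T \o upd X i v = upd (T \o X) i (T v).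
  by apply/funext => j; rewrite /upd /=; case: ifP.
split=> [X i a u v|X i j ij Xij]; first by rewrite !E Tl altform_lin.
by apply: (altform_alt f ij); rewrite /= Xij.
Qed.

Definition precomp (R : realType) (k : nat) (V W : lmodType R)
  (T : V -> W) (Tl : linear T) (f : altform k W) : altform k V :=
  mk_altform (linfun_precomp_alternating f Tl).

(** * Sections and frames *)

Section Sections.
Variables (R : realType) (d : nat) (M : topologicalType) (S : manifold R d M).
Variable E : algebroid_data R M.
Local Notation sections := (fib_prod (fib E)).
Local Notation sect := (@sec R M E).

Lemma at_upd k (X : 'I_k -> sections) i (Y : sections) x :
  (fun l => upd X i Y l x) = upd (fun l => X l x) i (Y x).
Proof. by apply/funext => l; rewrite /upd; case: ifP. Qed.

Lemma at_vcons k (X : 'I_k -> sections) (Y : sections) x :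
  (fun l => vcons Y X l x) = vcons (Y x) (fun l => X l x).
Proof. by apply/funext => l; rewrite /vcons; case: unliftP. Qed.

Lemma sec_upd k (X : 'I_k -> sections) i (Y : sections) :
  (forall l, sect (X l)) -> sect Y -> forall l, sect (upd X i Y l).
Proof. by move=> XS YS l; rewrite /upd; case: ifP. Qed.

Lemma sec_vcons k (X : 'I_k -> sections) (Y : sections) :
  (forall l, sect (X l)) -> sect Y -> forall l, sect (vcons Y X l).
Proof. by move=> XS YS l; rewrite /vcons; case: unliftP. Qed.

Lemma sform_smooth k (w : sform S E k) (X : 'I_k -> sections) :
  (forall i, sect (X i)) -> smooth S setT (fun x => w x (fun i => X i x)).
Proof. exact: (sformP w). Qed.

Lemma sform_ext k (v w : sform S E k) : (forall x, v x = w x) -> v = w.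
Proof.
move=> vw; apply: val_inj; apply: functional_extensionality_dep => x; exact: vw.
Qed.

Lemma sformD k (v w : sform S E k) x : (v + w) x = v x + w x. Proof. by []. Qed.
Lemma sformN k (v : sform S E k) x : (- v) x = - v x. Proof. by []. Qed.
Lemma fscaleE k (f : smooth_fun S) (v : sform S E k) x : fscale f v x = f x *: v x.
Proof. by []. Qed.

(** Under this condition a form is determined by its values on sections, so that [form_of] describes
    at most one form. *)
Definition spanning := forall x (v : fib E x), exists2 X, sect X & X x = v.

Hypothesis span : spanning.

Lemma altform_at_ext k x (f g : altform k (fib E x)) :
  (forall X : 'I_k -> sections, (forall i, sect (X i)) ->
     f (fun i => X i x) = g (fun i => X i x)) -> f = g.
Proof.
move=> fg; apply: altform_ext => v.
have vP i : exists X, sect X /\ X x = v i by have [X ? ?] := span (v i); exists X.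
have [X XP] := choice vP.
by rewrite (_ : v = fun i => X i x) ?fg// => [i|]; [have [] := XP i|
  apply/funext => i; have [] := XP i].
Qed.

Lemma form_ofE k F (w : sform S E k) :
  (forall X : 'I_k -> sections, (forall i, sect (X i)) ->
     forall x, w x (fun i => X i x) = F X x) -> form_of S F = w.
Proof.
move=> wF; have FP := @the_spec (sform S E k) 0 [set w : sform S E k |
  forall X : 'I_k -> forall x, fib E x,
    (forall i, sect (X i)) -> forall x, w x (fun i => X i x) = F X x] (ex_intro _ w wF).
by apply: sform_ext => x; apply: altform_at_ext => X XS; rewrite FP// wF.
Qed.
End Sections.

(** * Local frames and tensoriality *)

Section Frames.
Variables (R : realType) (d : nat) (M : topologicalType) (S : manifold R d M).
Variables (r : nat) (A : lie_algebroid S r).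
Local Notation sections := (fib_prod (fib A)).
Local Notation sect := (@sec R M A).

Lemma frame_expand (i : frame_index A) x (v : A x) : frame_dom i x ->
  v = \sum_l coord (frame i x) l v *: tnth (frame i x) l.
Proof.
move=> ix; have /andP[/eqP sp _] := frame_basis ix.
have := @coord_span _ _ _ (frame i x) v; rewrite sp memvf => /(_ isT) {1}->.
by apply: eq_bigr => l _; rewrite (tnth_nth 0).
Qed.

Lemma sec_lin (f : smooth_fun S) (X Y : sections) : sect X -> sect Y ->
  sect (fun x => f x *: X x + Y x).
Proof.
move=> XS YS i k; have oi := frame_dom_open i.
apply: (smooth_ext oi (f := fun x => f x * coord (frame i x) k (X x) +
    coord (frame i x) k (Y x))) => [x _|]; first by rewrite linearP.
apply: smooth_add => //.
by apply: smooth_mul; [|apply: smooth_sub (smooth_funP f)|].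
Qed.

Lemma sec0 : sect (fun x => 0).
Proof.
move=> i k; apply: (smooth_ext (frame_dom_open i) (f := fun=> 0)) => [x _|].
  by rewrite linear0.
exact: smooth_cst (frame_dom_open i).
Qed.

Lemma sec_scale (f : smooth_fun S) (X : sections) : sect X -> sect (fun x => f x *: X x).
Proof.
move=> XS; have := sec_lin f XS sec0.
by congr (sect _); apply: functional_extensionality_dep => x; rewrite addr0.
Qed.

Lemma sec_add (X Y : sections) : sect X -> sect Y -> sect (fun x => X x + Y x).
Proof.
move=> XS YS; have := sec_lin (smooth_fun_cst S 1) XS YS.
by congr (sect _); apply: functional_extensionality_dep => x; rewrite scale1r.
Qed.

Lemma sec_sum (I : Type) (s : seq I) (X : I -> sections) : (forall i, sect (X i)) ->
  sect (fun x => \sum_(i <- s) X i x).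
Proof.
move=> XS; elim: s => [|i s IH].
  have := sec0; congr (sect _); apply: functional_extensionality_dep => x.
  by rewrite big_nil.
have := sec_add (XS i) IH; congr (sect _); apply: functional_extensionality_dep => x.
by rewrite big_cons.
Qed.

Definition coord_form (i : frame_index A) x (l : 'I_r) : altform 1 (fib A x).
Proof.
apply: (@mk_altform R 1 (fib A x) (fun X => coord (frame i x) l (X ord0))).
split=> [X j a u v|X j j']; last by rewrite !ord1 eqxx.
by rewrite (ord1 j) !upd_same linearP.
Defined.

(* e and c are a frame and its dual multiplied by the bump function b, so they
   are globally defined; the two factors b explain b y * b y. *)
Lemma local_frame (i : frame_index A) x : frame_dom i x ->
  exists (b : smooth_fun S) (e : 'I_r -> sections) (c : 'I_r -> sform S A 1),
  [/\ \forall y \near x, b y = 1,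
      forall l, sect (e l),
      forall y (v : A y) l, c l y (fun=> v) = b y * coord (frame i y) l v &
      forall y (v : A y), (b y * b y) *: v = \sum_l c l y (fun=> v) *: e l y].
Proof.
move=> ix; have oi := frame_dom_open i.
have [b [K [cK KU b_ge0 bK b1]]] := bump_exists S oi ix.
have clK : closed K := compact_closed (manifold_hausdorff S) cK.
have bS := smooth_funP b.
have ext g : smooth S (frame_dom i) g -> smooth S setT (fun y => b y * g y).
  by apply: smooth_supported clK KU oi _ bK; apply: smooth_sub bS.
have cS l : smooth_form S (fun y => b y *: coord_form i y l : altform 1 (fib A y)).
  move=> X XS; have := ext _ (XS ord0 i l); congr (smooth _ _ _).
exists b, (fun l y => b y *: tnth (frame i y) l), (fun l => mk_sform (cS l)); split=> //.
- move=> l j k; have oj := frame_dom_open j; apply: smooth_local => y jy.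
  have [Ky|Ky] := pselect (K y); last first.
    exists (frame_dom j `&` ~` K) => //.
    apply: (@smooth_ext _ _ _ _ _ (fun=> 0)); first exact: openI (closed_openC clK).
      by move=> z [_ Kz]; rewrite bK// scale0r linear0.
    by apply: smooth_cst; exact: openI (closed_openC clK).
  exists (frame_dom j `&` frame_dom i); first by split=> //; exact: KU.
  apply: (smooth_ext (openI oj oi)
    (f := fun z => b z * coord (frame j z) k (tnth (frame i z) l))).
    by move=> z _; rewrite linearZ.
  apply: smooth_mul; [exact: openI|by apply: smooth_sub bS|exact: frame_transition].
move=> y v; have [iy|iy] := pselect (frame_dom i y).
  rewrite {1}(frame_expand v iy) scaler_sumr; apply: eq_bigr => l _.
  rewrite -[X in _ = X *: _]/(b y * coord (frame i y) l v) !scalerA.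
  by congr (_ *: _); ring.
have b0 : b y = 0 by apply: bK => /KU.
rewrite b0 mul0r scale0r big1// => l _ /=.
by rewrite -[X in X *: _]/(b y * coord (frame i y) l v) b0 mul0r scale0r.
Qed.

Lemma local_frame_at x : exists (b : smooth_fun S) (e : 'I_r -> sections)
    (c : 'I_r -> sform S A 1),
  [/\ \forall y \near x, b y = 1,
      forall l, sect (e l),
      forall y (v : A y), (b y * b y) *: v = \sum_l c l y (fun=> v) *: e l y &
      forall v : A x, v = \sum_l c l x (fun=> v) *: e l x].
Proof.
have [i ix] := frame_cover A x; have [b [e [c [b1 eS _ be]]]] := local_frame ix.
exists b, e, c; split=> // v.
by rewrite -be (nbhs_singleton b1) mulr1 scale1r.
Qed.

Lemma sec_through : spanning A.
Proof.
move=> x v; have [b [e [c [_ eS _ ev]]]] := local_frame_at x.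
exists (fun y => \sum_l c l x (fun=> v) *: e l y); last by rewrite -ev.
apply: (@sec_sum _ _ (fun l y => c l x (fun=> v) *: e l y)) => l.
exact: (sec_scale (smooth_fun_cst S _) (eS l)).
Qed.

(** f is pulled back along the maps [T y] from the fibre at y to the fibre at x given by the
    globally defined frame and coframe; [T x] is the identity. *)
Lemma form_through k x (f : altform k (fib A x)) : exists w : sform S A k, w x = f.
Proof.
have [b [e [c [_ eS _ ev]]]] := local_frame_at x.
pose T y (v : A y) : fib A x := \sum_l c l y (fun=> v) *: e l x.
have Tl y : linear (@T y : fib A y -> fib A x).
  move=> a u v; rewrite /T scaler_sumr -big_split; apply: eq_bigr => l _ /=.
  by rewrite covec_lin scalerDl scalerA.
have wS : smooth_form S (fun y => precomp (Tl y) f).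
  move=> X XS; apply: (smooth_ext openT (f := fun y => \sum_(g : {ffun 'I_k -> 'I_r})
      (\prod_i c (g i) y (fun=> X i y)) * f (fun i => e (g i) x))).
    move=> y _; rewrite -(altform_expand f (fun i l => c l y (fun=> X i y))
      (fun _ l => e l x)).
    by congr (f _).
  apply: smooth_sum; first exact: openT.
  move=> g _; apply: smooth_mul; [exact: openT| |exact: smooth_cst openT].
  apply: smooth_prod => [|i _]; first exact: openT.
  by apply: (@sform_smooth _ _ _ _ _ _ (c (g i)) (fun=> X i)) => _; exact: XS.
exists (mk_sform wS); apply: altform_ext => v.
have -> : mk_sform wS x v = f (@T x \o v) by [].
by congr (f _); apply/funext => i; rewrite /T /= -ev.
Qed.

Record tensorial k (F : ('I_k -> sections) -> M -> R) : Prop := Tensorial {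
  tensorial_lin : forall (X : 'I_k -> sections) i (f : smooth_fun S) (Y Z : sections),
    (forall j, sect (X j)) -> sect Y -> sect Z ->
    forall x, F (upd X i (fun y => f y *: Y y + Z y)) x =
      f x * F (upd X i Y) x + F (upd X i Z) x;
  tensorial_alt : forall (X : 'I_k -> sections) i j, (forall j, sect (X j)) ->
    i != j -> X i = X j -> forall x, F X x = 0;
  tensorial_smooth : forall X : 'I_k -> sections, (forall j, sect (X j)) ->
    smooth S setT (F X) }.

(** For the frame at x with bump b, b^2 Z = \sum_l c_l (Z) e_l on all of M and b (x) = 1, so
    linearity over functions shows that F at x sees Z only through Z (x). Hence Z may be replaced by
    the extension [ext] of Z (x) with constant coefficients, and F at such extensions defines the
    form on vectors. *)
Lemma tensorial_form k (F : ('I_k -> sections) -> M -> R) : tensorial F ->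
  exists w : sform S A k, forall X : 'I_k -> sections, (forall i, sect (X i)) ->
    forall x, w x (fun i => X i x) = F X x.
Proof.
case=> Flin Falt Fsm.
have Fadd (X : 'I_k -> sections) i (Y Z : sections) x : (forall j, sect (X j)) ->
    sect Y -> sect Z ->
    F (upd X i (fun y => Y y + Z y)) x = F (upd X i Y) x + F (upd X i Z) x.
  move=> XS YS ZS; have := Flin X i (smooth_fun_cst S 1) Y Z XS YS ZS x.
  rewrite /= mul1r => <-; congr (F (upd X i _) x).
  by apply: functional_extensionality_dep => y; rewrite scale1r.
have F0 (X : 'I_k -> sections) i x : (forall j, sect (X j)) ->
    F (upd X i (fun y => 0)) x = 0.
  move=> XS; have := Fadd X i (fun y => 0) (fun y => 0) x XS sec0 sec0.
  rewrite (_ : (fun y => _ + _) = fun y => 0); last first.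
    by apply: functional_extensionality_dep => y; rewrite addr0.
  by move/eqP; rewrite -subr_eq0 opprD addNKr oppr_eq0 => /eqP.
have Fsum (X : 'I_k -> sections) i (f : 'I_r -> smooth_fun S) (e : 'I_r -> sections) x :
    (forall j, sect (X j)) -> (forall l, sect (e l)) ->
    F (upd X i (fun y => \sum_l f l y *: e l y)) x =
    \sum_l f l x * F (upd X i (e l)) x.
  move=> XS eS; elim: (index_enum _) => [|l s IH].
    rewrite big_nil -[RHS](F0 X i x)//; congr (F (upd X i _) x).
    by apply: functional_extensionality_dep => y; rewrite big_nil.
  rewrite big_cons -IH -Flin//; last first.
    by apply: (@sec_sum _ _ (fun l y => f l y *: e l y)) => l'; exact: sec_scale.
  congr (F (upd X i _) x).
  by apply: functional_extensionality_dep => y; rewrite big_cons.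
have [b bP] := choice local_frame_at; have [e eP] := choice bP.
have [c {bP eP}cP] := choice eP.
pose ext x (v : fib A x) : sections := fun y => \sum_l c x l x (fun=> v) *: e x l y.
have extS x v : sect (@ext x v).
  apply: (@sec_sum _ _ (fun l y => c x l x (fun=> v) *: e x l y)) => l.
  by have [_ eS _ _] := cP x; exact: (sec_scale (smooth_fun_cst S _)).
have extE x v : ext x v x = v by have [_ _ _ ev] := cP x; rewrite /ext -ev.
have Fext x (X : 'I_k -> sections) : (forall i, sect (X i)) ->
    F (fun i => ext x (X i x)) x = F X x.
  move=> XS; apply: (slotwise (P := sect) (Q := fun Y => ext x (Y x)) (h := F ^~ x)) => //.
  move=> z i zS; have [b1 eS be _] := cP x.
  rewrite -[X in F X x]/(upd (z : 'I_k -> sections) i (ext x (z i x))).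
  have cS l : smooth S setT (fun y => c x l y (fun=> z i y)).
    by apply: (@sform_smooth _ _ _ _ _ _ (c x l) (fun=> z i)) => _; exact: zS.
  have -> : ext x (z i x) = fun y => \sum_l smooth_fun_cst S (c x l x (fun=> z i x)) y *: e x l y.
    by [].
  rewrite Fsum//=.
  rewrite -(Fsum z i (fun l => SmoothFun (cS l)) (e x) x zS eS) /=.
  have -> : (fun y => \sum_l c x l y (fun=> z i y) *: e x l y) =
      fun y => smooth_fun_mul (b x) (b x) y *: z i y + 0.
    by apply: functional_extensionality_dep => y; rewrite -be addr0.
  rewrite Flin//; last exact: sec0.
  by rewrite F0// addr0 upd_id /= (nbhs_singleton b1) !mul1r.
have walt x : alternating_form (fun V : 'I_k -> fib A x => F (fun i => ext x (V i)) x).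
  have E (V : 'I_k -> fib A x) i v :
      (fun j => ext x (upd V i v j)) = upd ((fun j => ext x (V j)) : 'I_k -> sections) i (ext x v).
    by apply/funext => j; rewrite /upd; case: ifP.
  split=> [V i a u v|V i j ij Vij]; last by apply: (Falt _ _ _ _ ij); rewrite ?Vij.
  rewrite !E; have -> : ext x (a *: u + v) =
      fun y => smooth_fun_cst S a y *: ext x u y + ext x v y.
    apply: functional_extensionality_dep => y; rewrite /ext scaler_sumr -big_split.
    by apply: eq_bigr => l _ /=; rewrite covec_lin scalerDl scalerA.
  by rewrite Flin.
have wS : smooth_form S (fun x => mk_altform (walt x)).
  move=> X XS; apply: (smooth_ext openT (f := F X)) => [x _|]; last exact: Fsm.
  exact/esym/Fext.
by exists (mk_sform wS) => X XS x; exact: Fext.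
Qed.

End Frames.

(** Translates the omission of an index by filtering, as in the bracket terms of the Koszul formula,
    into its omission by [lift], as in the slot calculus. *)
Lemma filter_lift_enum n (j : 'I_n.+1) :
  [seq h <- enum 'I_n.+1 | h != j] = [seq lift j h | h <- enum 'I_n].
Proof.
have F0 k : [seq h <- [seq lift ord0 i | i <- enum 'I_k] | h != ord0] =
    [seq lift ord0 i | i <- enum 'I_k].
  by rewrite filter_map (eq_filter (a2 := predT)) ?filter_predT// => i /=;
    rewrite eq_sym neq_lift.
elim: n j => [|n IH] j; first by rewrite (ord1 j) enum_ordSl /= F0.
rewrite enum_ordSl /=; case: (unliftP ord0 j) => [i ->|->]; last by rewrite eqxx F0.
rewrite neq_lift filter_map (eq_filter (a2 := fun h => h != i)) => [|h /=]; last first.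
  by rewrite (inj_eq lift_inj).
rewrite IH enum_ordSl /= -map_comp -[in RHS]map_comp; congr (_ :: _).
  exact: val_inj.
by apply: eq_map => l; apply: val_inj; rewrite /= /bump; lia.
Qed.

Arguments anchor : simpl never.
Arguments br : simpl never.
Arguments sform_at : simpl never.

(** * Exterior derivative *)

Section Calculus.
Variables (R : realType) (d : nat) (M : topologicalType) (S : manifold R d M).
Variables (r : nat) (A : lie_algebroid S r).
Local Notation sections := (fib_prod (fib A)).
Local Notation sect := (@sec R M A).

Let L : algebroid_laws S A := lie_laws A.

Lemma anchor0 x (v : fib A x) : anchor v (fun=> 0) = 0.
Proof.
have h : anchor v (fun=> 0 * 0) = anchor v (fun=> 0) * 0 + 0 * anchor v (fun=> 0) :=
  anchor_derivation L (smooth_fun_cst S 0) (smooth_fun_cst S 0) v.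
by move: h; rewrite !mulr0 mul0r addr0.
Qed.

Lemma anchor_cst x (v : fib A x) (a : R) : anchor v (fun=> a) = 0.
Proof.
have one : anchor v (fun=> 1) = 0.
  have h : anchor v (fun=> 1 * 1) = anchor v (fun=> 1) * 1 + 1 * anchor v (fun=> 1) :=
    anchor_derivation L (smooth_fun_cst S 1) (smooth_fun_cst S 1) v.
  move: h; rewrite !mulr1 mul1r => /eqP.
  by rewrite -subr_eq0 opprD addNKr oppr_eq0 => /eqP.
have h : anchor v (fun=> a * 1 + 0) = a * anchor v (fun=> 1) + anchor v (fun=> 0) :=
  anchor_lin L (smooth_fun_cst S 1) (smooth_fun_cst S 0) v a.
by move: h; rewrite one anchor0 mulr0 mulr1 !addr0.
Qed.

Section AnchorFun.
Variables (f g h : M -> R).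
Hypotheses (fS : smooth S setT f) (gS : smooth S setT g) (hS : smooth S setT h).

Lemma anchor_lin_fun x (v : fib A x) a :
  anchor v (fun y => a * f y + g y) = a * anchor v f + anchor v g.
Proof. exact: (anchor_lin L (SmoothFun fS) (SmoothFun gS)). Qed.

Lemma anchorD x (v : fib A x) : anchor v (fun y => f y + g y) = anchor v f + anchor v g.
Proof.
have := anchor_lin_fun v 1; rewrite mul1r => <-; congr (anchor v _).
by apply/funext => y; rewrite mul1r.
Qed.

Lemma anchorM x (v : fib A x) :
  anchor v (fun y => f y * g y) = anchor v f * g x + f x * anchor v g.
Proof. exact: (anchor_derivation L (SmoothFun fS) (SmoothFun gS)). Qed.

Lemma anchorN x (v : fib A x) : anchor v (fun y => - f y) = - anchor v f.
Proof.
have E : anchor v (fun y => -1 * f y + 0) = -1 * anchor v f + anchor v (fun=> 0) :=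
  anchor_lin L (SmoothFun fS) (smooth_fun_cst S 0) v (-1).
rewrite anchor0 addr0 mulN1r in E; rewrite -E; congr (anchor v _).
by apply/funext => y; rewrite mulN1r addr0.
Qed.

Lemma anchor_lin_vec x (u v : fib A x) a : anchor (a *: u + v) f = a * anchor u f + anchor v f.
Proof. exact: (anchor_linear L (SmoothFun fS)). Qed.

Lemma smooth_anchor (X : sections) : sect X -> smooth S setT (fun x => anchor (X x) f).
Proof. exact: (anchor_smooth L (SmoothFun fS)). Qed.

Lemma anchorM_aux (fgS : smooth S setT (fun y => f y * g y)) x (v : fib A x) :
  anchor v (fun y => f y * g y + h y) =
  anchor v f * g x + f x * anchor v g + anchor v h.
Proof.
have E : anchor v (fun y => 1 * (f y * g y) + h y) =
    1 * anchor v (fun y => f y * g y) + anchor v h :=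
  anchor_lin L (SmoothFun fgS) (SmoothFun hS) v 1.
rewrite mul1r anchorM in E; rewrite -E; congr (anchor v _).
by apply/funext => y; rewrite mul1r.
Qed.

Lemma anchorMD x (v : fib A x) : anchor v (fun y => f y * g y + h y) =
  anchor v f * g x + f x * anchor v g + anchor v h.
Proof. by apply: anchorM_aux; exact: smooth_mul openT fS gS. Qed.
End AnchorFun.

Lemma anchor_sum (I : Type) (s : seq I) (F : I -> M -> R) x (v : fib A x) :
  (forall i, smooth S setT (F i)) ->
  anchor v (fun y => \sum_(i <- s) F i y) = \sum_(i <- s) anchor v (F i).
Proof.
move=> FS; elim: s => [|i s IH].
  rewrite big_nil -[RHS](anchor0 v); congr (anchor v _).
  by apply/funext => y; rewrite big_nil.
rewrite big_cons -IH -anchorD//; last by apply: smooth_sum => //; exact: openT.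
by congr (anchor v _); apply/funext => y; rewrite big_cons.
Qed.

(** The difference of f and g times a bump supported where they agree is 0, and the Leibniz rule at
    x recovers the derivative of the difference. Locality is needed because multivectors decompose
    only locally. *)
Lemma anchor_local (f g : M -> R) x (v : fib A x) :
  smooth S setT f -> smooth S setT g -> (\forall y \near x, f y = g y) ->
  anchor v f = anchor v g.
Proof.
move=> fS gS fg.
have hS : smooth S setT (fun y => -1 * g y + f y) by exact: smooth_lin.
have [b [K [_ KU _ bK b1]]] := bump_exists S (open_interior (fun y => f y = g y)) fg.
have : anchor v (fun y => b y * (-1 * g y + f y)) = 0.
  rewrite -[RHS](anchor0 v); congr (anchor v _); apply/funext => y.
  have [/KU/interior_subset/= ->|/bK ->] := pselect (K y); last by rewrite mul0r.
  by rewrite mulN1r addNr mulr0.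
rewrite (anchorM (smooth_funP b) hS) (nbhs_singleton b1) mul1r.
rewrite (nbhs_singleton fg) mulN1r addNr mulr0 add0r anchor_lin_fun// mulN1r.
by move=> /eqP; rewrite addrC subr_eq0 => /eqP.
Qed.

Lemma br_linr (X Y Z : sections) (f : smooth_fun S) x : sect X -> sect Y -> sect Z ->
  br X (fun y => f y *: Y y + Z y) x =
  f x *: br X Y x + anchor (X x) f *: Y x + br X Z x.
Proof.
move=> XS YS ZS; have fYS := sec_scale f YS.
rewrite (br_skew L XS (sec_lin f YS ZS)).
have -> : (fun y => f y *: Y y + Z y) = fun y => 1 *: (f y *: Y y) + Z y.
  by apply: functional_extensionality_dep => y; rewrite scale1r.
rewrite (br_linear L 1 fYS ZS XS) scale1r opprD -!(br_skew L XS)//.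
by rewrite (br_leibniz L f XS YS).
Qed.

Definition lder_fun k (X : sections) (w : sform S A k) (Y : 'I_k -> sections) x : R :=
  anchor (X x) (fun y => w y (fun l => Y l y)) -
  \sum_(i < k) w x (upd (fun l => Y l x) i (br X (Y i) x)).

(** The derivative of the coefficient f along X arises once from the anchor and once from [br X],
    with opposite signs. For two equal arguments, the bracket terms of these two slots cancel. *)
Lemma lder_tensorial k X (w : sform S A k) : sect X -> tensorial (lder_fun X w).
Proof.
move=> XS; split=> [Y i f Y' Z YS Y'S ZS x|Y i j YS ij Yij x|Y YS].
- have wS (V : sections) : sect V ->
      smooth S setT (fun y => w y (fun l => upd Y i V l y)).
    by move=> VS; apply: sform_smooth; exact: sec_upd.
  rewrite /lder_fun.
  have -> : (fun y => w y (fun l => upd Y i (fun y => f y *: Y' y + Z y) l y)) =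
      fun y => f y * w y (fun l => upd Y i Y' l y) + w y (fun l => upd Y i Z l y).
    by apply/funext => y; rewrite !at_upd altform_lin.
  rewrite anchorMD; [|exact: smooth_funP|exact: wS|exact: wS].
  rewrite (bigD1 i)//= [in X in _ = f x * (_ - X) + _](bigD1 i)//=.
  rewrite [in X in _ = _ + (_ - X)](bigD1 i)//=.
  rewrite (at_upd Y i Y' x) (at_upd Y i Z x) (at_upd Y i (fun y => f y *: Y' y + Z y) x).
  rewrite !upd_same !upd_upd br_linr// !altform_updD !altform_updZ.
  have -> : \sum_(j < k | j != i) w x (upd (upd (fun l => Y l x) i (f x *: Y' x + Z x)) j
        (br X (upd Y i (fun y => f y *: Y' y + Z y) j) x)) =
      f x * (\sum_(j < k | j != i) w x (upd (upd (fun l => Y l x) i (Y' x)) j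
        (br X (upd Y i Y' j) x))) +
      \sum_(j < k | j != i) w x (upd (upd (fun l => Y l x) i (Z x)) j
        (br X (upd Y i Z j) x)).
    rewrite mulr_sumr -big_split; apply: eq_bigr => j ji /=.
    by rewrite !(upd_neq _ _ ji) !(updC _ _ _ (_ : i != j)) 1?eq_sym// altform_lin.
  ring.
- rewrite /lder_fun.
  have -> : (fun y => w y (fun l => Y l y)) = fun=> 0.
    by apply/funext => y; apply: (altform_alt _ ij); rewrite Yij.
  rewrite anchor0 (bigD1 i)//= (bigD1 j) 1?eq_sym//= big1 => [|l /andP[li lj]].
    rewrite addr0 Yij.
    have -> : upd (fun l => Y l x) i (br X (Y j) x) =
        upd (upd (fun l => Y l x) j (Y j x)) i (br X (Y j) x) by rewrite upd_id.
    have -> : upd (fun l => Y l x) j (br X (Y j) x) =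
        upd (upd (fun l => Y l x) j (br X (Y j) x)) i (Y j x).
      by rewrite updC 1?eq_sym// -Yij (upd_id (fun l => Y l x) i).
    by rewrite altform_swap_upd 1?eq_sym// addNr subrr.
  by apply: (altform_alt _ ij); rewrite !upd_neq// 1?eq_sym// Yij.
rewrite /lder_fun; apply: (smooth_ext openT (f := fun x =>
    -1 * (\sum_(i < k) w x (fun l => upd Y i (br X (Y i)) l x)) +
    anchor (X x) (fun y => w y (fun l => Y l y)))).
  move=> x _; rewrite mulN1r addrC; congr (_ - _).
  by apply: eq_bigr => i _; rewrite at_upd.
apply: smooth_lin; last by apply: smooth_anchor => //; exact: sform_smooth.
apply: smooth_sum => [|i _]; first exact: openT.
apply: sform_smooth; apply: sec_upd => //; exact: (br_sec L).
Qed.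

Lemma lie_derE k X (w : sform S A k) (Y : 'I_k -> sections) x : sect X ->
  (forall i, sect (Y i)) -> lie_der X w x (fun i => Y i x) = lder_fun X w Y x.
Proof.
move=> XS YS; have [v vP] := tensorial_form (lder_tensorial w XS).
by rewrite /lie_der (form_ofE (@sec_through _ _ _ _ _ A) vP) vP.
Qed.

Lemma iform_smooth k (X : sections) (w : sform S A k.+1) : sect X ->
  smooth_form S (fun x => Defs.interior (X x) (w x)).
Proof.
move=> XS Y YS; apply: (smooth_ext openT (f := fun x => w x (fun l => vcons (X : sections) Y l x))).
  by move=> x _; rewrite at_vcons.
by apply: sform_smooth; exact: sec_vcons.
Qed.

Definition iform k X (XS : sect X) (w : sform S A k.+1) : sform S A k :=
  mk_sform (iform_smooth w XS).

Lemma iformE k X (XS : sect X) (w : sform S A k.+1) x Y :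
  iform XS w x Y = w x (vcons (X x) Y).
Proof. by []. Qed.

Lemma koszul0 (w : sform S A 0) (X : 'I_1 -> sections) x :
  koszul w X x = lder_fun (X ord0) w (X \o lift ord0) x.
Proof.
rewrite /koszul /lder_fun big_ord_recl !big_ord0 subr0 expr0 mul1r addr0.
rewrite big_ord_recl big_ord0 addr0 big1 ?addr0// => j.
by rewrite (ord1 j).
Qed.

Lemma nth_vcons (V : lmodType R) k b (s : seq V) :
  (fun l : 'I_k.+1 => nth 0 (b :: s) l) = vcons b (fun l : 'I_k => nth 0 s l).
Proof.
by apply/funext => l; case: (unliftP ord0 l) => [j ->|->]; rewrite ?vconsS ?vcons0.
Qed.

(** Cartan's formula for the Koszul expression itself. The terms with index 0 make up the Lie
    derivative along X_0; in the others the minus sign comes from the shift of i in the anchor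
    terms, and from moving X_0 in front of the bracket in the bracket terms. *)
Lemma koszulS k (w : sform S A k.+1) (X : 'I_k.+2 -> sections) x
    (X0S : sect (X ord0)) :
  koszul w X x = lder_fun (X ord0) w (X \o lift ord0) x -
                 koszul (iform X0S w) (X \o lift ord0) x.
Proof.
pose X' := X \o lift ord0.
rewrite /koszul /lder_fun opprD addrACA; congr (_ + _).
  rewrite big_ord_recl /= expr0 mul1r; congr (_ + _); rewrite -sumrN.
  apply: eq_bigr => i _; rewrite /bump leq0n add1n exprS mulN1r mulNr; congr (- (_ * anchor _ _)).
  apply/funext => y; rewrite iformE; congr (w y _); apply/funext => l.
  rewrite /vcons; case: unliftP => [j ->|->] /=.
    congr (X _ y); apply: val_inj; rewrite /= /bump /=.
    by case: leqP => ?; rewrite ?(add1n, ltnS, addnS, add0n) //; lia.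
  by congr (X _ y); apply: val_inj.
rewrite big_ord_recl /=; congr (_ + _).
  rewrite big_mkcond big_ord_recl /= add0r -sumrN; apply: eq_bigr => j _.
  rewrite /bump /= add0n add1n exprS mulN1r mulNr nth_vcons.
  rewrite altform_upd_vcons; congr (- (_ * w x (vcons _ _))).
  apply/funext => l.
  have -> : [seq X h x | h <- enum 'I_k.+2 & h \notin [:: ord0; lift ord0 j]] =
      [seq X' (lift j h) x | h <- enum 'I_k].
    rewrite enum_ordSl /= filter_map -map_comp.
    rewrite [RHS](map_comp (fun h => X' h x) (lift j)) -filter_lift_enum.
    congr map; apply: eq_filter => h /=.
    by rewrite !inE negb_or eq_sym neq_lift (inj_eq lift_inj).
  by rewrite (nth_map l) ?size_enum_ord// nth_ord_enum.
rewrite -sumrN; apply: eq_bigr => i _.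
rewrite big_mkcond big_ord_recl /= add0r -sumrN [RHS]big_mkcond /=; apply: eq_bigr => j _.
rewrite /bump /= !add1n ltnS; case: ifP => // ij.
rewrite addSn addnS !exprS !mulN1r opprK; rewrite -mulrN; congr (_ * _).
rewrite nth_vcons iformE.
have -> : [seq X h x | h <- enum 'I_k.+2 & h \notin [:: lift ord0 i; lift ord0 j]] =
    X ord0 x :: [seq X' h x | h <- enum 'I_k.+1 & h \notin [:: i; j]].
  rewrite enum_ordSl /=; congr (_ :: _).
  by rewrite filter_map -map_comp.
(* In degree 1 there is no pair i < j. In higher degree the bracket and X_0 are the first two
   arguments, and exchanging them gives the sign. *)
rewrite {}/X' /=; case: k w X X0S i j ij => [|k] w X X0S i j ij.
  by move: ij; rewrite (ord1 i) (ord1 j).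
rewrite !nth_vcons; set T := fun l : 'I_k => _.
set b := br _ _ x.
have := altform_vcons_swap (w x) b (X ord0 x) (vcons 0 T) ord0.
by rewrite !vcons_upd0.
Qed.

End Calculus.

(** * Existence and Leibniz rule of the exterior derivative *)

Section ExteriorDerivative.
Variables (R : realType) (d : nat) (M : topologicalType) (S : manifold R d M).
Variables (r : nat) (A : lie_algebroid S r).
Local Notation sections := (fib_prod (fib A)).
Local Notation sect := (@sec R M A).

Let L : algebroid_laws S A := lie_laws A.

Lemma vcons_comp_lift (T : lmodType R) k (Z : T) (Y : 'I_k -> T) :
  vcons Z Y \o lift ord0 = Y.
Proof. by apply/funext => i; rewrite /= vconsS. Qed.

Lemma vcons_lift (T : lmodType R) k (Z : T) (Y : 'I_k.+1 -> T) (i : 'I_k.+1) :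
  vcons Z Y \o lift (lift ord0 i) = vcons Z (Y \o lift i).
Proof.
apply/funext => l; case: (unliftP ord0 l) => [j ->|->] /=.
  have -> : lift (lift ord0 i) (lift ord0 j) = lift ord0 (lift i j).
    by apply: val_inj; rewrite /= /bump; lia.
  by rewrite !vconsS.
have -> : lift (lift ord0 i) ord0 = ord0 by apply: val_inj.
by rewrite !vcons0.
Qed.

Lemma koszul_vcons k (w : sform S A k.+1) (Z : sections) (ZS : sect Z)
    (Y : 'I_k.+1 -> sections) x :
  koszul w (vcons Z Y) x = lder_fun Z w Y x - koszul (iform ZS w) Y x.
Proof.
have ZS' : sect (vcons Z Y ord0) by rewrite vcons0.
rewrite (koszulS _ _ ZS') vcons_comp_lift.
rewrite (_ : iform ZS' w = iform ZS w) ?vcons0//.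
by apply: sform_ext => y; apply: altform_ext => V; rewrite !iformE vcons0.
Qed.

Lemma lder_vcons k (w : sform S A k.+1) (Z Y0 : sections) (Y0S : sect Y0)
    (Y : 'I_k -> sections) x :
  lder_fun Z w (vcons Y0 Y) x =
  lder_fun Z (iform Y0S w) Y x - w x (vcons (br Z Y0 x) (fun l => Y l x)).
Proof.
rewrite /lder_fun big_ord_recl opprD addrA addrAC; congr (_ - _ - _).
- by congr (anchor _ _); apply/funext => y; rewrite at_vcons iformE.
- by apply: eq_bigr => i _; rewrite at_vcons vcons_updS vconsS iformE.
- by rewrite at_vcons vcons_upd0 vcons0.
Qed.

Lemma koszulN k (w : sform S A k) (X : 'I_k.+1 -> sections) x :
  (forall i, sect (X i)) -> koszul (- w) X x = - koszul w X x.
Proof.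
move=> XS; rewrite /koszul opprD -!sumrN; congr (_ + _); apply: eq_bigr => i _.
  rewrite -mulrN -anchorN//.
  by apply: sform_smooth => l; exact: XS.
by rewrite -sumrN; apply: eq_bigr => j _; rewrite sformN altformN mulrN.
Qed.

(** Cartan's formula is applied twice. The Lie derivatives of contracted forms cancel in pairs, the
    bracket terms by skewness of the bracket, and the doubly contracted terms by iota_Y iota_Z = -
    iota_Z iota_Y. *)
Lemma koszul_swap k (w : sform S A k.+1) (Z Y : sections) (X : 'I_k -> sections) x :
  sect Z -> sect Y -> (forall i, sect (X i)) ->
  koszul w (vcons Z (vcons Y X)) x = - koszul w (vcons Y (vcons Z X)) x.
Proof.
move=> ZS YS XS; rewrite (koszul_vcons _ ZS) (koszul_vcons _ YS).
rewrite (lder_vcons _ _ YS) (lder_vcons _ _ ZS).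
have -> : w x (vcons (br Y Z x) (fun l => X l x)) = - w x (vcons (br Z Y x) (fun l => X l x)).
  by rewrite (br_skew L)// -scaleN1r -[_ *: _]addr0 altform_vcons_lin
    -[X in _ + X](_ : 0 = _) ?addr0 ?mulN1r// -(vcons_upd0 0) altform_upd0.
have K2 : koszul (iform ZS w) (vcons Y X) x + koszul (iform YS w) (vcons Z X) x =
    lder_fun Y (iform ZS w) X x + lder_fun Z (iform YS w) X x.
  case: k w X XS => [|k] w X XS.
    by rewrite !koszul0 !vcons_comp_lift !vcons0.
  rewrite (koszul_vcons _ YS) (koszul_vcons _ ZS).
  have -> : iform YS (iform ZS w) = - iform ZS (iform YS w).
    apply: sform_ext => y; apply: altform_ext => V; rewrite sformN altformN !iformE.
    by have := altform_vcons_swap (w y) (Z y) (Y y) (vcons 0 V) ord0; rewrite !vcons_upd0.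
  by rewrite koszulN//; ring.
lra.
Qed.

(** For a fixed first argument, [tP] makes the Koszul expression a form in the remaining ones. The
    first slot is treated by exchanging it with the second through [koszul_swap], which also gives
    the vanishing [diag] when a later argument repeats the first. *)
Lemma koszul_form k (w : sform S A k) : exists t : sform S A k.+1,
  forall X : 'I_k.+1 -> sections, (forall i, sect (X i)) ->
  forall x, t x (fun i => X i x) = koszul w X x.
Proof.
elim: k w => [|k IH] w.
  apply: tensorial_form; have E (X : 'I_1 -> sections) x :
      koszul w X x = anchor (X ord0 x) (fun y => w y (fun=> 0)).
    rewrite koszul0 /lder_fun big_ord0 subr0; congr (anchor _ _); apply/funext => y.
    by congr (w y _); apply/funext => -[].
  have wS : smooth S setT (fun y => w y (fun=> 0)).
    apply: (smooth_ext openT (f := fun y => w y (fun l : 'I_0 => (0 : sections) y))) => //.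
    by apply: sform_smooth => -[].
  split=> [X i f Y Z XS YS ZS x|X i j|X XS]; last 2 first.
  - by rewrite (ord1 i) (ord1 j) eqxx.
  - by apply: (smooth_ext openT (fun x _ => esym (E X x))); exact: smooth_anchor.
  by rewrite !E (ord1 i) !upd_same anchor_lin_vec.
have tP (Z : sections) : sect Z -> exists t : sform S A k.+1,
    forall Y : 'I_k.+1 -> sections, (forall i, sect (Y i)) ->
    forall x, t x (fun i => Y i x) = koszul w (vcons Z Y) x.
  move=> ZS; have [l lP] := tensorial_form (lder_tensorial w ZS).
  have [t tP] := IH (iform ZS w); exists (l - t) => Y YS x.
  by rewrite sformD sformN altformD altformN lP// tP// (koszul_vcons _ ZS).
have diag (Z : sections) (Y : 'I_k.+1 -> sections) j x : sect Z ->
    (forall i, sect (Y i)) -> Y j = Z -> koszul w (vcons Z Y) x = 0.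
  move=> ZS YS Yj; have [t tE] := tP _ ZS; rewrite -tE//.
  rewrite -(upd_id (fun i => Y i x) j) altform_upd_vcons.
  have := tE (vcons Z (Y \o lift j)) _ x; rewrite at_vcons Yj => ->; last first.
    by apply: sec_vcons => // i; exact: YS.
  have YS' i : sect ((Y \o lift j) i) by exact: YS.
  have /eqP := koszul_swap w x ZS ZS YS'; rewrite -addr_eq0 -mulr2n mulrn_eq0 /=.
  by move=> /eqP ->; rewrite mulr0.
apply: tensorial_form; split=> [X i f Y Z XS YS ZS x|X i j XS ij Xij x|X XS].
- case: (unliftP ord0 i) => [l ->|->].
    have [t tE] := tP _ (XS ord0).
    have E (V : sections) : sect V -> koszul w (upd X (lift ord0 l) V) x =
        t x (upd (fun i => X (lift ord0 i) x) l (V x)).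
      move=> VS; rewrite -{1}(vcons_eta X) vcons_updS -tE ?at_upd//.
      by apply: sec_upd => // j; exact: XS.
    rewrite !E//; last exact: sec_lin.
    exact: altform_lin.
  have [t tE] := tP _ (XS (lift ord0 ord0)).
  have E (V : sections) : sect V -> koszul w (upd X ord0 V) x =
      - t x (vcons (V x) (fun i => X (lift ord0 (lift ord0 i)) x)).
    move=> VS; rewrite -{1}(vcons_eta X) vcons_upd0 -{1}(vcons_eta (X \o lift ord0)).
    rewrite koszul_swap//; [|exact: XS|by move=> j; exact: XS].
    rewrite -tE ?at_vcons//; apply: sec_vcons => // j; exact: XS.
  rewrite !E//; last exact: sec_lin.
  by rewrite altform_vcons_lin opprD mulrN.
- rewrite -(vcons_eta X); have X'S l : sect ((X \o lift ord0) l) by exact: XS.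
  case: (unliftP ord0 i) (unliftP ord0 j) ij Xij => [i' ->|->] [j' ->|->] ij Xij.
  + have [t tE] := tP _ (XS ord0); rewrite -tE//.
    by apply: (altform_alt _ (_ : i' != j')); [rewrite (inj_eq lift_inj) in ij|rewrite /= Xij].
  + by apply: (diag _ _ i').
  + by apply: (diag _ _ j').
  + by rewrite eqxx in ij.
have [t tE] := tP _ (XS ord0).
apply: (smooth_ext openT (f := fun x => t x (fun i => (X \o lift ord0) i x))).
  by move=> x _; rewrite tE ?vcons_eta// => i; exact: XS.
by apply: sform_smooth => i; exact: XS.
Qed.

Lemma dformE k (w : sform S A k) (X : 'I_k.+1 -> sections) x :
  (forall i, sect (X i)) -> dform w x (fun i => X i x) = koszul w X x.
Proof.
move=> XS; have [t tE] := koszul_form w.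
by rewrite /dform (form_ofE (@sec_through _ _ _ _ _ A) tE) tE.
Qed.

Lemma dcov_alternating (f : smooth_fun S) x :
  alternating_form (fun X : 'I_1 -> fib A x => anchor (X ord0) f).
Proof.
split=> [X i a u v|X i j]; last by rewrite !ord1 eqxx.
by rewrite (ord1 i) !upd_same; exact: (anchor_linear L).
Qed.

Definition dcov (f : smooth_fun S) x : altform 1 (fib A x) :=
  mk_altform (dcov_alternating f x).

Lemma dcovE f x (v : fib A x) : dcov f x (fun=> v) = anchor v f.
Proof. by []. Qed.

Lemma koszul_fscale k (f : smooth_fun S) (w : sform S A k) (X : 'I_k.+1 -> sections) x :
  (forall i, sect (X i)) ->
  koszul (fscale f w) X x = f x * koszul w X x +
    \sum_(i < k.+1) (-1) ^+ i * (anchor (X i x) f * w x (fun l => X (lift i l) x)).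
Proof.
move=> XS; rewrite /koszul mulrDr addrAC; congr (_ + _).
  rewrite mulr_sumr -big_split; apply: eq_bigr => i _ /=.
  have -> : (fun y => fscale f w y (fun l => X (lift i l) y)) =
      fun y => f y * w y (fun l => X (lift i l) y) by [].
  rewrite anchorM; [ring|exact: smooth_funP|].
  by apply: sform_smooth => l; exact: XS.
rewrite mulr_sumr; apply: eq_bigr => i _; rewrite mulr_sumr; apply: eq_bigr => j _.
by rewrite fscaleE altformZ mulrCA.
Qed.

(** This is d (f w) = f d w + df /\ w contracted with v, where [nder] stands for df /\ iota_v w.
    With [lie_der_fscale] it isolates the terms in df of the Nambu identity. *)
Lemma interior_dform_fscale k (f : smooth_fun S) (w : sform S A k) x (v : fib A x) :
  Defs.interior v (dform (fscale f w) x) =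
  f x *: Defs.interior v (dform w x) + anchor v f *: w x - nder (dcov f x) v (w x).
Proof.
have [Y' YS <-] := sec_through v; pose Y : sections := Y'; rewrite -[Y' x]/(Y x).
apply: (altform_at_ext (@sec_through _ _ _ _ _ A)) => Z ZS.
rewrite !altformD altformN !altformZ.
have ZYS : forall i, sect (vcons Y Z i) by exact: sec_vcons.
have dE (u : sform S A k) : Defs.interior (Y x) (dform u x) (fun i => Z i x) =
    koszul u (vcons Y Z) x.
  by rewrite -dformE// at_vcons.
rewrite !dE koszul_fscale// -addrA; congr (_ + _).
rewrite big_ord_recl expr0 mul1r vcons0; congr (_ * w x _ + _).
  by apply/funext => l; rewrite vconsS.
rewrite nderE -sumrN; apply: eq_bigr => i _; rewrite dcovE vconsS.
case: k w Z ZS ZYS dE i => [|k] w Z ZS ZYS dE i; first by case: i.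
rewrite altform_upd_vcons.
have -> : (fun l => vcons Y Z (lift (lift ord0 i) l) x) = vcons (Y x) (fun l => Z (lift i l) x).
  by rewrite -(at_vcons (fun l => Z (lift i l))) -(vcons_lift Y Z i).
by rewrite lift0 exprS -[_ \o lift i]/(fun l => Z (lift i l) x); ring.
Qed.

Lemma lie_der_fscale k (f : smooth_fun S) (X : sections) (w : sform S A k) x : sect X ->
  lie_der (fun y => f y *: X y) w x = f x *: lie_der X w x + nder (dcov f x) (X x) (w x).
Proof.
move=> XS; apply: (altform_at_ext (@sec_through _ _ _ _ _ A)) => Y YS.
have fXS := sec_scale f XS.
rewrite altformD altformZ !lie_derE// nderE /lder_fun.
have wS : smooth S setT (fun y => w y (fun l => Y l y)) by exact: sform_smooth.
have -> : anchor (f x *: X x) (fun y => w y (fun l => Y l y)) =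
    f x * anchor (X x) (fun y => w y (fun l => Y l y)).
  rewrite -[f x *: X x]addr0 anchor_lin_vec// (_ : anchor 0 _ = 0) ?addr0//.
  have := anchor_lin_vec wS (0 : fib A x) 0 1; rewrite scale1r addr0 mul1r => /eqP.
  by rewrite -subr_eq0 opprD addNKr oppr_eq0 => /eqP.
rewrite mulrBr -addrA; congr (_ + _); rewrite mulr_sumr -!sumrN -big_split.
apply: eq_bigr => i _ /=; rewrite (br_skew L)//.
rewrite (br_leibniz L f (YS i) XS) (br_skew L XS (YS i)).
by rewrite !altform_updN altform_updD !altform_updZ dcovE; ring.
Qed.

End ExteriorDerivative.

(** * Schouten bracket and the Nambu identity *)

Section WedgeLinear.
Variables (R : realType) (V : lmodType R) (m : nat).

Lemma wedge1_linl (c : altform 1 V) a (f g : altform m V) :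
  wedge (addn1 m) (a *: f + g) c = a *: wedge (addn1 m) f c + wedge (addn1 m) g c.
Proof.
apply: altform_ext => X; rewrite altformD altformZ !wedge1E mulr_sumr -big_split.
by apply: eq_bigr => i _ /=; rewrite altformD altformZ; ring.
Qed.

Lemma wedge1Dl (c : altform 1 V) (f g : altform m V) :
  wedge (addn1 m) (f + g) c = wedge (addn1 m) f c + wedge (addn1 m) g c.
Proof. by rewrite -[f]scale1r wedge1_linl !scale1r. Qed.

Lemma wedge10l (c : altform 1 V) : wedge (addn1 m) (0 : altform m V) c = 0.
Proof.
by apply: altform_ext => X; rewrite wedge1E big1// => i _; rewrite altform0 mul0r mulr0.
Qed.

Lemma wedge1Zl (c : altform 1 V) a (f : altform m V) :
  wedge (addn1 m) (a *: f) c = a *: wedge (addn1 m) f c.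
Proof. by rewrite -[a *: f]addr0 wedge1_linl wedge10l addr0. Qed.

Lemma wedge1Nl (c : altform 1 V) (f : altform m V) :
  wedge (addn1 m) (- f) c = - wedge (addn1 m) f c.
Proof. by rewrite -scaleN1r wedge1Zl scaleN1r. Qed.

Lemma nder_linl k (w : altform k V) X a (c c' : altform 1 V) :
  nder (a *: c + c') X w = a *: nder c X w + nder c' X w.
Proof.
apply: altform_ext => Z; rewrite altformD altformZ !nderE mulr_sumr -big_split.
by apply: eq_bigr => i _ /=; rewrite altformD altformZ; ring.
Qed.

Lemma nder0l k (w : altform k V) X : nder 0 X w = 0.
Proof.
by apply: altform_ext => Z; rewrite nderE big1// => i _; rewrite altform0 mul0r.
Qed.
End WedgeLinear.

(** * Multivector fields and the Schouten bracket *)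

Section Multivectors.
Variables (R : realType) (d : nat) (M : topologicalType) (S : manifold R d M).
Variables (r : nat) (A : lie_algebroid S r) (m : nat).
Local Notation sections := (fib_prod (fib A)).
Local Notation sect := (@sec R M A).

Lemma fib_dual x : exists (e : 'I_r -> fib A x) (c : 'I_r -> altform 1 (fib A x)),
  forall v : fib A x, v = \sum_l c l (fun=> v) *: e l.
Proof.
have [b [e [c [_ _ _ ev]]]] := local_frame_at A x.
by exists (fun l => e l x), (fun l => c l x).
Qed.

Lemma covec_at_inj x (u v : fib A x) :
  (forall c : altform 1 (fib A x), c (fun=> u) = c (fun=> v)) -> u = v.
Proof. by have [e [c ec]] := fib_dual x; exact: (covec_inj ec). Qed.

Lemma sharpE (xi : mvector_field A m.+1) x (a : altform m (fib A x)) (c : altform 1 (fib A x)) :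
  c (fun=> sharp xi a) = xi x (wedge (addn1 m) a c).
Proof. by have [e [ec ecP]] := fib_dual x; exact: (sharpvE ecP (xi x) a c). Qed.

Lemma sharp_linear (xi : mvector_field A m.+1) x : linear (@sharp R M A m xi x).
Proof. by have [e [ec ecP]] := fib_dual x; exact: (sharpv_linear ecP (xi x)). Qed.

Lemma sharpZ (xi : mvector_field A m.+1) x t (a : altform m (fib A x)) :
  sharp xi (t *: a) = t *: sharp xi a.
Proof.
by apply: covec_at_inj => c; rewrite covecZ !sharpE wedge1Zl linearZ.
Qed.

Lemma swedge_smooth (a : sform S A m) (c : sform S A 1) :
  smooth_form S (fun x => wedge (addn1 m) (a x) (c x)).
Proof.
move=> X XS; apply: (smooth_ext openT (f := fun x => \sum_(i < m.+1) (-1) ^+ (m + i) *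
    (a x (fun l => X (lift i l) x) * c x (fun=> X i x)))).
  by move=> x _; rewrite wedge1E.
apply: smooth_sum => [|i _]; first exact: openT.
apply: smooth_mul; [exact: openT|exact: smooth_cst openT|].
apply: smooth_mul; first exact: openT.
  by apply: (@sform_smooth _ _ _ _ _ _ a (fun l => X (lift i l))) => l; exact: XS.
by apply: (@sform_smooth _ _ _ _ _ _ c (fun=> X i)) => l; exact: XS.
Qed.

Definition swedge (a : sform S A m) (c : sform S A 1) : sform S A m.+1 :=
  mk_sform (swedge_smooth a c).

Lemma swedgeE a c x : swedge a c x = wedge (addn1 m) (a x) (c x).
Proof. by []. Qed.

Lemma sdetform_smooth k (c : 'I_k -> sform S A 1) :
  smooth_form S (fun x => detform (fun i => c i x)).
Proof.
move=> X XS; rewrite /sform_at.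
apply: (smooth_ext openT (f := fun x => \sum_(s : 'S_k) (-1) ^+ s *
    \prod_i c (s i) x (fun=> X i x))).
  move=> x _; rewrite detformE /determinant; apply: eq_bigr => s _.
  by congr (_ * _); apply: eq_bigr => i _; rewrite mxE.
apply: smooth_sum => [|s _]; first exact: openT.
apply: smooth_mul; [exact: openT|exact: smooth_cst openT|].
apply: smooth_prod => [|i _]; first exact: openT.
by apply: (@sform_smooth _ _ _ _ _ _ (c (s i)) (fun=> X i)) => l; exact: XS.
Qed.

Definition sdetform k (c : 'I_k -> sform S A 1) : sform S A k :=
  mk_sform (sdetform_smooth c).

Variable Pi : mvector_field A m.+1.
Hypothesis PiS : smooth_mvector S Pi.

(** Where the bump of the coframe is 1, the k-th coordinate is Pi (a /\ c_k), the value of Pi on a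
    smooth form. *)
Lemma sharp_sec (a : sform S A m) : sect (fun x => sharp Pi (a x)).
Proof.
move=> i k; apply: smooth_local => x ix; have [b [e [c [b1 _ cb _]]]] := local_frame ix.
exists ([set y | b y = 1]°); first exact: b1.
apply: (smooth_ext (open_interior _) (f := fun y => Pi y (swedge a (c k) y))).
  by move=> y /interior_subset/= by1; rewrite swedgeE -sharpE cb by1 mul1r.
exact: smooth_sub (PiS _).
Qed.

Lemma mvector_local x : exists (U : set M) (p : nat) (Y : 'I_p -> 'I_m.+1 -> sections),
  [/\ open U, U x, forall j i, sect (Y j i) &
      forall y, U y -> forall f : altform m.+1 (fib A y),
        Pi y f = \sum_(j < p) f (fun i => Y j i y)].
Proof.
have [b [e [c [b1 eS be _]]]] := local_frame_at A x.
pose cf (g : {ffun 'I_m.+1 -> 'I_r}) y : R :=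
  (m.+1`!)%:R^-1 * Pi y (sdetform (fun i => c (g i)) y).
have cfS g : smooth S setT (cf g).
  by apply: smooth_mul; [exact: openT|exact: smooth_cst openT|exact: PiS].
pose Y0 (g : {ffun 'I_m.+1 -> 'I_r}) : 'I_m.+1 -> sections :=
  vcons ((fun y => cf g y *: e (g ord0) y) : sections) (fun i => e (g (lift ord0 i))).
exists ([set y | b y = 1]°), #|{ffun 'I_m.+1 -> 'I_r}|, (fun j => Y0 (enum_val j)).
split; [exact: open_interior|exact: b1| |].
  move=> j i; apply: sec_vcons => [l|]; first exact: eS.
  exact: (sec_scale (SmoothFun (cfS _)) (eS _)).
move=> y /interior_subset/= by1 f.
have ev (v : fib A y) : v = \sum_l c l y (fun=> v) *: e l y.
  by rewrite -be by1 mulr1 scale1r.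
rewrite -(big_enum_val (fun g : {ffun 'I_m.+1 -> 'I_r} => f (fun i => Y0 g i y))) /=.
rewrite {1}(altform_detforms ev f) linearZ linear_sum /= mulr_sumr.
apply: eq_big => // g _; rewrite at_vcons altform_vcons_scale linearZ /= /cf mulrA mulrAC.
congr (_ * _ * f _).
by rewrite -[LHS]vcons_eta.
Qed.

(** The right-hand side does not mention Y, so the local formula for the bracket is independent of
    the decomposition. It is the definition of the Lie derivative, summed over the decomposable
    terms. *)
Lemma schouten_val (X : sections) x (U : set M) (p : nat) (Y : 'I_p -> 'I_m.+1 -> sections)
    (w : sform S A m.+1) : sect X -> open U -> U x -> (forall j i, sect (Y j i)) ->
  (forall y, U y -> forall f : altform m.+1 (fib A y),
     Pi y f = \sum_(j < p) f (fun i => Y j i y)) ->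
  \sum_(j < p) \sum_i w x (upd (fun l => Y j l x) i (br X (Y j i) x)) =
  anchor (X x) (fun y => Pi y (w y)) - Pi x (lie_der X w x).
Proof.
move=> XS oU Ux YS PiE; rewrite (PiE _ Ux).
have wS j : smooth S setT (fun y => w y (fun i => Y j i y)) by exact: sform_smooth.
have -> : anchor (X x) (fun y => Pi y (w y)) =
    anchor (X x) (fun y => \sum_(j < p) w y (fun i => Y j i y)).
  apply: anchor_local; [exact: PiS|by apply: smooth_sum; [exact: openT|]|].
  by apply: filterS (open_nbhs_nbhs (conj oU Ux)) => y Uy; rewrite PiE.
rewrite anchor_sum// -sumrB; apply: eq_bigr => j _.
by rewrite lie_derE// /lder_fun opprB addrC subrK.
Qed.

(** One decomposition near each y defines a functional on the fibre, and [schouten_val] shows that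
    it agrees with every other decomposition; so the described bracket exists. *)
Lemma schoutenE (X : sections) x (w : sform S A m.+1) : sect X ->
  schouten X Pi x (w x) = anchor (X x) (fun y => Pi y (w y)) - Pi x (lie_der X w x).
Proof.
move=> XS.
have zex y : exists z : mvector m.+1 (fib A y), forall w : sform S A m.+1,
    z (w y) = anchor (X y) (fun y => Pi y (w y)) - Pi y (lie_der X w y).
  have [U [p [Y [oU Uy YS PiE]]]] := mvector_local y.
  pose z (f : altform m.+1 (fib A y)) : R :=
    \sum_(j < p) \sum_i f (upd (fun l => Y j l y) i (br X (Y j i) y)).
  have zl : scalar z.
    move=> a f g; rewrite /z mulr_sumr -big_split; apply: eq_bigr => j _ /=.
    rewrite mulr_sumr -big_split; apply: eq_bigr => i _ /=.
    by rewrite altformD altformZ.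
  pose zz : {scalar altform m.+1 (fib A y)} :=
    HB.pack z (GRing.isLinear.Build R (altform m.+1 (fib A y)) R _ z zl).
  by exists zz => v; rewrite -[LHS]/(z (v y)) /z (schouten_val v XS oU Uy YS PiE).
pose zeta : mvector_field A m.+1 := fun y => sval (cid (zex y)).
have zetaE y (v : sform S A m.+1) :
    zeta y (v y) = anchor (X y) (fun y => Pi y (v y)) - Pi y (lie_der X v y).
  exact: (svalP (cid (zex y)) v).
pose Q : set (mvector_field A m.+1) := [set zeta : mvector_field A m.+1 |
    forall (U : set M) (p : nat) (Y : 'I_p -> 'I_m.+1 -> forall x, fib A x),
      open U -> (forall j i, sect (Y j i)) ->
      (forall x, U x -> forall phi : altform m.+1 (fib A x),
         Pi x phi = \sum_(j < p) phi (fun i => Y j i x)) ->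
      forall x, U x -> forall phi : altform m.+1 (fib A x),
        zeta x phi = \sum_(j < p) \sum_(i < m.+1)
          phi (upd (fun l => Y j l x) i (br X (Y j i) x))].
have spec : Q (schouten X Pi).
  apply: the_spec; exists zeta => U p Y oU YS PiE y Uy phi; have [v <-] := form_through phi.
  by rewrite zetaE -(schouten_val _ XS oU Uy YS PiE).
have [U [p [Y [oU Ux YS PiE]]]] := mvector_local x.
rewrite -(schouten_val w XS oU Ux YS PiE).
exact: (spec U p Y oU YS PiE x Ux (w x)).
Qed.

Lemma schouten_fscale (f : smooth_fun S) (X : sections) x (w : altform m.+1 (fib A x)) :
  sect X -> schouten (fun y => f y *: X y) Pi x w =
  f x * schouten X Pi x w - Pi x (nder (dcov A f x) (X x) w).
Proof.
move=> XS; have [v <-] := form_through w; rewrite !schoutenE//; last exact: sec_scale.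
rewrite lie_der_fscale// linearD linearZ /= -[f x *: X x]addr0.
rewrite (anchor_lin_vec (PiS v)).
have -> : anchor (0 : fib A x) (fun y => Pi y (v y)) = 0.
  have := anchor_lin_vec (PiS v) (0 : fib A x) 0 1.
  by rewrite scale1r addr0 mul1r => /eqP; rewrite -subr_eq0 opprD addNKr oppr_eq0 => /eqP.
by rewrite addr0; ring.
Qed.

End Multivectors.

(** * The symbol of the Nambu identity *)

Section NambuSymbol.
Variables (R : realType) (d : nat) (M : topologicalType) (S : manifold R d M).
Variables (r : nat) (A : lie_algebroid S r) (m : nat).
Variable Pi : mvector_field A m.+1.
Hypothesis PiN : regular_nambu Pi.
Hypothesis A_spanned : locally_spanned_by_exact A.

Let PiS : smooth_mvector S Pi := nambu_smooth PiN.

Lemma nambu_symbol_exact x (f : smooth_fun S) (c : altform 1 (fib A x))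
    (a g : altform m (fib A x)) :
  Pi x (nder (dcov A f x) (sharp Pi a) (wedge (addn1 m) g c)) =
  dcov A f x (fun=> sharp Pi g) * Pi x (wedge (addn1 m) a c) -
  Pi x (wedge (addn1 m) (nder (dcov A f x) (sharp Pi g) a) c).
Proof.
have [al <-] := form_through a; have [be <-] := form_through g.
pose X y := sharp Pi (al y).
have XS : @sec R M A X by exact: sharp_sec.
have N0 := nambu_identity PiN al be x.
have := nambu_identity PiN (fscale f al) be x.
have -> : (fun y => sharp Pi (fscale f al y)) = fun y => f y *: X y.
  by apply: functional_extensionality_dep => y; rewrite fscaleE sharpZ.
rewrite interior_dform_fscale => N1.
have := congr1 (fun v => c (fun=> v)) N1; rewrite covecN !sharpE schouten_fscale//.
rewrite !(wedge1Dl, wedge1Nl, wedge1Zl) !linearD !linearN !linearZ /=.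
have := congr1 (fun v => c (fun=> v)) N0; rewrite covecN !sharpE => ->.
by rewrite -(sharpE _ _ (dcov A f x)) dcovE /GRing.scale /= /X; lra.
Qed.

(** Both sides are linear in phi, and at x a covector is a combination of differentials; only the
    values of the coefficients at x enter. *)
Lemma nambu_symbol x (phi c : altform 1 (fib A x)) (a g : altform m (fib A x)) :
  Pi x (nder phi (sharp Pi a) (wedge (addn1 m) g c)) =
  phi (fun=> sharp Pi g) * Pi x (wedge (addn1 m) a c) -
  Pi x (wedge (addn1 m) (nder phi (sharp Pi g) a) c).
Proof.
have [al alE] := form_through phi; have [U [oU Ux /(_ al)[p [f [h [_ hf]]]]]] := A_spanned x.
have -> : phi = \sum_(j < p) h j x *: dcov A (f j) x.
  apply: altform_ext => V; have -> : V = fun=> V ord0 by apply/funext => i; rewrite (ord1 i).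
  by rewrite -alE hf// altform_sum.
elim: (index_enum _) => [|j s IH].
  by rewrite big_nil !nder0l wedge10l altform0 !linear0 mul0r ?subr0 ?addr0.
rewrite big_cons !nder_linl wedge1_linl !linearD !linearZ /= IH altformD altformZ.
by rewrite nambu_symbol_exact /GRing.scale /=; ring.
Qed.

Lemma nambu_decomp x : (1 < m)%N -> exists X : 'I_m.+1 -> fib A x, forall w, Pi x w = w X.
Proof.
move=> m2; have [e [c ec]] := fib_dual A x; have [w0 Pw0] := nambu_regular PiN x.
exact: (nambu_decomposable ec (nambu_symbol (x := x)) m2 Pw0).
Qed.

End NambuSymbol.

Section Volume.
Variables (R : realType) (d : nat) (M : topologicalType) (S : manifold R d M).

Lemma smooth_continuous (f : M -> R) : smooth S setT f -> continuous f.
Proof.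
move=> fS x; have [i ix] := chart_cover S x.
have [cf _] := fS i 0; have ci : {for x, continuous (chart i)} by exact: chart_continuous.
have fx : (chart i @` (chart_dom i `&` setT)) (chart i x) by exists x.
have h : {for x, continuous ((f \o chart_inv i) \o chart i)}.
  by apply: continuous_comp; [exact: ci|exact: cf].
rewrite /continuous_at /= in h; rewrite /continuous_at.
have E : \forall y \near x, f y = (f \o chart_inv i \o chart i) y.
  have n : nbhs x (chart_dom i) by apply: open_nbhs_nbhs; split=> //; exact: chart_dom_open.
  by apply: filterS n => y iy; rewrite /= chartK.
rewrite (nbhs_singleton E); apply: cvg_trans h.
by apply: near_eq_cvg; apply: filterS E => y ->.
Qed.

Lemma smooth_open_gt0 (f : M -> R) : smooth S setT f -> open [set y | 0 < f y].
Proof.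
move=> fS; have -> : [set y | 0 < f y] = f @^-1` [set t | 0 < t] by [].
by apply: open_comp; [move=> ? _; exact: smooth_continuous|exact: open_gt].
Qed.
End Volume.

(** * Brackets in the image of sharp, and a form dual to Pi *)

Section NambuGeometry.
Variables (R : realType) (d : nat) (M : topologicalType) (S : manifold R d M).
Variables (r : nat) (A : lie_algebroid S r) (m : nat).
Local Notation sections := (fib_prod (fib A)).
Local Notation sect := (@sec R M A).

(** In each term of [wedge1E] the bracket falls either on the argument of c or on one of those of a;
    [bigD1_ord] separates the two cases. *)
Lemma lie_der_swedge (X : sections) (a : sform S A m) (c : sform S A 1) x : sect X ->
  lie_der X (swedge a c) x =
  wedge (addn1 m) (lie_der X a x) (c x) + wedge (addn1 m) (a x) (lie_der X c x).
Proof.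
move=> XS; apply: (altform_at_ext (@sec_through _ _ _ _ _ A)) => Z ZS.
have aS (i : 'I_m.+1) : smooth S setT (fun y => a y (fun l => Z (lift i l) y)).
  by apply: (@sform_smooth _ _ _ _ _ _ a (fun l => Z (lift i l))) => l; exact: ZS.
have cS (i : 'I_m.+1) : smooth S setT (fun y => c y (fun=> Z i y)).
  by apply: (@sform_smooth _ _ _ _ _ _ c (fun=> Z i)) => l; exact: ZS.
rewrite altformD lie_derE// !wedge1E -big_split /= /lder_fun.
have -> : anchor (X x) (fun y => swedge a c y (fun l => Z l y)) =
    \sum_(i < m.+1) (-1) ^+ (m + i) *
      (anchor (X x) (fun y => a y (fun l => Z (lift i l) y)) * c x (fun=> Z i x) +
       a x (fun l => Z (lift i l) x) * anchor (X x) (fun y => c y (fun=> Z i y))).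
  have -> : (fun y => swedge a c y (fun l => Z l y)) = fun y =>
      \sum_(i < m.+1) smooth_fun_cst S ((-1) ^+ (m + i)) y *
        (a y (fun l => Z (lift i l) y) * c y (fun=> Z i y)).
    by apply/funext => y; rewrite swedgeE wedge1E.
  rewrite anchor_sum => [|i]; last first.
    by apply: smooth_mul; [exact: openT|exact: smooth_funP|exact: (smooth_mul openT (aS i) (cS i))].
  apply: eq_bigr => i _; rewrite anchorM; [|exact: smooth_funP|exact: (smooth_mul openT (aS i) (cS i))].
  by rewrite anchor_cst mul0r add0r anchorM; [|exact: aS|exact: cS].
have -> : \sum_(l < m.+1) swedge a c x (upd (fun l => Z l x) l (br X (Z l) x)) =
    \sum_(i < m.+1) (-1) ^+ (m + i) *
      (a x (fun l => Z (lift i l) x) * c x (fun=> br X (Z i) x) +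
       (\sum_(l < m) a x (upd (fun l => Z (lift i l) x) l (br X (Z (lift i l)) x))) *
         c x (fun=> Z i x)).
  under eq_bigr do rewrite swedgeE wedge1E.
  rewrite exchange_big; apply: eq_bigr => i _ /=; rewrite -mulr_sumr; congr (_ * _).
  rewrite (bigD1_ord i)//=; congr (_ + _).
    rewrite upd_same; congr (a x _ * _); apply/funext => l /=.
    by rewrite upd_neq// eq_sym neq_lift.
  rewrite mulr_suml; apply: eq_bigr => l _; rewrite upd_neq ?neq_lift//.
  congr (a x _ * _); apply/funext => l' /=; rewrite /upd (inj_eq lift_inj).
  by case: eqP.
rewrite -sumrB; apply: eq_bigr => i _; rewrite -mulrBr -mulrDr; congr (_ * _).
have -> : lie_der X a x ((fun l => Z l x) \o lift i) = lder_fun X a (Z \o lift i) x.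
  by rewrite -lie_derE// => l; exact: ZS.
have -> : lie_der X c x (fun=> Z i x) = lder_fun X c (fun=> Z i) x.
  by rewrite -lie_derE// => l; exact: ZS.
rewrite /lder_fun big_ord_recl big_ord0 addr0 /=.
have -> : upd (fun=> Z i x) (@ord0 0) (br X (Z i) x) = fun=> br X (Z i) x.
  by apply/funext => l; rewrite (ord1 l) upd_same.
by rewrite -[_ \o lift i]/(fun l => Z (lift i l) x); ring.
Qed.

Variable Pi : mvector_field A m.+1.
Hypothesis PiN : regular_nambu Pi.
Let PiS : smooth_mvector S Pi := nambu_smooth PiN.

(** Paired with a 1-form c: the Nambu identity turns the term in d a into [X, Pi] (b /\ c), and by
    [schoutenE] and the Leibniz rule for L_X (b /\ c) there remains X (c (Y)) - (L_X c) (Y) = c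
    ([X, Y]). *)
Lemma sharp_bracket (a b : sform S A m) x :
  sharp Pi (form_bracket Pi a b x) =
  br (fun y => sharp Pi (a y)) (fun y => sharp Pi (b y)) x.
Proof.
pose X : sections := fun y => sharp Pi (a y); pose Y : sections := fun y => sharp Pi (b y).
have XS : sect X by exact: sharp_sec.
have YS : sect Y by exact: sharp_sec.
apply: covec_at_inj => c0; have [c <-] := form_through c0.
rewrite sharpE wedge1Dl wedge1Nl linearB /=.
have := congr1 (fun v => c x (fun=> v)) (nambu_identity PiN a b x).
rewrite covecN !sharpE -[wedge _ (b x) (c x)]swedgeE schoutenE//.
rewrite lie_der_swedge// linearD /= -[Pi x (wedge _ (b x) _)]sharpE.
have -> : lie_der X c x (fun=> Y x) = lder_fun X c (fun=> Y) x by rewrite -lie_derE.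
rewrite /lder_fun big_ord_recl big_ord0 addr0.
have -> : upd (fun=> Y x) (@ord0 0) (br X Y x) = fun=> br X Y x.
  by apply/funext => l; rewrite (ord1 l) upd_same.
have -> : (fun y => Pi y (swedge b c y)) = fun y => c y (fun=> Y y).
  by apply/funext => y; rewrite swedgeE -sharpE.
by move=> h; lra.
Qed.

Hypothesis pM : paracompact M.

(** Positivity of the value under Pi survives sums with nonnegative weights, so forms positive near
    single points are added up with bumps as weights. The final division by the value of Pi also
    normalises the weights. *)
Lemma nambu_volume : exists Phi : sform S A m.+1, forall x, Pi x (Phi x) = 1.
Proof.
have wex x : exists w : sform S A m.+1, 0 < Pi x (w x).
  have [f] := nambu_regular PiN x; have [w <-] := form_through f => w0.
  have [wp|wn] := ltP 0 (Pi x (w x)); first by exists w.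
  by exists (- w); rewrite sformN linearN oppr_gt0 lt_neqAle w0.
have [w wP] := choice wex.
pose O x := [set y | 0 < Pi y (w x y)].
have oO x : open (O x) by apply: smooth_open_gt0; exact: PiS.
have [b [b_ge0 bO b_pos b_lf]] := locally_finite_bumps S pM oO wP.
have fin y : exists s : seq M, uniq s /\ forall x, x \notin s -> b x y = 0.
  have [W Wy /finite_seqP[s sE]] := b_lf y; exists (undup s); split; first exact: undup_uniq.
  move=> x; rewrite mem_undup => /negP xs; apply: contrapT => /eqP bx; apply: xs.
  have : [set` s] x by rewrite -sE; exists y => //; exact: nbhs_singleton.
  by [].
have fsumE (G : lmodType R) y (s : seq M) (F : M -> G) : uniq s ->
    (forall x, x \notin s -> b x y = 0) ->
    \sum_(x \in setT) b x y *: F x = \sum_(x <- s) b x y *: F x.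
  move=> us bs; rewrite (fsbigE s)//; last by move=> x _ xs; rewrite bs// scale0r.
  by rewrite big_mkcond; apply: eq_bigr => x _; rewrite in_setT.
pose Phi0 y : altform m.+1 (fib A y) := \sum_(x \in setT) b x y *: w x y.
have Phi0S : smooth_form S Phi0.
  move=> X XS; apply: (smooth_ext openT
      (f := fun y => \sum_(x \in setT) b x y * w x y (fun i => X i y))).
    move=> y _; have [s [us bs]] := fin y.
    rewrite /Phi0 (fsumE _ y s (fun x => w x y))// altform_sum.
    exact: (fsumE R^o y s (fun x => w x y (fun i => X i y))).
  apply: smooth_fsum => [x|y].
    by apply: smooth_mul; [exact: openT|exact: smooth_funP|exact: sform_smooth].
  have [W Wy fW] := b_lf y; exists W => //; apply: sub_finite_set fW => x [z Wz bz].
  by exists z => //; apply: contraNneq bz => ->; rewrite mul0r.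
pose Phi1 : sform S A m.+1 := mk_sform Phi0S.
have Phi1_gt0 y : 0 < Pi y (Phi1 y).
  have [s [us bs]] := fin y; have [x bx] := b_pos y.
  have xs : x \in s by apply: contraT => /bs b0; rewrite b0 ltxx in bx.
  have h : Pi y (Phi1 y) = \sum_(x <- s) b x y * Pi y (w x y).
    rewrite -[Phi1 y]/(Phi0 y) /Phi0 (fsumE _ y s (fun x => w x y))// linear_sum.
    by apply: eq_bigr => z _; rewrite linearZ.
  rewrite h (bigD1_seq x)//= ltr_wpDr//.
    apply: sumr_ge0 => z _; have [->|bz] := eqVneq (b z y) 0; first by rewrite mul0r.
    by rewrite mulr_ge0 ?b_ge0// ltW//; exact: bO bz.
  by rewrite mulr_gt0//; apply: bO; rewrite gt_eqF.
have iS : smooth S setT (fun y => (Pi y (Phi1 y))^-1).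
  by apply: smooth_inv; [exact: openT|move=> y _; rewrite gt_eqF|exact: PiS].
exists (fscale (SmoothFun iS) Phi1) => y.
rewrite fscaleE linearZ; apply: mulVf; exact: lt0r_neq0.
Qed.

End NambuGeometry.

(** * Complexes *)

Section LinearIso.
Variable R : realType.
Implicit Types V W : lmodType R.

(** Lets the spans in the definitions of D, of the vanishing forms and of the kernel of sharp be
    read as these sets themselves. *)
Lemma lspanP V (S : set V) (v : V) : S 0 ->
  (forall a u w, S u -> S w -> S (a *: u + w)) -> (v \in lspan S) <-> S v.
Proof.
move=> S0 SD; rewrite unfold_in; split=> [/asboolP|Sv].
  by apply=> //.
by apply/asboolP => P _ _; apply.
Qed.

Lemma linear_fun0 V W (f : V -> W) : linear f -> f 0 = 0.
Proof.
by move=> fl; have := fl (-1) 0 0; rewrite scaler0 addr0 scaleN1r addNr.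
Qed.

Lemma lspan_map V W (f : V -> W) (S : set V) (S' : set W) (v : V) : linear f ->
  (forall u, S u -> S' (f u)) -> v \in lspan S -> f v \in lspan S'.
Proof.
move=> fl fS; rewrite !unfold_in => /asboolP vS; apply/asboolP => P P0 PD SP.
apply: (vS (fun u => P (f u))) => [|a u w Pu Pw|u /fS]; last exact: SP.
  by rewrite linear_fun0.
by rewrite fl; apply: PD.
Qed.

Lemma bij_linear_inv V W (f : {linear V -> W}) (g : W -> V) :
  cancel g f -> cancel f g -> linear g.
Proof. by move=> gK fK a u v; apply: (can_inj fK); rewrite linearP !gK. Qed.

Lemma lmod_isomorphic_linear V W (f : V -> W) : linear f -> bijective f ->
  lmod_isomorphic V W.
Proof.
move=> fl fb; pose F : {linear V -> W} := HB.pack f (GRing.isLinear.Build R V W _ f fl).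
by exists F.
Qed.

Lemma lmod_isomorphic_sym V W : lmod_isomorphic V W -> lmod_isomorphic W V.
Proof.
move=> [f [g fK gK]]; apply: (@lmod_isomorphic_linear _ _ g).
  exact: (bij_linear_inv gK fK).
by exists f.
Qed.

Section Iso.
Variables (V W : lmodType R) (f : {linear V -> W}) (g : W -> V).
Hypotheses (fK : cancel f g) (gK : cancel g f).
Variables (S : set V) (S' : set W).
Hypothesis SS' : forall v, S v <-> S' (f v).

Let gl : linear g := bij_linear_inv gK fK.

Lemma iso_lspan v : v \in lspan S -> f v \in lspan S'.
Proof. by apply: lspan_map => [|u /SS']; first exact: linearP. Qed.

Lemma iso_lspan_inv w : w \in lspan S' -> g w \in lspan S.
Proof. by apply: (lspan_map gl) => u Su; apply/SS'; rewrite gK. Qed.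

Lemma subspace_iso : exists F : {linear Defs.subspace S -> Defs.subspace S'},
  bijective F /\ forall v : Defs.subspace S, val (F v : Defs.subspace S') = f (val v).
Proof.
pose F (v : Defs.subspace S) : Defs.subspace S' := exist _ (f (val v)) (iso_lspan (valP v)).
pose G (w : Defs.subspace S') : Defs.subspace S := exist _ (g (val w)) (iso_lspan_inv (valP w)).
have Fl : linear F by move=> a u v; apply: val_inj; rewrite /= !linearP.
pose FF : {linear Defs.subspace S -> Defs.subspace S'} :=
  HB.pack F (GRing.isLinear.Build R _ _ _ F Fl).
exists FF; split=> //.
by exists G => v; apply: val_inj; rewrite /= ?fK ?gK.
Qed.

Lemma quotient_iso : lmod_isomorphic (Defs.quotient S) (Defs.quotient S').
Proof.
pose F (q : Defs.quotient S) : Defs.quotient S' := class_of S' (f (rep q)).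
pose G (q : Defs.quotient S') : Defs.quotient S := class_of S (g (rep q)).
have FE v : F (class_of S v) = class_of S' (f v).
  apply/class_ofE; rewrite -linearB; apply: iso_lspan; apply/class_ofE.
  exact: rep_class.
have GE w : G (class_of S' w) = class_of S (g w).
  have -> : g w = g (rep (class_of S' w)) + - 1 *: (g (rep (class_of S' w)) - g w).
    by rewrite scaleN1r opprB addrC subrK.
  apply/class_ofE; rewrite opprD addNKr scaleN1r opprK.
  have gB : g (rep (class_of S' w)) - g w = g (rep (class_of S' w) - w).
    by rewrite addrC -scaleN1r -gl scaleN1r addrC.
  by rewrite gB; apply: iso_lspan_inv; apply/class_ofE; exact: rep_class.
apply: (@lmod_isomorphic_linear _ _ F) => [a u v|].
  rewrite -(rep_class u) -(rep_class v).
  have E (V' : lmodType R) (T : set V') a' u' v' :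
      a' *: class_of T u' + class_of T v' = class_of T (a' *: u' + v').
    by rewrite class_ofD class_ofZ.
  by rewrite E !FE E linearP.
exists G => q; rewrite -(rep_class q).
  by rewrite FE GE fK.
by rewrite GE FE gK.
Qed.
End Iso.

End LinearIso.

(** * Cohomology of isomorphic complexes *)

Section ChainIso.
Variable R : realType.
Variables (C C' : cochains R) (f : forall k, {linear cobj C k -> cobj C' k}).
Hypothesis f_bij : forall k, bijective (f k).
Hypothesis f_diff : forall k z, f k.+1 (cdiff z) = cdiff (f k z).

Lemma chain_iso_coboundary k (z : cobj C k) :
  @coboundary R C k z <-> @coboundary R C' k (f k z).
Proof.
have fI j : injective (f j) := bij_inj (f_bij j).
case: k z => [|k] z /=.
  split=> [->|fz]; first exact: linear0.
  by apply: (fI 0); rewrite fz linear0.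
split=> [[y _ <-]|[y' _ E]]; first by exists (f k y) => //; rewrite f_diff.
have [g _ gK] := f_bij k; exists (g y') => //.
by apply: (fI k.+1); rewrite f_diff gK.
Qed.

Lemma chain_iso_cohomology k : lmod_isomorphic (cohomology C k) (cohomology C' k).
Proof.
have fI j : injective (f j) := bij_inj (f_bij j).
have [g fK gK] := f_bij k.
have ZZ v : @cocycle R C k v <-> @cocycle R C' k (f k v).
  rewrite /cocycle /=; split=> [z0|z0]; first by rewrite -f_diff z0 linear0.
  by apply: (fI k.+1); rewrite f_diff z0 linear0.
have [F [[G FK GK] FE]] := subspace_iso fK gK ZZ.
by apply: (quotient_iso FK GK) => v; rewrite /= FE; exact: chain_iso_coboundary.
Qed.
End ChainIso.

Section KoszulMap.
Variables (R : realType) (d : nat) (M : topologicalType) (S : manifold R d M).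
Variables (E E' : algebroid_data R M) (s : forall x, fib E x -> fib E' x).
Hypothesis sl : forall x, linear (@s x).
Hypothesis s_anchor : forall x (v : fib E x), anchor v = anchor (s v).

(** Compatibility with brackets is asked for the sections X only, because brackets are controlled on
    smooth sections alone. *)
Lemma koszul_map k (w : sform S E k) (w' : sform S E' k)
    (X : 'I_k.+1 -> forall x, fib E x) x :
  (forall y V, w y V = w' y (@s y \o V)) ->
  (forall i j, s (br (X i) (X j) x) = br (fun y => s (X i y)) (fun y => s (X j y)) x) ->
  koszul w X x = koszul w' (fun i y => s (X i y)) x.
Proof.
move=> ww' sbr; rewrite /koszul; congr (_ + _); apply: eq_bigr => i _.
  by rewrite s_anchor; congr (_ * anchor _ _); apply/funext => y; rewrite ww'.
apply: eq_bigr => j _; congr (_ * _); rewrite ww'; congr (w' x _).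
apply/funext => l /=; rewrite -sbr.
case: (nat_of_ord l) => [//|n] /=.
(* Past the end of the list both sides take the default 0, which s preserves. *)
by elim: [seq h <- _ | _] n => [|h t IH] [|n] //=; rewrite ?nth_nil ?linear_fun0.
Qed.
End KoszulMap.

(** * Restriction to D and the Lie algebroid of the coimage *)

Section Complexes.
Variables (R : realType) (d : nat) (M : topologicalType) (S : manifold R d M).
Variables (r : nat) (A : lie_algebroid S r) (m : nat).
Local Notation sections := (fib_prod (fib A)).
Local Notation sect := (@sec R M A).
Variable Pi : mvector_field A m.+1.
Hypothesis PiN : regular_nambu Pi.
Hypothesis A_spanned : locally_spanned_by_exact A.
Hypothesis m2 : (1 < m)%N.
Let PiS : smooth_mvector S Pi := nambu_smooth PiN.

Variable Phi : sform S A m.+1.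
Hypothesis PhiE : forall x, Pi x (Phi x) = 1.

Local Notation D := (image_data Pi).
Local Notation C := (coimage_data Pi).

(* (-1)^m iota_v Phi, which sharp maps to v when v is in the image of sharp. *)
Definition flat_at x (v : fib A x) : altform m (fib A x) :=
  (-1) ^+ m *: Defs.interior v (Phi x).

Lemma flat_at_linear x : linear (@flat_at x).
Proof.
move=> a u v; apply: altform_ext => X; rewrite altformD !altformZ.
rewrite -[Defs.interior _ _ _]/(Phi x (vcons _ X)) altform_vcons_lin.
by rewrite -[Defs.interior u _ _]/(Phi x (vcons _ X)) -[Defs.interior v _ _]/(Phi x (vcons _ X)); ring.
Qed.

Lemma sharp_flat_sharp x (a : altform m (fib A x)) :
  sharp Pi (flat_at (sharp Pi a)) = sharp Pi a.
Proof.
have [e [c ec]] := fib_dual A x; have [X XP] := nambu_decomp PiN A_spanned x m2.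
rewrite /flat_at sharpZ.
rewrite [X in _ *: X](sharp_projection ec a XP (PhiE x)) scalerA.
by rewrite -signr_odd -signr_addb addbb scale1r.
Qed.

Definition sflat (X : sections) (XS : sect X) : sform S A m := (-1) ^+ m *: iform XS Phi.

Lemma sflatE X XS x : @sflat X XS x = flat_at (X x).
Proof. by []. Qed.

Lemma image_spanP x (v : fib A x) :
  (v \in lspan (range (@sharp R M A m Pi x))) <-> exists a, sharp Pi a = v.
Proof.
rewrite lspanP; first by split=> [[a _ <-]|[a <-]]; exists a.
  by exists 0 => //; apply: linear_fun0; exact: sharp_linear.
by move=> t _ _ [a _ <-] [b _ <-]; exists (t *: a + b) => //; exact: sharp_linear.
Qed.

Lemma sharp_in x (a : altform m (fib A x)) :
  sharp Pi a \in lspan (range (@sharp R M A m Pi x)).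
Proof. by apply/image_spanP; exists a. Qed.

Definition to_image x (a : altform m (fib A x)) : fib D x := exist _ (sharp Pi a) (sharp_in a).

Lemma to_image_val x (a : altform m (fib A x)) : val (to_image a) = sharp Pi a.
Proof. by []. Qed.

Lemma to_image_linear x : linear (@to_image x).
Proof. by move=> a u v; apply: val_inj; rewrite linearP /=; exact: sharp_linear. Qed.

Lemma to_image_surj x (v : fib D x) : exists a, to_image a = v.
Proof.
have /image_spanP[a aE] := valP v.
by exists a; apply: val_inj; rewrite /= aE.
Qed.

Lemma to_image_flat x (v : fib D x) : to_image (flat_at (val v)) = v.
Proof.
by have [a <-] := to_image_surj v; apply: val_inj; exact: sharp_flat_sharp.
Qed.

Lemma to_image_sec (a : sform S A m) : @sec R M D (fun x => to_image (a x)).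
Proof. exact: sharp_sec. Qed.

Lemma image_spanning : spanning D.
Proof.
move=> x v; have [a <-] := to_image_surj v; have [w <-] := form_through a.
by exists (fun y => to_image (w y)) => //; exact: to_image_sec.
Qed.

Lemma val_linear x : linear (fun v : fib D x => val v : fib A x).
Proof. by move=> a u v; rewrite linearP. Qed.

(** Involutivity of D: a smooth section of D is sharp of the smooth form [sflat], and
    [sharp_bracket] keeps brackets of such sections in D. So the default of [insubd] is not
    reached. *)
Lemma image_br (X Y : forall x, fib D x) x : @sec R M D X -> @sec R M D Y ->
  val (br X Y x) = br (fun y => val (X y) : fib A y) (fun y => val (Y y)) x.
Proof.
move=> XS YS; pose X' : sections := fun y => val (X y); pose Y' : sections := fun y => val (Y y).
have XE (Z : forall x, fib D x) (ZS : sect (fun y => val (Z y))) :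
    (fun y => val (Z y) : fib A y) = fun y => sharp Pi (sflat ZS y).
  apply: functional_extensionality_dep => y; rewrite sflatE.
  by rewrite -{1}(to_image_flat (Z y)).
rewrite /br /= insubdK// (XE _ XS) (XE _ YS) -sharp_bracket//.
exact: sharp_in.
Qed.

Lemma restrict_formE k (w : sform S A k) x V :
  restrict_form Pi w x V = w x (fun i => val (V i)).
Proof. by []. Qed.

Lemma koszul_restrict k (w : sform S A k) (X : 'I_k.+1 -> forall x, fib D x) x :
  (forall i, @sec R M D (X i)) ->
  koszul (restrict_form Pi w) X x = koszul w (fun i y => val (X i y) : fib A y) x.
Proof.
move=> XS; apply: (koszul_map (s := fun y (v : fib D y) => val v : fib A y)).
- exact: val_linear.
- by [].
- by [].
by move=> i j; exact: image_br.
Qed.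

(** The restriction of d w satisfies the Koszul formula on sections of D, and hence is the form that
    [dform] describes there. *)
Lemma restrict_dform k (w : sform S A k) :
  restrict_form Pi (dform w) = dform (restrict_form Pi w).
Proof.
apply/esym/(form_ofE image_spanning) => X XS x.
rewrite koszul_restrict// restrict_formE.
by rewrite -(dformE w (X := fun i y => val (X i y) : fib A y)).
Qed.

Lemma restrict_lin k a (v w : sform S A k) :
  restrict_form Pi (a *: v + w) = a *: restrict_form Pi v + restrict_form Pi w.
Proof. by apply: sform_ext => x; apply: altform_ext. Qed.

Lemma restrict_fscale k (f : smooth_fun S) (w : sform S A k) :
  restrict_form Pi (fscale f w) = fscale f (restrict_form Pi w).
Proof. by apply: sform_ext => x; apply: altform_ext. Qed.

Lemma restrict_eq0 k (w : sform S A k) : restrict_form Pi w = 0 <-> vanishing Pi w.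
Proof.
split=> [w0 eta x|w0].
  have := congr1 (fun u : sform S D k => u x (fun i => to_image (eta i x))) w0.
  by rewrite restrict_formE.
apply: sform_ext => x; apply: altform_ext => V.
have ex i : exists a : sform S A m, to_image (a x) = V i.
  have [a <-] := to_image_surj (V i); have [u <-] := form_through a.
  by exists u.
have [eta etaE] := choice ex; rewrite restrict_formE.
have -> : (fun i => val (V i)) = fun i => sharp Pi (eta i x).
  by apply/funext => i; rewrite -etaE.
exact: w0.
Qed.

Lemma vclass_eq k (v w : sform S A k) :
  vclass Pi v = vclass Pi w <-> restrict_form Pi v = restrict_form Pi w.
Proof.
have rB : restrict_form Pi (v - w) = restrict_form Pi v - restrict_form Pi w.
  by rewrite addrC -scaleN1r restrict_lin scaleN1r addrC.
rewrite /vclass; split=> [/class_ofE|vw].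
  rewrite lspanP.
  - by move=> /restrict_eq0; rewrite rB => /eqP; rewrite subr_eq0 => /eqP.
  - by apply/restrict_eq0; apply: sform_ext => x; apply: altform_ext.
  by move=> a u1 u2 /restrict_eq0 h1 /restrict_eq0 h2; apply/restrict_eq0;
    rewrite restrict_lin h1 h2 scaler0 addr0.
apply/class_ofE; rewrite lspanP.
- by apply/restrict_eq0; rewrite rB vw subrr.
- by apply/restrict_eq0; apply: sform_ext => x; apply: altform_ext.
by move=> a u1 u2 /restrict_eq0 h1 /restrict_eq0 h2; apply/restrict_eq0;
  rewrite restrict_lin h1 h2 scaler0 addr0.
Qed.

Definition proj_image x (v : fib A x) : fib D x := to_image (flat_at v).

Lemma proj_image_linear x : linear (@proj_image x).
Proof. by move=> a u v; rewrite /proj_image flat_at_linear to_image_linear. Qed.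

Lemma extend_smooth k (w : sform S D k) :
  smooth_form S (fun x => precomp (@proj_image_linear x) (w x)).
Proof.
move=> X XS; apply: (sform_smooth w (X := fun i y => proj_image (X i y))) => i.
exact: (to_image_sec (sflat (XS i))).
Qed.

Definition extend_form k (w : sform S D k) : sform S A k := mk_sform (extend_smooth w).

Lemma restrict_extend k (w : sform S D k) : restrict_form Pi (extend_form w) = w.
Proof.
apply: sform_ext => x; apply: altform_ext => V; rewrite restrict_formE.
rewrite -[LHS]/(w x (fun i => proj_image (val (V i)))); congr (w x _).
by apply/funext => i; exact: to_image_flat.
Qed.

(** Classes are told apart by restriction, which commutes with d. So the class of d w depends only
    on that of w, and the described value exists. *)
Lemma cdiff_vclass k (w : sform S A k) :
  cdiff (vclass Pi w : cobj (vanishing_quotient Pi) k) = vclass Pi (dform w).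
Proof.
rewrite /=; set Q := [set q' | _].
have Qw : Q (vclass Pi (dform w)).
  by move=> v /vclass_eq vw; apply/vclass_eq; rewrite !restrict_dform vw.
have QQ : Q (the 0 Q) by apply: the_spec; exists (vclass Pi (dform w)).
exact: QQ.
Qed.

Definition restrict_class k (q : cobj (vanishing_quotient Pi) k) :
    cobj (forms S D) k := restrict_form Pi (rep q).

Lemma restrict_classE k (w : sform S A k) :
  restrict_class (vclass Pi w : cobj (vanishing_quotient Pi) k) = restrict_form Pi w.
Proof. by apply/vclass_eq; exact: rep_class. Qed.

Lemma restrict_class_linear k : linear (@restrict_class k).
Proof.
move=> a p q; rewrite -(rep_class p) -(rep_class q).
rewrite -[a *: _]/(quotient_scale a (class_of _ (rep p))) -class_ofZ -class_ofD.
by rewrite -!/(vclass Pi _) !restrict_classE restrict_lin.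
Qed.

HB.instance Definition _ k := GRing.isLinear.Build R
  (cobj (vanishing_quotient Pi) k) (cobj (forms S D) k) *:%R (@restrict_class k)
  (@restrict_class_linear k).

Lemma restrict_class_bij k : bijective (@restrict_class k).
Proof.
exists (fun w : sform S D k => vclass Pi (extend_form w)) => [q|w].
  by rewrite -[RHS](rep_class q); apply/vclass_eq; rewrite restrict_extend.
by rewrite restrict_classE restrict_extend.
Qed.

Lemma restrict_class_diff k (q : cobj (vanishing_quotient Pi) k) :
  restrict_class (cdiff q) = cdiff (restrict_class q).
Proof.
rewrite -(rep_class q) -/(vclass Pi (rep q)) cdiff_vclass !restrict_classE.
exact: restrict_dform.
Qed.

Definition sharp_class x (q : fib C x) : fib D x := to_image (rep q).

Lemma ker_spanP x (a : altform m (fib A x)) :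
  (a \in lspan [set a : altform m (fib A x) | sharp Pi a = 0]) <-> sharp Pi a = 0.
Proof.
have sl := @sharp_linear R d M S r A m Pi x.
rewrite lspanP//=; first exact: (linear_fun0 sl).
by move=> t u v u0 v0; rewrite sl u0 v0 scaler0 addr0.
Qed.

Lemma coimage_class_eq x (a b : altform m (fib A x)) :
  class_of [set a : altform m (fib A x) | sharp Pi a = 0] a = class_of _ b <->
  sharp Pi a = sharp Pi b.
Proof.
have sl := @sharp_linear R d M S r A m Pi x.
have sB : sharp Pi (a - b) = sharp Pi a - sharp Pi b.
  have -> : a - b = -1 *: b + a by rewrite scaleN1r addrC.
  by rewrite sl scaleN1r addrC.
rewrite class_ofE ker_spanP sB; split=> [/eqP|->]; last by rewrite subrr.
by rewrite subr_eq0 => /eqP.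
Qed.

Lemma sharp_classE x (a : altform m (fib A x)) :
  sharp_class (class_of _ a : fib C x) = to_image a.
Proof. by apply: val_inj; rewrite /=; apply/coimage_class_eq; exact: rep_class. Qed.

Lemma sharp_class_linear x : linear (@sharp_class x).
Proof.
move=> t p q; rewrite -(rep_class p) -(rep_class q).
rewrite -[t *: _]/(quotient_scale t (class_of _ (rep p))) -class_ofZ -class_ofD.
by rewrite !sharp_classE to_image_linear.
Qed.

Definition flat_class x (v : fib D x) : fib C x := class_of _ (flat_at (val v)).

Lemma flat_class_linear x : linear (@flat_class x).
Proof.
move=> t u v; rewrite /flat_class linearP flat_at_linear class_ofD class_ofZ.
by [].
Qed.

Lemma flat_classK x : cancel (@flat_class x) (@sharp_class x).
Proof. by move=> v; rewrite sharp_classE to_image_flat. Qed.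

Lemma sharp_classK x : cancel (@sharp_class x) (@flat_class x).
Proof.
move=> q; rewrite -[RHS]rep_class; apply/coimage_class_eq.
exact: sharp_flat_sharp.
Qed.

Lemma sharp_class_sec (X : forall x, fib C x) : @sec R M C X ->
  @sec R M D (fun x => sharp_class (X x)).
Proof.
move=> [a ->]; have := to_image_sec a; congr (@sec R M D _).
by apply: functional_extensionality_dep => x; rewrite sharp_classE.
Qed.

(** Sections of the coimage are classes of global smooth forms; [sflat] gives such a form in one
    formula, with no local representatives to glue. *)
Lemma flat_class_sec (X : forall x, fib D x) : @sec R M D X ->
  @sec R M C (fun x => flat_class (X x)).
Proof. by move=> XS; exists (sflat XS). Qed.

Lemma coimage_spanning : spanning C.
Proof.
move=> x q; have [w wE] := form_through (rep q).
exists (coimage_class Pi w); first by exists w.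
by rewrite /coimage_class wE; exact: rep_class.
Qed.

(** sharp maps [form_bracket] to the bracket of the images, so its class does not depend on the
    representatives, and the bracket described on the coimage exists. *)
Lemma coimage_br (X Y : forall x, fib C x) x : @sec R M C X -> @sec R M C Y ->
  sharp_class (br X Y x) =
  br (fun y => sharp_class (X y)) (fun y => sharp_class (Y y)) x.
Proof.
move=> XS YS; apply: val_inj; rewrite image_br; try exact: sharp_class_sec.
case: XS => a Xa; case: YS => b Yb.
have E (Z : forall x, fib C x) (c : sform S A m) : Z = coimage_class Pi c ->
    (fun y => val (sharp_class (Z y)) : fib A y) = fun y => sharp Pi (c y).
  by move=> ->; apply: functional_extensionality_dep => y; rewrite sharp_classE.
rewrite (E _ _ Xa) (E _ _ Yb).
pose Q : set (forall x, fib C x) := [set u | forall a b : sform S A m,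
  X = coimage_class Pi a -> Y = coimage_class Pi b ->
  u = coimage_class Pi (form_bracket Pi a b)].
have QQ : Q (br X Y).
  apply: the_spec; exists (coimage_class Pi (form_bracket Pi a b)) => a' b' Xa' Yb'.
  apply: functional_extensionality_dep => y; apply/coimage_class_eq.
  by rewrite !sharp_bracket// -(E _ _ Xa) -(E _ _ Xa') -(E _ _ Yb) -(E _ _ Yb').
rewrite (QQ a b Xa Yb) sharp_classE to_image_val.
exact: sharp_bracket.
Qed.

Lemma pull_smooth k (w : sform S D k) :
  smooth_form S (fun x => precomp (@sharp_class_linear x) (w x)).
Proof.
move=> X XS; apply: (sform_smooth w (X := fun i y => sharp_class (X i y))) => i.
exact: sharp_class_sec.
Qed.

Definition pull_form k (w : cobj (forms S D) k) : cobj (forms S C) k :=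
  mk_sform (pull_smooth w).

Lemma pull_formE k (w : sform S D k) x V :
  (pull_form w : sform S C k) x V = w x (@sharp_class x \o V).
Proof. by []. Qed.

Lemma pull_form_linear k : linear (@pull_form k).
Proof. by move=> a v w; apply: sform_ext => x; apply: altform_ext. Qed.

HB.instance Definition _ k := GRing.isLinear.Build R
  (cobj (forms S D) k) (cobj (forms S C) k) *:%R (@pull_form k) (@pull_form_linear k).

Lemma push_smooth k (w : sform S C k) :
  smooth_form S (fun x => precomp (@flat_class_linear x) (w x)).
Proof.
move=> X XS; apply: (sform_smooth w (X := fun i y => flat_class (X i y))) => i.
exact: flat_class_sec.
Qed.

Lemma pull_form_bij k : bijective (@pull_form k).
Proof.
exists (fun w : sform S C k => mk_sform (push_smooth w) : sform S D k) => w;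
  apply: sform_ext => x; apply: altform_ext => V.
  rewrite -[LHS]/(w x (fun i => sharp_class (flat_class (V i)))); congr (w x _).
  by apply/funext => i; rewrite flat_classK.
rewrite -[LHS]/(w x (fun i => flat_class (sharp_class (V i)))); congr (w x _).
by apply/funext => i; rewrite sharp_classK.
Qed.

(** Every form on D is the restriction of its extension, so the Koszul formula on D is inherited
    from A. *)
Lemma image_dformE k (w : sform S D k) (X : 'I_k.+1 -> forall x, fib D x) x :
  (forall i, @sec R M D (X i)) -> dform w x (fun i => X i x) = koszul w X x.
Proof.
move=> XS; rewrite -(restrict_extend w) -restrict_dform koszul_restrict// restrict_formE.
by rewrite -(dformE _ (X := fun i y => val (X i y) : fib A y)).
Qed.

(** As for restriction: the pullback of d w satisfies the Koszul formula on the coimage, and hence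
    is the form described there. *)
Lemma pull_form_diff k (w : cobj (forms S D) k) :
  pull_form (cdiff w) = cdiff (pull_form w).
Proof.
apply/esym/(form_ofE coimage_spanning) => X XS x; rewrite pull_formE.
have sXS i : @sec R M D (fun y => sharp_class (X i y)) by exact: sharp_class_sec.
rewrite -[LHS]/(dform w x (fun i => (fun i y => sharp_class (X i y)) i x)) image_dformE//.
apply/esym/(koszul_map (s := sharp_class)) => //.
  exact: sharp_class_linear.
by move=> i j; exact: coimage_br.
Qed.

Lemma nambu_cohomology_iso k : lmod_isomorphic
  (cohomology (forms S C) k) (cohomology (vanishing_quotient Pi) k).
Proof.
apply: lmod_isomorphic_sym.
apply: (@chain_iso_cohomology _ _ _ (fun k => @pull_form k \o @restrict_class k)) => j.
  by apply: bij_comp; [exact: pull_form_bij|exact: restrict_class_bij].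
by move=> z /=; rewrite restrict_class_diff pull_form_diff.
Qed.

End Complexes.

Theorem proposition4p2 (R : realType) (d : nat) (M : topologicalType)
    (S : manifold R d M) (M_paracompact : paracompact M)
    (r m : nat) (order_ge3 : (3 <= m.+1)%N)
    (A : lie_algebroid S r) (Pi : mvector_field A m.+1)
    (Pi_nambu : regular_nambu Pi)
    (A_spanned : locally_spanned_by_exact A) :
  (forall k (f : smooth_fun S) (v w : sform S A k),
     restrict_form Pi (fscale f v + w) = fscale f (restrict_form Pi v) + restrict_form Pi w) /\
  (exists pi : forall k, {linear cobj (vanishing_quotient Pi) k ->
                                 cobj (forms S (image_data Pi)) k},
     [/\ forall k (w : sform S A k),
           pi k (vclass Pi w) = restrict_form Pi w,
         forall k, bijective (pi k),
         forall k (f : smooth_fun S) (w : sform S A k),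
           pi k (vclass Pi (fscale f w)) =
           fscale f (pi k (vclass Pi w)) &
         forall k (q : cobj (vanishing_quotient Pi) k),
           pi k.+1 (cdiff q) = cdiff (pi k q)]) /\
  (forall k, lmod_isomorphic (cohomology (forms S (coimage_data Pi)) k)
                             (cohomology (vanishing_quotient Pi) k)).
Proof.
have [Phi PhiE] := nambu_volume Pi_nambu M_paracompact.
split=> [k f v w|]; first by apply: sform_ext => x; apply: altform_ext.
split; last first.
  exact: (nambu_cohomology_iso Pi_nambu A_spanned order_ge3 PhiE).
exists (fun k => @restrict_class R d M S r A m Pi k); split=> [k w|k|k f w|k q].
- exact: restrict_classE.
- exact: (restrict_class_bij Pi_nambu A_spanned order_ge3 PhiE).
- by rewrite /= !restrict_classE restrict_fscale.
- exact: (restrict_class_diff Pi_nambu A_spanned order_ge3 PhiE).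
Qed.
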